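(* Let $q\in\mathbb N_1$. For every Borel probability measure $\mu$ on the polychromatic Kingman simplex $\boldsymbol\nabla^{(q)}_0$ and every $n\in\mathbb N_0$, the assignment $$P_n\colon A\longmapsto \int_{\boldsymbol\nabla^{(q)}_0}\psi_A(\mathbf x)\,d\mu(\mathbf x),\qquad A\in\mathcal A^{(q)}_n,\qquad ( * )$$ defines a probability measure $P_n$ on $\mathcal A^{(q)}_n$, and the family $(P_n)_{n\ge 0}$ is a $q$-chromatic partition structure. Conversely, every $q$-chromatic partition structure $(P_n)_{n\geq 0}$ is represented by $( * )$ (for all $n\in\mathbb N_0$) for one and only one Borel probability measure $\mu$ on $\boldsymbol\nabla^{(q)}_0$.
   Context: Notation: $\mathbb N_1=\{1,2,\dots\}$, $\mathbb N_0=\{0,1,2,\dots\}$, $[q]=\{1,\dots,q\}$, $\mathbb N^q_*=\mathbb N_0^q\setminus\{\mathbf 0\}$, $0^0=1$. For vectors: $|\mathbf a|=\sum_j|a_j|$, $\mathbf a!=\prod_j a_j!$, $\mathbf x^{\mathbf a}=\prod_j x_j^{a_j}$; $\mathbf e_j$ is the $j$-th canonical basis vector. A $q$-chromatic partition of $n\in\mathbb N_0$ is a finitely supported map (multiset) $A\colon\mathbb N^q_*\to\mathbb N_0$ with $\sum_{\mathbf a}A(\mathbf a)|\mathbf a|=n$ ($A(\mathbf a)$ is the number of blocks with color count $\mathbf a$); $\mathcal A^{(q)}_n$ is the set of these (so $\mathcal A^{(q)}_0=\{0\}$). $\mathbf 1_{\mathbf a}$ is the multiset with the single element $\mathbf a$;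 sums, differences and $\le$ of multisets are pointwise; $\mathrm{supp}\,A$ is the support and $s(A)=\sum_{\mathbf a}A(\mathbf a)$. Partition structures: for $A\in\mathcal A^{(q)}_n$, $\mathbf a\in\mathrm{supp}\,A$ and $j\in[q]$ with $a_j\ge1$ set $A_{\setminus\mathbf a,j}=A-\mathbf 1_{\mathbf a}$ if $\mathbf a=\mathbf e_j$ and $A_{\setminus\mathbf a,j}=A-\mathbf 1_{\mathbf a}+\mathbf 1_{\mathbf a-\mathbf e_j}$ otherwise. Set $S_{n,n}(A,B)=1$ if $A=B$ and $0$ otherwise; for $n\ge1$, $A\in\mathcal A^{(q)}_n$, $B\in\mathcal A^{(q)}_{n-1}$, set $S_{n-1,n}(A,B)=a_jA(\mathbf a)/n$ if $B=A_{\setminus\mathbf a,j}$ for some (necessarily unique) $(\mathbf a,j)$, and $0$ otherwise; extend by $S_{\ell,n}(A,C)=\sum_{B\in\mathcal A^{(q)}_m}S_{\ell,m}(B,C)S_{m,n}(A,B)$ for $\ell<m<n$. A $q$-chromatic partition structure is a sequence $(P_n)_{n\ge0}$ of probability measures $P_n$ on $\mathcal A^{(q)}_n$ with $P_m[B]=\sum_{A\in\mathcal A^{(q)}_n}P_n[A]S_{m,n}(A,B)$ for all $m\le n$, $B\in\mathcal A^{(q)}_m$. Kingman simplex: the shortlex order on $[0,\infty)^q$ is $\mathbf s<_{\mathrm{sl}}\mathbf t$ iff $(|\mathbf s|,s_1,\dots,s_q)<(|\mathbf t|,t_1,\dots,t_q)$ lexicographically. $\boldsymbol\nabla^{(q)}_0$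 is the set of sequences $\mathbf x=(\mathbf x_i)_{i\ge0}$, $\mathbf x_i=(x_{i,1},\dots,x_{i,q})\in[0,\infty)^q$, with $\mathbf x_i\ge_{\mathrm{sl}}\mathbf x_{i+1}$ for $i\ge1$ and $\sum_{i\ge0}|\mathbf x_i|=1$, with the Borel $\sigma$-algebra of the product topology inherited from $([0,1]^q)^{\mathbb N_0}$. For $A\in\mathcal A^{(q)}_n$, let $(\mathbf a_h)_{h\in[s(A)]}$ list all $\mathbf a\in\mathrm{supp}\,A$ with multiplicity $A(\mathbf a)$, decreasingly in shortlex order, and let $T_r$ be the set of injective maps $[r]\to\mathbb N_1$ ($T_0=\{\varnothing\}$). Set $\varphi_0\equiv1$ and $$\varphi_A(\mathbf x)=n!\Big(\prod_{\mathbf a\in\mathrm{supp}A}\frac1{\mathbf a!^{A(\mathbf a)}A(\mathbf a)!}\Big)\sum_{\iota\in T_{s(A)}}\prod_{h=1}^{s(A)}\mathbf x_{\iota(h)}^{\mathbf a_h}.$$ For $\mathbf m\in\mathbb N_0^q$ put $\mathrm{dust}(\mathbf m)=m_1\mathbf 1_{\mathbf e_1}+\dots+m_q\mathbf 1_{\mathbf e_q}$, and set $\psi_0\equiv1$ and $$\psi_A(\mathbf x)=n!\sum_{\mathbf m\in\mathbb N_0^q:\ \mathrm{dust}(\mathbf m)\le A}\frac{\mathbf x_0^{\mathbf m}}{\mathbf m!\,(n-|\mathbf m|)!}\,\varphi_{A-\mathrm{dust}(\mathbf m)}(\mathbf x).$$ *)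

(* Defs.v *)
From HB Require Import structures.
From mathcomp Require Import all_boot all_order all_algebra finmap.
From mathcomp.finmap Require Import multiset.
From mathcomp Require Import all_classical all_reals all_analysis.
Set Implicit Arguments.
Unset Strict Implicit.
Unset Printing Implicit Defensive.
Import Order.TTheory GRing.Theory Num.Theory.
Import numFieldNormedType.Exports.
Local Open Scope classical_set_scope.
Local Open Scope ring_scope.

HB.instance Definition _ (K : choiceType) :=
  Monoid.isComLaw.Build {mset K}%mset mset0 (@msetD K)
    (@msetDA K) (@msetDC K) (@mset0D K).

Notation color_count q := {ffun 'I_q -> nat}.

Section Multisets.
Variable q : nat.
Implicit Types (a m : color_count q) (A B : {mset color_count q}%mset).

Definition color_size a : nat := (\sum_j a j)%N.

Definition vfact a : nat := (\prod_j (a j)`!)%N.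

Definition unit_count (j : 'I_q) : color_count q := [ffun k => nat_of_bool (k == j)].

Definition weight A : nat := (\sum_(a <- finsupp A) A a * color_size a)%N.

(* Multisets on N_0^q \ {0} are encoded as multisets on N_0^q in which 0 has
   multiplicity 0. *)
Definition is_chromatic_partition (n : nat) A : bool :=
  (A [ffun=> 0%N] == 0%N) && (weight A == n).

Definition remove_color A a (j : 'I_q) : {mset color_count q}%mset :=
  if a == unit_count j then (A `\ a)%mset
  else ([ffun k => (a k - unit_count j k)%N] +` (A `\ a))%mset.

Definition dust m : {mset color_count q}%mset :=
  \big[msetD/mset0]_j msetn (m j) (unit_count j).

End Multisets.

Section ChromaticPartition.
Variables q n : nat.

Record chromatic_partition := ChromaticPartition {
  mset_of_cp :> {mset color_count q}%mset ;
  cpP : is_chromatic_partition n mset_of_cp }.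

HB.instance Definition _ := [isSub for mset_of_cp].
HB.instance Definition _ := [Choice of chromatic_partition by <:].

Lemma cp_bounded (A : chromatic_partition) (a : color_count q) :
  a \in finsupp (mset_of_cp A) -> ((mset_of_cp A a <= n)%N * (forall j, (a j <= n)%N))%type.
Proof.
case: A => A /= /andP[/eqP A0 /eqP wA] aA.
have Aa_gt0 : (0 < A a)%N by rewrite lt0n -mem_finsupp.
have leAa : (A a * color_size a <= n)%N.
  by rewrite -wA /weight (big_fsetD1 a)//= leq_addr.
have a_gt0 : (0 < color_size a)%N.
  rewrite lt0n; apply: contraL Aa_gt0; rewrite /color_size sum_nat_eq0 => /forallP a0.
  rewrite (_ : a = [ffun=> 0%N]) ?A0//; apply/ffunP => j; rewrite ffunE.
  exact/eqP/a0.
split=> [|j]; first by apply: leq_trans leAa; rewrite leq_pmulr.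
apply: leq_trans (leq_trans (leq_pmull (color_size a) Aa_gt0) leAa).
by rewrite /color_size (bigD1 j)//= leq_addr.
Qed.

Definition cp_code (A : chromatic_partition) :
    {ffun {ffun 'I_q -> 'I_n.+1} -> 'I_n.+1} :=
  [ffun b : {ffun 'I_q -> 'I_n.+1} =>
    inord (mset_of_cp A [ffun j => nat_of_ord (b j)])].

Lemma cp_code_inj : injective cp_code.
Proof.
have key (A : chromatic_partition) (a : color_count q) :
    mset_of_cp A a = if [forall j, (a j <= n)%N]
          then nat_of_ord (cp_code A [ffun j => inord (a j)]) else 0%N.
  case: ifPn => [/forallP an|Nan].
    rewrite ffunE (_ : [ffun j => _] = a); last first.
      by apply/ffunP => j; rewrite !ffunE inordK ?ltnS.
    rewrite inordK// ltnS; case: (boolP (a \in finsupp (mset_of_cp A))) => [/cp_bounded[]//|].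
    by rewrite memNfinsupp => /eqP ->.
  apply/eqP; rewrite -memNfinsupp; apply: contra Nan => /cp_bounded[_ an].
  exact/forallP.
move=> A B AB; apply: val_inj; apply/fsfunP => a /=.
by rewrite [LHS]key [RHS]key AB.
Qed.

Definition cp_decode (f : {ffun {ffun 'I_q -> 'I_n.+1} -> 'I_n.+1}) :
    option chromatic_partition :=
  if pselect (exists A, cp_code A == f) is left p then Some (xchoose p)
  else None.

Lemma cp_codeK : pcancel cp_code cp_decode.
Proof.
move=> A; rewrite /cp_decode; case: pselect => [p|[]]; last by exists A.
by congr Some; apply: cp_code_inj; exact/eqP/(xchooseP p).
Qed.

HB.instance Definition _ := PCanIsCountable cp_codeK.
HB.instance Definition _ : fintype.isFinite chromatic_partition :=
  PCanIsFinite cp_codeK.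

End ChromaticPartition.

Lemma cp_point_subproof q n :
  is_chromatic_partition n (msetn n (unit_count (@ord0 q))).
Proof.
have b0 : color_size (unit_count (@ord0 q)) = 1%N.
  rewrite /color_size (bigD1 ord0)//= ffunE eqxx big1 ?addn0// => j /negbTE.
  by rewrite ffunE => ->.
apply/andP; split.
  rewrite msetnE ifN//; apply/eqP => /ffunP/(_ ord0).
  by rewrite !ffunE eqxx.
rewrite /weight; have [->|n0] := eqVneq n 0%N.
  by rewrite big1// => a _; rewrite msetnE if_same mul0n.
by rewrite finsupp_msetn lt0n n0 big_seq_fset1 msetnxx b0 muln1.
Qed.

(* Measurable spaces are nonempty in the library; there is no partition of
   n > 0 without colours, whence q.+1. *)
HB.instance Definition _ q n := isPointed.Build (chromatic_partition q.+1 n)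
  (ChromaticPartition (cp_point_subproof q n)).

HB.instance Definition _ q n := @isMeasurable.Build default_measure_display
  (chromatic_partition q.+1 n) (@discrete_measurable _)
  (@discrete_measurable0 _) (@discrete_measurableC _)
  (@discrete_measurableU _).

Section PartitionStructure.
Variables (R : realType) (q : nat).
Implicit Types A B C : {mset color_count q}%mset.

(* The pair (a, j) is unique when it exists. *)
Definition transition1 (n : nat) A B : R :=
  if [pick p : finsupp A * 'I_q |
        (0 < fsval p.1 p.2)%N && (B == remove_color A (fsval p.1) p.2)] is Some p
  then (fsval p.1 p.2 * A (fsval p.1))%:R / n%:R else 0.

(* S_{l,n} for l <= n, as the matrix product of the one-step kernels; the
   composition rule through any intermediate m follows by associativity. *)
Fixpoint transition (l n : nat) A C {struct n} : R :=
  if n == l then (A == C)%:R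
  else if n is n'.+1 then
    \sum_(B : chromatic_partition q n') transition l n' B C * transition1 n A B
  else 0.

End PartitionStructure.

Definition partition_structure (R : realType) (q : nat)
    (P : forall n, probability (chromatic_partition q.+1 n) R) : Prop :=
  forall m n : nat, (m <= n)%N -> forall B : chromatic_partition q.+1 m,
    P m [set B] =
    (\sum_(A : chromatic_partition q.+1 n)
      P n [set A] * (transition R m n A B)%:E)%E.

Section KingmanSimplex.
Variables (R : realType) (q : nat).

Definition vnorm (T : realDomainType) (s : 'I_q -> T) : T := \sum_j `|s j|.

Definition shortlex_le (T : realDomainType) (s t : 'I_q -> T) : bool :=
  let key (u : 'I_q -> T) : seqlexi T := vnorm u :: codom u in
  (key s <= key t)%O.

Definition kingman_set : set {ptws nat -> {ptws 'I_q -> R}} :=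
  [set x | [/\ forall i j, 0 <= x i j,
               forall i, (1 <= i)%N -> shortlex_le (x i.+1) (x i) &
               (\sum_(0 <= i <oo) (vnorm (x i))%:E = 1)%E]].

Definition kingman_simplex : Type := set_type kingman_set.

HB.instance Definition _ := Topological.copy kingman_simplex
  (set_type kingman_set).

Definition coords (x : kingman_simplex) : nat -> 'I_q -> R := set_val x.

End KingmanSimplex.

Arguments kingman_set : clear implicits.

Definition kingman_point (R : realType) (q : nat) :
    {ptws nat -> {ptws 'I_q.+1 -> R}} :=
  fun i j => ((i == 0%N) && (j == ord0))%:R.

Arguments kingman_point : clear implicits.

Lemma kingman_pointP (R : realType) (q : nat) :
  kingman_point R q \in kingman_set R q.+1.
Proof.
apply/mem_set; split => [i j|i i1|]; first by rewrite ler0n.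
  rewrite (_ : kingman_point R q i = kingman_point R q i.+1) ?/shortlex_le//.
  by apply/funext => j; rewrite /kingman_point -(prednK i1).
rewrite nneseries_recl//; last by move=> i _; rewrite lee_fin sumr_ge0.
rewrite eseries0 ?adde0; last first.
  by move=> [//|i] _ _; rewrite /vnorm big1// => j _; rewrite normr0.
rewrite /vnorm (bigD1 ord0)//= big1 ?addr0 ?normr1// => j /negbTE jn0.
by rewrite /kingman_point jn0 andbF normr0.
Qed.

HB.instance Definition _ R q := isPointed.Build (kingman_simplex R q.+1)
  (exist _ (kingman_point R q) (kingman_pointP R q)).

(* Here and in represents below, the number of colours is q.+1. *)
Definition borel_kingman_simplex (R : realType) (q : nat) :=
  g_sigma_algebraType (@open (kingman_simplex R q.+1)).

Section SamplingFunctions.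
Variables (R : realType) (q : nat).
Implicit Types (A : {mset color_count q}%mset) (x : nat -> 'I_q -> R).
Local Open Scope ereal_scope.

Definition monomial (s : 'I_q -> R) (a : color_count q) : R :=
  (\prod_j s j ^+ a j)%R.

(* enum_mset repeats each element according to its multiplicity; the sort is
   decreasing. *)
Definition blocks A : seq (color_count q) :=
  sort (fun a b : color_count q => shortlex_le (fun j => (b j)%:Z) (fun j => (a j)%:Z))
       (enum_mset A).

(* No special case is needed for A = 0: there is then one (empty) injection,
   with empty product 1. *)
Definition phi A x : \bar R :=
  let s := size (blocks A) in
  ((weight A)`!%:R *
   \prod_(a <- finsupp A) ((vfact a)%:R ^+ A a * (A a)`!%:R)^-1)%:E *
  \esum_(iota in [set iota : {ffun 'I_s -> nat} |
                   injective iota /\ forall h, (1 <= iota h)%N])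
     (\prod_(h < s) monomial (x (iota h)) (nth [ffun=> 0%N] (blocks A) h))%:E.

(* dust m <= A forces m_j <= A(e_j), so the sum is finite. *)
Definition psi A x : \bar R :=
  (weight A)`!%:R%:E *
  \sum_(m \in [set m : color_count q | (dust m `<=` A)%mset])
     (monomial (x 0%N) m / ((vfact m)%:R * (weight A - color_size m)`!%:R))%:E *
     phi (A `\` dust m)%mset x.

End SamplingFunctions.

Definition represents (R : realType) (q : nat)
    (mu : probability (borel_kingman_simplex R q) R)
    (P : forall n, probability (chromatic_partition q.+1 n) R) : Prop :=
  forall (n : nat) (A : chromatic_partition q.+1 n),
    (P n [set A] = \int[mu]_x psi A (coords x))%E.

(* Main.v *)
Require Import Defs.
From HB Require Import structures.
From mathcomp Require Import all_boot all_order all_algebra finmap.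
From mathcomp.finmap Require Import multiset.
From mathcomp Require Import all_classical all_reals all_analysis measurable_realfun.
From mathcomp Require Import zify ring lra.
Set Implicit Arguments.
Unset Strict Implicit.
Unset Printing Implicit Defensive.
Import Order.TTheory GRing.Theory Num.Theory.
Import numFieldNormedType.Exports.
Local Open Scope classical_set_scope.
Local Open Scope ring_scope.

(** The partition of [n] items sampled from the atoms and the dust of a point [x] of the
simplex is [A] with probability [psi A x]. Mixtures of these laws are partition structures
because removing an item from a sample leaves a sample. The converse and the uniqueness of
the mixing measure rest on the following ideas.

Sampling functions are sums over the placements of items in boxes ([seat_sum]): box [0] is
the dust, and the other boxes are the atoms, which hold at most one block each. They obey one
recursion, [seat_sum_rec]: a further item goes to a free box or joins an item that has been
placed. With the combinatorial identity [harmonic_partition], this yields the consistency of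
the functions [psi] ([sampling_prob_step]); with falling factorials in place of monomials, it
yields a formula for the transition probabilities ([transition_hypergeometric]). Drawing with
or without replacement from a large population being almost the same, the transition
probability from [A] to [B] is close to the sampling function of [B] at the empirical point
of [A], whose atoms are the blocks of [A] divided by their total size
([transition_sampling]).

Existence. By consistency, [P n] is almost the mean of the sampling functions at the empirical
points of partitions of a large integer [N] under [P N]. As the simplex is not compact,
the limit is taken for the values of the sampling functions instead of the points:
[random_limits] realizes it as a random family of numbers on the unit interval with Lebesgue
measure, by cutting the interval into cells that reflect the binary digits of these
values. Each realization is a limit of the sampling functions of a sequence of points. By
[sampling_closed] it is the family of the sampling functions of some point, the mass that
escapes to small atoms turning into dust. This random point is measurable by
[measurable_point], and its law is the measure sought.

Uniqueness. By the recursion, the span of the sampling functions contains the products of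
power sums. The integrals of these products determine the measures of the boxes defined by
the power sums ([threshold_class]), and the boxes generate the Borel sets: the coordinates
of a point generate them ([measurable_to_kingman]), and are measurable functions of the
power sums, the atoms being recovered from the largest on ([measurable_point]). *)

(** * Sums over infinite index sets *)

Section Esum.
Variable R : realType.

Lemma esumZl (I : choiceType) (D : set I) (c : R) (a : I -> \bar R) : 0 <= c ->
  (forall i, D i -> 0 <= a i)%E ->
  (\esum_(i in D) (c%:E * a i) = c%:E * \esum_(i in D) a i)%E.
Proof.
move=> c0 a0.
have le_esumZl (k : R) (b : I -> \bar R) : 0 <= k ->
    (forall i, D i -> 0 <= b i)%E ->
    (\esum_(i in D) (k%:E * b i) <= k%:E * \esum_(i in D) b i)%E.
  move=> k0 b0; apply: ge_ereal_sup => /= _ [X [finX XD] <-].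
  rewrite fsbig_finite//= big_seq.
  rewrite -ge0_sume_distrr; last first.
    by move=> i; rewrite in_fset_set// inE => /XD/b0.
  apply: lee_wpmul2l; first by rewrite lee_fin.
  by apply: ereal_sup_ubound; exists X => //; rewrite fsbig_finite//= [LHS]big_seq.
apply/eqP; rewrite eq_le le_esumZl//=.
move: c0; rewrite [0 <= c]le_eqVlt => /predU1P[<-|c0].
  by rewrite mul0e; apply: esum_ge0 => i Di; rewrite mul0e.
rewrite -[leRHS]mul1e -(@divff _ c) ?gt_eqF// EFinM -muleA.
apply: lee_wpmul2l; first by rewrite lee_fin ltW.
apply: (@le_trans _ _ (\esum_(i in D) (c^-1%:E * (c%:E * a i)))%E); last first.
  apply: le_esumZl; first by rewrite invr_ge0 ltW.
  by move=> i Di; rewrite mule_ge0 ?lee_fin ?(ltW c0)// a0.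
by apply: le_esum => i Di; rewrite muleA -EFinM mulVf ?gt_eqF// mul1e.
Qed.

Lemma esum_seq_cons (a : seq nat -> \bar R) : (forall t, 0 <= a t)%E ->
  (\esum_(t in [set: seq nat]) a t =
    a [::] + \esum_(t in [set: seq nat]) \esum_(i in [set: nat]) a (i :: t))%E.
Proof.
move=> a0; rewrite (esumID [set [::]])// !setTI esum_set1//; congr (_ + _)%E.
rewrite esum_esum//; apply: (reindex_esum _ _ (fun k => k.2 :: k.1)).
split => //=.
- by move=> [t i] [t' i'] _ _ /= [-> ->].
- by move=> [|i t] //= _; exists (t, i).
Qed.

Lemma esum_nat_recl (a : nat -> \bar R) : (forall i, 0 <= a i)%E ->
  (\esum_(i in [set: nat]) a i = a 0%N + \esum_(i in [set: nat]) a i.+1)%E.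
Proof.
move=> a0; rewrite (esumID [set 0%N])// !setTI esum_set1//; congr (_ + _)%E.
apply: (reindex_esum _ _ S); split => //=.
- by move=> i j _ _ [].
- by move=> [|i] //= _; exists i.
Qed.

Lemma esum_nth (T : Type) (z : T) (s : seq T) (f : T -> \bar R) :
  (forall c, 0 <= f c)%E -> f z = 0%E ->
  (\esum_(i in [set: nat]) f (nth z s i) = \sum_(c <- s) f c)%E.
Proof.
move=> f0 fz; elim: s => [|c s ih].
  by rewrite big_nil esum1// => i _; rewrite nth_nil.
by rewrite esum_nat_recl// big_cons ih.
Qed.

Lemma sum_le_esum (T : choiceType) (a : T -> \bar R) (s : seq T) :
  (forall i, 0 <= a i)%E -> uniq s ->
  (\sum_(i <- s) a i <= \esum_(i in [set: T]) a i)%E.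
Proof.
move=> a0 us; apply: esum_ge; exists [set` s]; first by split.
by rewrite -fsbig_seq.
Qed.

Lemma esum_nat_split (a : nat -> \bar R) I : (forall i, 0 <= a i)%E ->
  (\esum_(i in [set: nat]) a i =
   \sum_(i < I) a i + \esum_(i in [set: nat]) a (I + i)%N)%E.
Proof.
elim: I a => [|I ih] a a0; first by rewrite big_ord0 add0e.
rewrite esum_nat_recl// (ih (fun i => a i.+1))// big_ord_recl addeA.
by congr (_ + _)%E; apply: eq_esum => i _; rewrite addSn.
Qed.

End Esum.

(** The outcomes of applying [g] to exactly one entry of a list: what can happen to the
blocks of a partition when a new item joins one of them. *)
Fixpoint alterations (T : Type) (g : T -> T) (l : seq T) : seq (seq T) :=
  if l is c :: l' then (g c :: l') :: map (cons c) (alterations g l') else [::].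

Lemma map_alterations (T U : eqType) (f : T -> U) (g : T -> T) (h : U -> U) (l : seq T) :
  {in l, forall c, f (g c) = h (f c)} ->
  map (map f) (alterations g l) = alterations h (map f l).
Proof.
elim: l => //= c l ih fgh; rewrite fgh ?mem_head//; congr cons.
rewrite -map_comp -ih; last by move=> x xl; rewrite fgh// in_cons xl orbT.
by rewrite -map_comp; apply: eq_map.
Qed.

Lemma size_alterations (T : eqType) (g : T -> T) (l l' : seq T) :
  l' \in alterations g l -> size l' = size l.
Proof.
elim: l l' => //= c l ih l'; rewrite in_cons => /predU1P[->//|].
by case/mapP => l'' /ih sz -> /=; rewrite sz.
Qed.

Lemma alterations_all (T : eqType) (g : T -> T) (P : pred T) (l l' : seq T) :
  (forall a, P a -> P (g a)) -> l' \in alterations g l -> all P l -> all P l'.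
Proof.
move=> Pg; elim: l l' => //= c l ih l'; rewrite in_cons => /predU1P[->|] /=.
  by case/andP => /Pg -> ->.
by case/mapP => l'' /ih {}ih -> /= /andP[-> /ih].
Qed.

(** * Placing items in boxes *)

Section WeightedSums.
Variables (R : realType) (T : choiceType) (w : nat -> T -> R).
Hypothesis w_ge0 : forall i a, 0 <= w i a.
Implicit Types (l : seq (bool * T)) (t : seq nat).

(** The items of a list are put into boxes indexed by [nat]. Box [0] models the dust: it
takes flagged items only, but any number of them, whereas each other box holds at most one
item. *)
Definition admits (d : bool) (t : seq nat) (i : nat) : bool :=
  if i == 0%N then d else i \notin t.

Fixpoint seat_weight l t : R :=
  match l, t with
  | [::], [::] => 1
  | c :: l', i :: t' =>
      (if admits c.1 t' i then w i c.2 else 0) * seat_weight l' t'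
  | _, _ => 0
  end.

(** The total weight of the admissible placements of the flagged items [l]. With monomials as
weights this is the sum over injections in the sampling functions, dust included; with
falling factorials it counts draws without replacement. *)
Definition seat_sum l : \bar R :=
  \esum_(t in [set: seq nat]) (seat_weight l t)%:E.

Definition total_weight (d : bool) (b : T) : \bar R :=
  \esum_(i in [set: nat]) (if (i == 0%N) && ~~ d then 0 else w i b)%:E.

Lemma seat_weight_ge0 l t : 0 <= seat_weight l t.
Proof.
elim: l t => [|c l ih] [|i t] //=; rewrite mulr_ge0//.
by case: ifP.
Qed.

Lemma seat_weightE l t : seat_weight l t =
  ((size t == size l) && uniq [seq i <- t | i != 0%N])%:R *
  \prod_(p <- zip l t) (if (p.2 == 0%N) && ~~ p.1.1 then 0 else w p.2 p.1.2).
Proof.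
elim: l t => [|c l ih] [|i t] //=; rewrite ?big_nil ?mulr1 ?mul0r//.
rewrite big_cons/= ih eqSS /admits.
case: (eqVneq i 0%N) => [->|i0] /=.
  by case: c.1; rewrite /= ?mul0r ?mulr0//; ring.
rewrite mem_filter i0/=; case: (i \in t) => /=; last by ring.
by rewrite andbF !mul0r.
Qed.

Lemma seat_sum_nil : seat_sum [::] = 1%E.
Proof.
rewrite /seat_sum esum_seq_cons; last by move=> t; rewrite lee_fin seat_weight_ge0.
by rewrite /= esum1 ?adde0// => t _; rewrite esum1.
Qed.

Lemma seat_sum_cons c l : seat_sum (c :: l) =
  (\esum_(t in [set: seq nat]) ((seat_weight l t)%:E *
     \esum_(i in [set: nat]) (if admits c.1 t i then w i c.2 else 0)%:E))%E.
Proof.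
rewrite /seat_sum esum_seq_cons; last by move=> t; rewrite lee_fin seat_weight_ge0.
rewrite /= add0e; apply: eq_esum => t _.
rewrite -esumZl ?seat_weight_ge0//; last first.
  by move=> i _; rewrite lee_fin; case: ifP.
by apply: eq_esum => i _; rewrite mulrC EFinM.
Qed.

Lemma seat_sum_ge0 l : (0 <= seat_sum l)%E.
Proof. by apply: esum_ge0 => t _; rewrite lee_fin seat_weight_ge0. Qed.

(** The recursion in [seat_weight] singles out the head of the list, but its closed form
[seat_weightE] does not: permuting items and boxes together is a bijection of placements. *)
Lemma seat_sum_perm l l' : perm_eq l l' -> seat_sum l = seat_sum l'.
Proof.
move=> pll'; have sz := perm_size pll'.
have restrict k : seat_sum k =
    \esum_(t in [set t | size t = size k]) (seat_weight k t)%:E.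
  rewrite [RHS]esum_mkcond; apply: eq_esum => t _; case: ifPn => //.
  rewrite notin_setE/= => /eqP nsz; rewrite seat_weightE.
  by rewrite (negbTE nsz) mul0r.
rewrite !restrict sz {restrict}.
case: l pll' sz => [|c l].
  by rewrite perm_sym => /perm_nilP ->.
set k := c :: l => pll' sz.
have : perm_eq l' k by rewrite perm_sym.
case/(perm_iotaP c) => idx pidx l'E.
have ltidx i : i \in idx -> (i < size k)%N.
  by rewrite (perm_mem pidx) mem_iota add0n.
have szidx : size idx = size k by rewrite (perm_size pidx) size_iota.
apply/esym.
rewrite [LHS](reindex_esum [set t | size t = size k] _ (fun t => map (nth 0%N t) idx)).
  rewrite -sz; apply: eq_esum => t; rewrite [X in X -> _]/= => szt; congr (_%:E).
  rewrite !seat_weightE size_map szidx szt sz !eqxx l'E !andTb.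
  have pt : perm_eq (map (nth 0%N t) idx) t.
    have tE : t = map (nth 0%N t) (iota 0 (size k)).
      by rewrite [size k]/= -szt map_nth_iota0// take_size.
    by rewrite [X in perm_eq _ X]tE perm_map.
  congr (_%:R * _).
    rewrite size_map szidx eqxx; congr nat_of_bool.
    by apply: perm_uniq; exact: perm_filter.
  have zipE : zip (map (nth c k) idx) (map (nth 0%N t) idx) =
              map (nth (c, 0%N) (zip k t)) idx.
    rewrite -[RHS]/(map _ idx).
    have -> : map (nth (c, 0%N) (zip k t)) idx =
              map (fun i => (nth c k i, nth 0%N t i)) idx.
      apply/eq_in_map => i /ltidx ik; rewrite nth_zip//.
    by elim: (idx) => //= i s ->.
  rewrite zipE; apply: perm_big.
  have szz : size (zip k t) = size k by rewrite size_zip szt minnn.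
  have zE : zip k t = map (nth (c, 0%N) (zip k t)) (iota 0 (size k)).
    by rewrite -szz map_nth_iota0// take_size.
  by rewrite [X in perm_eq _ X]zE perm_map.
split.
- by move=> t _ /=; rewrite size_map szidx sz.
- move=> t t'; rewrite !inE/= => st st' /eq_in_map tt'.
  apply: (@eq_from_nth _ 0%N); first by rewrite st st'.
  move=> i; rewrite st => ik; apply: tt'.
  by rewrite (perm_mem pidx) mem_iota.
- move=> t /= st; exists (mkseq (fun i => nth 0%N t (index i idx)) (size k)).
    by rewrite size_mkseq.
  apply: (@eq_from_nth _ 0%N); first by rewrite size_map szidx st sz.
  rewrite size_map szidx => i ik; rewrite (nth_map 0%N) ?szidx//.
  have iis : (nth 0%N idx i < size k)%N by rewrite ltidx// mem_nth// szidx.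
  rewrite nth_mkseq//; congr nth; rewrite index_uniq ?szidx//.
  by rewrite (perm_uniq pidx) iota_uniq.
Qed.

(** A flagged item either goes to box [0], where it does not constrain the other items, or
is placed like an unflagged one. *)
Lemma seat_sum_dust b l :
  (seat_sum ((true, b) :: l) = (w 0 b)%:E * seat_sum l + seat_sum ((false, b) :: l))%E.
Proof.
rewrite !seat_sum_cons /seat_sum -esumZl//; last first.
  by move=> t _; rewrite lee_fin seat_weight_ge0.
rewrite -esumD; last 2 first.
- by move=> t _; rewrite -EFinM lee_fin mulr_ge0// seat_weight_ge0.
- move=> t _; rewrite mule_ge0// ?lee_fin ?seat_weight_ge0// esum_ge0// => i _.
  by rewrite lee_fin; case: ifP.
apply: eq_esum => t _; rewrite [X in (X + _)%E]muleC -ge0_muleDr ?lee_fin//; last first.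
  by rewrite esum_ge0// => i _; rewrite lee_fin; case: ifP.
congr (_ * _)%E; rewrite (esumID [set 0%N]); last first.
  by move=> i _; rewrite lee_fin; case: ifP.
rewrite !setTI esum_set1 ?lee_fin//; congr (_ + _)%E.
rewrite esum_mkcond; apply: eq_esum => i _; rewrite /admits/=.
case: ifPn => [|]; first by rewrite in_setE/= => /eqP/negbTE ->.
by rewrite notin_setE/= => /contrapT ->.
Qed.

Lemma sum_alterations_weight (m : T -> T) (r : nat -> T -> R) l t :
  (forall i a, i != 0%N -> w i (m a) = w i a * r i a) ->
  \sum_(l' <- alterations (fun c => (false, m c.2)) l) seat_weight l' t =
  seat_weight l t * \sum_(p <- zip l t | p.2 != 0%N) r p.2 p.1.2.
Proof.
move=> wm; elim: l t => [|c l ih] [|i t] //=; rewrite ?big_nil ?mulr0//.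
  rewrite big_cons big_map/= add0r big1//.
rewrite big_cons big_map/= -mulr_sumr ih big_cons/= /admits.
case: eqVneq => [_|i0] /=; first by ring.
by case: ifP => _; rewrite ?wm//; ring.
Qed.

Lemma total_weight_split d b t : uniq [seq i <- t | i != 0%N] ->
  (\esum_(i in [set: nat]) (if admits d t i then w i b else 0)%:E
    + (\sum_(i <- t | i != 0%N) w i b)%:E = total_weight d b)%E.
Proof.
move=> ut; set s := [seq i <- t | i != 0%N] in ut.
rewrite /total_weight addeC [RHS](esumID [set` s]); last first.
  by move=> i _; rewrite lee_fin; case: ifP.
rewrite !setTI; congr (_ + _)%E.
  rewrite esum_fset; last 2 first.
  - exact: finite_seq.
  - by move=> i _; rewrite lee_fin; case: ifP.
    rewrite -big_filter -/s -fsbig_seq//= -sumEFin; apply: eq_big_seq => i.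
  by rewrite mem_filter => /andP[/negbTE ->].
rewrite [RHS]esum_mkcond; apply: eq_esum => i _; rewrite /admits.
have -> : (i \in ~` [set` s]) = (i \notin s).
  by rewrite in_setC; congr negb; apply/idP/idP; rewrite in_setE.
by rewrite mem_filter; case: eqVneq => //= _; case: ifP.
Qed.

(** The recursion on which the whole proof rests. Given a placement of [l], an item [b] of
total weight [p] goes either to an available box, which yields a placement of [(d, b) :: l],
or to the nonzero box that holds an item [a] of [l], which amounts to replacing [a] by the
merged item [m a]. The correction [delta] is for draws without replacement, where the weight
of [b] in a box decreases with what the box already holds; for monomials it is [0]. *)
Lemma seat_sum_rec d b (p : R) (m : T -> T) (delta : T -> R) l :
  total_weight d b = p%:E ->
  (forall a, 0 <= delta a) ->
  (forall i a, i != 0%N -> w i (m a) = w i a * (w i b - delta a)) ->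
  (forall c, c \in l -> c.1 -> delta c.2 = 0) ->
  (p%:E * seat_sum l = seat_sum ((d, b) :: l) +
    \sum_(l' <- alterations (fun c => (false, m c.2)) l) seat_sum l' +
    (\sum_(c <- l) delta c.2)%:E * seat_sum l)%E.
Proof.
move=> pE delta0 wm flagP.
have p0 : 0 <= p.
  rewrite -lee_fin -pE; apply: esum_ge0 => i _.
  by rewrite lee_fin; case: ifP.
have sw0 k t : (0 <= (seat_weight k t)%:E)%E by rewrite lee_fin seat_weight_ge0.
have adm0 t : (0 <= \esum_(i in [set: nat]) (if admits d t i then w i b else 0)%:E)%E.
  by rewrite esum_ge0// => i _; rewrite lee_fin; case: ifP.
rewrite -!esumZl//; last by rewrite sumr_ge0.
rewrite seat_sum_cons /seat_sum.
rewrite -(@esum_sum _ _ _ _ _ xpredT (fun t l' => (seat_weight l' t)%:E))// -!esumD//; last 4 first.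
- by move=> t _; apply: adde_ge0; [exact: mule_ge0 | exact: sume_ge0].
- by move=> t _; rewrite mule_ge0// lee_fin sumr_ge0.
- by move=> t _; exact: mule_ge0.
- by move=> t _; exact: sume_ge0.
apply: eq_esum => t _; rewrite /= sumEFin (sum_alterations_weight l t wm).
have [->|sw] := eqVneq (seat_weight l t) 0.
  by rewrite !mul0r !mule0 mul0e !adde0.
move: (sw); rewrite seat_weightE; case: (boolP (_ && _)); last by rewrite mul0r eqxx.
case/andP => /eqP szt ut; rewrite mul1r => prod_neq0.
have := total_weight_split d b ut; rewrite pE => <-.
set E := esum _ _; have E0 : (0 <= E)%E by apply: adm0.
rewrite muleDl ?fin_num_adde_defl// -addeA muleC; congr (_ + _)%E.
rewrite -!EFinM -!EFinD; congr (_%:E).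
rewrite [X in _ = _ + X]mulrC -mulrDr [LHS]mulrC; congr (_ * _).
have zt : unzip2 (zip l t) = t by rewrite unzip2_zip// szt.
have zl : unzip1 (zip l t) = l by rewrite unzip1_zip// szt.
rewrite -{1}zt -{3}zl !big_map/= sumrB -addrA.
(* The items in box [0] are flagged, so that their correction vanishes. *)
rewrite [X in _ = _ + X](_ : _ = 0) ?addr0//.
rewrite [X in _ + X](bigID (fun p => p.2 != 0%N))/= addrA addNr add0r.
rewrite big_seq_cond big1// => q /andP[qz]; rewrite negbK => q0.
apply: flagP.
  rewrite -zl; apply/mapP; by exists q.
move: prod_neq0; rewrite prodf_seq_neq0 => /allP/(_ q qz)/=.
by rewrite q0/=; case: (q.1.1); rewrite ?eqxx.
Qed.

Lemma seat_sum_cons_le d b l (p : R) : total_weight d b = p%:E ->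
  (seat_sum ((d, b) :: l) <= p%:E * seat_sum l)%E.
Proof.
move=> pE; rewrite seat_sum_cons muleC /seat_sum.
have p0 : 0 <= p.
  rewrite -lee_fin -pE; apply: esum_ge0 => i _.
  by rewrite lee_fin; case: ifP.
rewrite muleC -esumZl//; last by move=> t _; rewrite lee_fin seat_weight_ge0.
apply: le_esum => t _; rewrite muleC; apply: lee_wpmul2r.
  by rewrite lee_fin seat_weight_ge0.
rewrite -pE; apply: le_esum => i _; rewrite lee_fin /admits.
by case: eqP => //= _; [case: ifP|case: ifP].
Qed.

End WeightedSums.

(** * Colour counts and chromatic partitions *)

Section Blocks.
Variable q : nat.
Implicit Types (a b : color_count q) (A B : {mset color_count q}%mset) (j : 'I_q).

Definition cadd a b : color_count q := [ffun k => (a k + b k)%N].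
Definition csub a b : color_count q := [ffun k => (a k - b k)%N].
Definition nonempty_block b : bool := b != [ffun=> 0%N].

Definition add_color j b : color_count q := cadd b (unit_count j).

Lemma color_sizeD a b : color_size (cadd a b) = (color_size a + color_size b)%N.
Proof. by rewrite /color_size -big_split; apply: eq_bigr => j _; rewrite ffunE. Qed.

Lemma color_size_unit j : color_size (unit_count j) = 1%N.
Proof.
by rewrite /color_size (bigD1 j)//= ffunE eqxx big1 ?addn0// => k /negbTE;
  rewrite ffunE => ->.
Qed.

Lemma color_size_eq0 b : (color_size b == 0%N) = ~~ nonempty_block b.
Proof.
rewrite /nonempty_block negbK /color_size sum_nat_eq0; apply/forallP/eqP => [b0|->].
  by apply/ffunP => j; rewrite ffunE; exact/eqP/b0.
by move=> j; rewrite ffunE.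
Qed.

Lemma nonempty_unit j : nonempty_block (unit_count j).
Proof. by rewrite -[nonempty_block _]negbK -color_size_eq0 color_size_unit. Qed.

Lemma nonempty_cadd a b : nonempty_block a -> nonempty_block (cadd a b).
Proof.
by rewrite -[nonempty_block a]negbK -[nonempty_block (cadd _ _)]negbK
  -!color_size_eq0 color_sizeD addn_eq0 negb_and => ->.
Qed.

Lemma nonempty_pos b : nonempty_block b -> exists j, (0 < b j)%N.
Proof.
move=> b0; apply/existsP; apply: contraNT b0 => /existsPn b0; apply/eqP/ffunP => j.
by rewrite ffunE; apply/eqP; rewrite -leqn0 leqNgt b0.
Qed.

Lemma vfact_unit j : vfact (unit_count j) = 1%N.
Proof. by rewrite /vfact big1// => k _; rewrite ffunE; case: (k == j). Qed.

Lemma vfactD_unit b j : vfact (cadd b (unit_count j)) = (vfact b * (b j).+1)%N.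
Proof.
rewrite /vfact (bigD1 j)//= [in RHS](bigD1 j)//= !ffunE eqxx addn1 factS.
rewrite [RHS]mulnC mulnA; congr (_ * _)%N; apply: eq_bigr => k /negbTE kj.
by rewrite !ffunE kj addn0.
Qed.

Lemma vfact_gt0 b : (0 < vfact b)%N.
Proof. by rewrite prodn_gt0// => j; exact: fact_gt0. Qed.

Lemma caddI b : injective (cadd^~ b).
Proof.
by move=> a a' /ffunP aa'; apply/ffunP => k; have := aa' k; rewrite !ffunE => /addIn.
Qed.

Lemma cadd_idl a b : cadd a b = b -> a = [ffun=> 0%N].
Proof.
move=> /ffunP ab; apply/ffunP => k; have := ab k.
by rewrite !ffunE -[X in _ = X -> _]add0n => /addIn.
Qed.

Lemma caddK a b : csub (cadd a b) b = a.
Proof. by apply/ffunP => k; rewrite !ffunE addnK. Qed.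

Lemma csubK a j : (0 < a j)%N -> cadd (csub a (unit_count j)) (unit_count j) = a.
Proof.
move=> aj; apply/ffunP => k; rewrite !ffunE; case: eqVneq => [->|_] /=.
  by rewrite subnK.
by rewrite subn0 addn0.
Qed.

Lemma unit_count_inj : injective (@unit_count q).
Proof.
move=> j k /ffunP/(_ j); rewrite !ffunE eqxx.
by case: (eqVneq j k).
Qed.

Lemma csub_unit_neq a j : (0 < a j)%N -> csub a (unit_count j) != a.
Proof.
move=> aj; apply/eqP => /ffunP/(_ j); rewrite !ffunE eqxx /= subn1.
by move: aj; case: (a j) => //= n _; lia.
Qed.

Lemma csub_unit_nonempty a j : (0 < a j)%N -> a != unit_count j ->
  nonempty_block (csub a (unit_count j)).
Proof.
move=> aj; apply: contraNN => /eqP/ffunP a0; apply/eqP/ffunP => k.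
by have := a0 k; rewrite !ffunE; case: eqVneq => [->|_] /=; lia.
Qed.

Lemma perm_enum_mset1D b A :
  perm_eq (enum_mset (b +` A)%mset) (b :: enum_mset A).
Proof.
rewrite -[X in perm_eq (enum_mset X)](_ : seq_mset (b :: enum_mset A) = _).
  exact: perm_eq_seq_mset.
by rewrite mset_cons seq_mset_id.
Qed.

Lemma weight_enum A : weight A = (\sum_(b <- enum_mset A) color_size b)%N.
Proof.
by rewrite (sum_mset A xpredT) /weight; apply: eq_bigr => b _.
Qed.

Lemma weightD1 b A : weight (b +` A)%mset = (color_size b + weight A)%N.
Proof. by rewrite !weight_enum (perm_big _ (perm_enum_mset1D b A))/= big_cons. Qed.

Lemma weightB1 b A : b \in A -> (color_size b + weight (A `\ b)%mset = weight A)%N.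
Proof. by move=> bA; rewrite -weightD1 msetB1K. Qed.

(** The number of permutations of labelled items that preserve the blocks and the colours. *)
Definition symfact A : nat :=
  (\prod_(a <- finsupp A) (vfact a ^ A a * (A a)`!))%N.

Lemma symfact_widen A (X : {fset color_count q}) : (finsupp A `<=` X)%fset ->
  symfact A = (\prod_(a <- X) (vfact a ^ A a * (A a)`!))%N.
Proof.
move=> AX; rewrite /symfact; apply: (big_fset_incl _ AX) => a _.
by rewrite memNfinsupp => /eqP ->; rewrite expn0 fact0.
Qed.

Lemma symfactD1 b A : symfact (b +` A)%mset = (symfact A * vfact b * (A b).+1)%N.
Proof.
pose X := (b |` finsupp A)%fset.
have AX : (finsupp A `<=` X)%fset by exact: fsubsetU1.
have bAX : (finsupp (b +` A)%mset `<=` X)%fset.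
  by apply/fsubsetP => c; rewrite msuppE in_mset1D in_fset1U msuppE.
rewrite (symfact_widen AX) (symfact_widen bAX).
have bX : b \in X by rewrite fset1U1.
rewrite !(big_fsetD1 b bX)/= mset1DE eqxx add1n expnS factS.
rewrite [X in (_ * X)%N](_ : _ = (\prod_(i <- (X `\ b)%fset) (vfact i ^ A i * (A i)`!))%N).
  move: (vfact b) (_ ^ _)%N (A b).+1 (A b)`! (\prod_(i <- _) _)%N => u v w x y.
  by ring.
rewrite !big_seq; apply: eq_bigr => c; rewrite in_fsetD1 => /andP[/negbTE cb _].
by rewrite mset1DE cb add0n.
Qed.

Lemma symfact_gt0 A : (0 < symfact A)%N.
Proof.
rewrite /symfact big_seq prodn_gt0// => a; rewrite muln_gt0 fact_gt0 andbT.
by rewrite expn_gt0 vfact_gt0.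
Qed.

(** Growing a partition by an item of colour [j], either in a block [b], when the option is
[Some b], or in a block of its own, when it is [None]; this inverts [remove_color]. *)
Definition grown_block j (o : option (color_count q)) : color_count q :=
  if o is Some b then cadd b (unit_count j) else unit_count j.

Definition grown B j (o : option (color_count q)) : {mset color_count q}%mset :=
  (grown_block j o +` (if o is Some b then B `\ b else B))%mset.

Definition growable B (o : option (color_count q)) : bool :=
  if o is Some b then b \in B else true.

Lemma remove_colorE A a j c : a \in A -> (0 < a j)%N ->
  remove_color A a j c =
    (A c - (c == a) + ((a != unit_count j) && (c == csub a (unit_count j))))%N.
Proof.
move=> aA aj; rewrite /remove_color; case: eqVneq => [->|_] /=.
  by rewrite msetB1E addn0.
by rewrite mset1DE msetB1E addnC.
Qed.

(** Removing an item from [a] lowers the multiplicity of [a] only, and raises at most that of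
the reduced block; hence the block and the colour can be read off the result, and the choice
in [transition1] is harmless. *)
Lemma remove_color_inj A a j a' j' :
  a \in A -> (0 < a j)%N -> a' \in A -> (0 < a' j')%N ->
  remove_color A a j = remove_color A a' j' -> a = a' /\ j = j'.
Proof.
move=> aA aj a'A a'j' /msetP rem.
have aa' : a = a'.
  apply/eqP; rewrite -[_ == _]negbK; apply/negP => naa'.
  have := rem a; rewrite !remove_colorE// eqxx (negbTE naa').
  rewrite [X in _ && X]eq_sym (negbTE (csub_unit_neq aj)) andbF addn0 subn0.
  by move: aA; rewrite -mset_gt0; lia.
split=> //; subst a'.
have [aej|naej] := eqVneq a (unit_count j); have [aej'|naej'] := eqVneq a (unit_count j').
- by apply: unit_count_inj; rewrite -aej.
- have := rem (csub a (unit_count j')); rewrite !remove_colorE// -aej eqxx/= naej' eqxx.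
  by rewrite (negbTE (csub_unit_neq a'j')); lia.
- have := rem (csub a (unit_count j)); rewrite !remove_colorE// -aej' eqxx/= naej eqxx.
  by rewrite (negbTE (csub_unit_neq aj)); lia.
- have := rem (csub a (unit_count j)); rewrite !remove_colorE// naej naej' eqxx.
  rewrite (negbTE (csub_unit_neq aj)) subn0 andTb.
  case: eqVneq => [/ffunP/(_ j)|_]; last first.
    by move=> /= h; move: (addnI h).
  by rewrite !ffunE eqxx; case: (eqVneq j j') => //=; lia.
Qed.

Lemma grownK B j o : growable B o ->
  (if o is Some b then nonempty_block b else true) = true ->
  remove_color (grown B j o) (grown_block j o) j = B.
Proof.
rewrite /remove_color /grown; case: o => [b|] /= bB b0; last first.
  by rewrite eqxx msetD1K.
case: eqVneq => [/ffunP be|_].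
  by move/ffunP/cadd_idl: be b0 => ->; rewrite /nonempty_block eqxx.
by rewrite msetD1K (_ : [ffun k => _] = b) ?msetB1K//; exact: caddK.
Qed.

Lemma grown_block_mem B j o : grown_block j o \in grown B j o.
Proof. exact: mset1D1. Qed.

Lemma grown_block_gt0 j o : (0 < grown_block j o j)%N.
Proof. by case: o => [b|] /=; rewrite !ffunE eqxx ?addn1. Qed.

Lemma remove_colorK A a j : a \in A -> (0 < a j)%N ->
  let B := remove_color A a j in
  let o := if a == unit_count j then None else Some (csub a (unit_count j)) in
  [/\ grown B j o = A, grown_block j o = a &
      growable B o].
Proof.
move=> aA aj; rewrite /= /remove_color.
case: (eqVneq a (unit_count j)) => [ae|na] /=.
  by split => //; rewrite /grown/= -ae; exact: msetB1K.
split; last exact: mset1D1.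
- by rewrite /grown/= csubK// msetD1K msetB1K.
- exact: csubK.
Qed.

Lemma weight_grown B j o : growable B o ->
  weight (grown B j o) = (weight B).+1.
Proof.
rewrite /grown; case: o => [b|] bB; rewrite weightD1/= ?color_sizeD color_size_unit//.
by rewrite -(weightB1 bB); lia.
Qed.

Lemma weight_remove_color A a j : a \in A -> (0 < a j)%N ->
  weight A = (weight (remove_color A a j)).+1.
Proof.
move=> aA aj; have [h _ oB] := remove_colorK aA aj.
by have := weight_grown j oB; rewrite h.
Qed.

Lemma chromatic_all n (A : chromatic_partition q n) :
  all nonempty_block (enum_mset (mset_of_cp A)).
Proof.
apply/allP => b bA; apply/eqP => b0; case: A bA => A /= /andP[/eqP A0 _].
by rewrite -[_ \in _]/(b \in A) -mset_gt0 b0 A0.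
Qed.

Lemma chromatic_nonempty n (A : chromatic_partition q n) b :
  b \in mset_of_cp A -> nonempty_block b.
Proof. by move=> bA; have /allP/(_ b bA) := chromatic_all A. Qed.

Lemma chromatic_weight n (A : chromatic_partition q n) : weight A = n.
Proof. by case: A => A /= /andP[_ /eqP]. Qed.

Lemma is_chromatic_all n A :
  is_chromatic_partition n A = all nonempty_block (enum_mset A) && (weight A == n).
Proof.
rewrite /is_chromatic_partition; congr andb; apply/idP/allP => [/eqP A0 b bA|A0].
  apply/eqP => b0; move: bA; by rewrite -[_ \in _]/(b \in A) -mset_gt0 b0 A0.
rewrite mset_eq0; apply/negP => /A0; by rewrite /nonempty_block eqxx.
Qed.

Lemma grown_chromatic n (B : chromatic_partition q n) j o :
  growable B o ->
  is_chromatic_partition n.+1 (grown B j o).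
Proof.
move=> oB; rewrite is_chromatic_all weight_grown// chromatic_weight eqxx andbT.
apply/allP => c; rewrite -[_ \in _]/(c \in grown B j o) in_mset1D => /orP[/eqP ->|].
  case: o oB => [b|] /= bB; last exact: nonempty_unit.
  exact/nonempty_cadd/(chromatic_nonempty bB).
case: o oB => [b|] /= bB; last exact: chromatic_nonempty.
by move=> cB; apply: (@chromatic_nonempty _ B); exact: (msubset_subset (msubD1set _ _) cB).
Qed.

Lemma remove_color_chromatic n (A : chromatic_partition q n.+1) a j :
  a \in mset_of_cp A -> (0 < a j)%N -> is_chromatic_partition n (remove_color A a j).
Proof.
move=> aA aj; rewrite is_chromatic_all.
have := weight_remove_color aA aj; rewrite chromatic_weight => -[<-]; rewrite eqxx andbT.
apply/allP => c; rewrite -[_ \in _]/(c \in remove_color A a j) /remove_color.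
have sub : c \in (mset_of_cp A `\ a)%mset -> nonempty_block c.
  by move=> cA; apply: (@chromatic_nonempty _ A); exact: (msubset_subset (msubD1set _ _) cA).
case: eqVneq => [_|na]; first exact: sub.
rewrite in_mset1D => /orP[/eqP ->|]; last exact: sub.
exact: csub_unit_nonempty.
Qed.

End Blocks.

Arguments nonempty_block {q} b.
Arguments cadd {q} a b.
Arguments add_color {q} j b.

(** * One-step transitions *)

Section Transitions.
Variables (R : realType) (q : nat).
Implicit Types (a b : color_count q) (A B : {mset color_count q}%mset) (j : 'I_q).

Lemma transition1_remove n A a j : a \in A -> (0 < a j)%N ->
  transition1 R n A (remove_color A a j) = (a j * A a)%:R / n%:R.
Proof.
move=> aA aj; rewrite /transition1; case: pickP => [p /andP[pj /eqP E]|].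
  have pA : fsval p.1 \in A by rewrite -msuppE; exact: fsvalP.
  by have [<- <-] := remove_color_inj aA aj pA pj E.
have aS : a \in finsupp A by rewrite msuppE.
by move/(_ ([` aS]%fset, j)) => /=; rewrite aj eqxx.
Qed.

Lemma transition1_neq0 n A B : transition1 R n A B != 0 ->
  exists a j, [/\ a \in A, (0 < a j)%N & B = remove_color A a j].
Proof.
rewrite /transition1; case: pickP => [p /andP[pj /eqP E] _|_]; last by rewrite eqxx.
by exists (fsval p.1), p.2; split => //; rewrite -msuppE; exact: fsvalP.
Qed.

Lemma transition1_ge0 n A B : 0 <= transition1 R n A B.
Proof. by rewrite /transition1; case: pickP => // p _; rewrite divr_ge0. Qed.

Lemma transition1_sumE n A B : transition1 R n A B =
  \sum_(p : finsupp A * 'I_q)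
    (if B == remove_color A (fsval p.1) p.2
     then (fsval p.1 p.2 * A (fsval p.1))%:R / n%:R else 0).
Proof.
have memA (p : finsupp A * 'I_q) : fsval p.1 \in A by rewrite -msuppE; exact: fsvalP.
rewrite /transition1; case: pickP => [p /andP[pj /eqP E]|no].
  rewrite (bigD1 p)//= E eqxx big1 ?addr0// => p' p'p.
  case: eqP => // E'; have [->|p'j] := posnP (fsval p'.1 p'.2).
    by rewrite mul0n mul0r.
  have [e1 e2] := remove_color_inj (memA p) pj (memA p') p'j E'.
  case/eqP: p'p; apply/esym; case: p {pj E E'} e1 e2 => [a j] /= e1 ->.
  by rewrite [RHS]surjective_pairing; congr pair; apply: val_inj.
rewrite big1// => p _; case: eqP => // E; have := no p; rewrite E eqxx andbT.
by case: (posnP (fsval p.1 p.2)) => // -> _; rewrite mul0n mul0r.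
Qed.

Lemma sum_transition1 n (A : chromatic_partition q n.+1) :
  \sum_(B : chromatic_partition q n) transition1 R n.+1 A B = 1.
Proof.
under eq_bigr do rewrite transition1_sumE.
rewrite exchange_big/=.
transitivity (\sum_(p : finsupp (mset_of_cp A) * 'I_q)
    ((fsval p.1 p.2 * mset_of_cp A (fsval p.1))%:R / n.+1%:R : R)).
  apply: eq_bigr => p _; have [->|pj] := posnP (fsval p.1 p.2).
    by rewrite mul0n mul0r big1// => B _; case: ifP.
  have pA : fsval p.1 \in mset_of_cp A by rewrite -msuppE; exact: fsvalP.
  pose B0 := ChromaticPartition (remove_color_chromatic pA pj).
  rewrite (bigD1 B0)//= eqxx big1 ?addr0// => B BB0.
  by case: eqP => // E; case/eqP: BB0; exact: val_inj.
rewrite -(pair_big xpredT xpredT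
  (fun (a : finsupp (mset_of_cp A)) j =>
    ((fsval a j * mset_of_cp A (fsval a))%:R / n.+1%:R : R)))/=.
have wA : (weight A)%:R = n.+1%:R :> R by rewrite chromatic_weight.
rewrite -[RHS](@divff _ (n.+1%:R : R))// -[X in _ = X / _]wA /weight natr_sum mulr_suml.
rewrite [RHS]big_seq_fsetE/=; apply: eq_bigr => a _; rewrite -mulr_suml.
congr (_ / _); rewrite -natr_sum; congr (_%:R).
by rewrite -big_distrl/= mulnC.
Qed.

(** The prefactor of [phi]: the number of ways of partitioning and colouring [weight A]
labelled items such that [A] results. *)
Definition coef A : R := (weight A)`!%:R / (symfact A)%:R.

Lemma coef_gt0 A : 0 < coef A.
Proof. by rewrite divr_gt0 ?ltr0n ?fact_gt0 ?symfact_gt0. Qed.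

Lemma enum_chromatic0 (B : chromatic_partition q 0) : enum_mset (mset_of_cp B) = [::].
Proof.
have := chromatic_weight B; rewrite weight_enum.
have /allP := chromatic_all B; case: (enum_mset _) => // b s /(_ b (mem_head _ _)).
rewrite -[nonempty_block b]negbK -color_size_eq0 big_cons; lia.
Qed.

Lemma sum_chromatic0 (f : seq (color_count q) -> R) :
  \sum_(B : chromatic_partition q 0) coef B * f (enum_mset (mset_of_cp B)) = f [::].
Proof.
have all0 (B : chromatic_partition q 0) : mset_of_cp B = mset0.
  by rewrite -[LHS]seq_mset_id enum_chromatic0; apply/msetP => a; rewrite mset_seqE mset0E.
have P0 : is_chromatic_partition 0 (mset0 : {mset color_count q}%mset).
  by rewrite is_chromatic_all weight_enum enum_mset0 big_nil.
rewrite (bigD1 (ChromaticPartition P0))//= big1 ?addr0; last first.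
  by move=> B; rewrite (_ : B = ChromaticPartition P0) ?eqxx//; apply: val_inj; exact: all0.
rewrite enum_mset0 /coef /symfact weight_enum enum_mset0 big_nil finsupp0 big_seq_fset0.
by rewrite fact0 divr1 mul1r.
Qed.

Lemma transition1_grown n B j o : growable B o ->
  (if o is Some b then nonempty_block b else true) = true ->
  transition1 R n (grown B j o) B =
    (grown_block j o j * grown B j o (grown_block j o))%:R / n%:R.
Proof.
move=> oB ob; rewrite -{2}(grownK j oB ob) transition1_remove//.
  exact: grown_block_mem.
exact: grown_block_gt0.
Qed.

(** Undoing the growth has exactly the probability that compensates the change of the
coefficient, up to the number of blocks in which the growth may take place. *)
Lemma coef_grown n (B : chromatic_partition q n) j o : growable B o ->
  coef (grown B j o) * transition1 R n.+1 (grown B j o) B =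
    coef B * (if o is Some b then mset_of_cp B b else 1%N)%:R.
Proof.
move=> oB; rewrite transition1_grown//; last first.
  by case: o oB => // b /chromatic_nonempty.
rewrite /coef weight_grown// chromatic_weight factS.
have sB : (symfact B)%:R != 0 :> R by rewrite pnatr_eq0 -lt0n symfact_gt0.
have sG : (symfact (grown B j o))%:R != 0 :> R by rewrite pnatr_eq0 -lt0n symfact_gt0.
suff E : (grown_block j o j * grown B j o (grown_block j o) * symfact B =
   symfact (grown B j o) * (if o is Some b then mset_of_cp B b else 1))%N.
  move/(congr1 (fun k => k%:R : R)): E; rewrite natrM [in X in _ = X]natrM => E.
  rewrite -[X in _ * (X / _)](mulfK sB) E natrM; field.
  by rewrite sB sG nat1r pnatr_eq0.
rewrite /grown; case: o oB {sG} => [b|] /= bB.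
  have b0 : (0 < mset_of_cp B b)%N by rewrite mset_gt0.
  have SB : symfact B = (symfact (mset_of_cp B `\ b)%mset * vfact b * mset_of_cp B b)%N.
    by rewrite -{1}(msetB1K bB) symfactD1 msetB1E eqxx subn1 prednK.
  rewrite SB symfactD1 vfactD_unit mset1DE eqxx add1n !ffunE eqxx addn1.
  by move: (_ `\ _)%mset (vfact b) => C v; move: (symfact C) (C _).+1 => s k; ring.
by rewrite symfactD1 vfact_unit mset1DE !eqxx ffunE eqxx /= mul1n !muln1 add1n mulnC.
Qed.

Lemma sum_alterations_mem (f : seq (color_count q) -> R) (g : color_count q -> color_count q) l :
  (forall s s', perm_eq s s' -> f s = f s') ->
  \sum_(l' <- alterations g l) f l' = \sum_(b <- l) f (g b :: rem b l).
Proof.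
elim: l f => [|c l ih] f fp /=; first by rewrite !big_nil.
rewrite !big_cons eqxx big_map (ih (fun s => f (c :: s))); last first.
  by move=> s s' ss'; apply: fp; rewrite perm_cons.
congr (_ + _); rewrite !big_seq; apply: eq_bigr => b bl; apply: fp.
rewrite (perm_catCA [:: c] [:: g b] (rem b l)) perm_cons /=.
case: eqVneq => [->|_] //; by rewrite perm_sym perm_to_rem.
Qed.

(** Consistency of a family of functions on partitions reduces to an identity between
functions on lists of blocks. Indeed the partitions that lead to [B] are obtained by growing
[B], and by [coef_grown] each is counted once for every block of [B] that can be grown into
it, which turns the sum into one over the entries of the list of blocks of [B]. *)
Lemma harmonic_partition (f : seq (color_count q) -> R) n (B : chromatic_partition q n) :
  (forall s s', perm_eq s s' -> f s = f s') ->
  \sum_(A : chromatic_partition q n.+1)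
     coef A * f (enum_mset (mset_of_cp A)) * transition1 R n.+1 A B =
  coef B * \sum_j (f (unit_count j :: enum_mset (mset_of_cp B)) +
     \sum_(l <- alterations (add_color j) (enum_mset (mset_of_cp B))) f l).
Proof.
move=> fp.
pose lab := (unit + finsupp (mset_of_cp B))%type.
pose val_lab (o : lab) := if o is inr b then Some (fsval b) else None.
have labP (o : lab) : growable B (val_lab o).
  by case: o => //= b; rewrite /growable -msuppE; exact: fsvalP.
have labN (o : lab) : (if val_lab o is Some b then nonempty_block b else true) = true.
  by case: o (labP o) => //= b /chromatic_nonempty.
pose Phi (x : 'I_q * lab) := ChromaticPartition (grown_chromatic x.1 (labP x.2)).
have PhiI : injective Phi.
  move=> [j o] [j' o'] /(congr1 (@mset_of_cp _ _)) /= E.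
  have e1 := grownK j (labP o) (labN o).
  have := grownK j' (labP o') (labN o'); rewrite -E => /(etrans e1 \o esym) rem.
  have m1 := grown_block_mem B j (val_lab o).
  have m2 : grown_block j' (val_lab o') \in grown B j (val_lab o).
    by rewrite E; exact: grown_block_mem.
  have [eb ej] := remove_color_inj m1 (grown_block_gt0 _ _) m2 (grown_block_gt0 _ _) rem.
  rewrite -{}ej in eb *; congr pair.
  case: o o' eb {E e1 rem m1 m2} (labN o) (labN o') => [[]|b] [[]|b'] //=.
  - by move=> eb _; rewrite /nonempty_block (cadd_idl (esym eb)) eqxx.
  - by move=> eb; rewrite /nonempty_block (cadd_idl eb) eqxx.
  - by move=> /caddI eb _ _; congr inr; exact: val_inj.
pose X (A : chromatic_partition q n.+1) :=
  coef A * f (enum_mset (mset_of_cp A)) * transition1 R n.+1 A B.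
rewrite (_ : \sum_A _ = \sum_(A in Phi @: predT) X A); last first.
  rewrite [RHS]big_mkcond/=; apply: eq_bigr => A _; case: ifPn => // /imsetP noA.
  apply/eqP/negP => /negP; rewrite mulf_eq0 negb_or => /andP[_ /transition1_neq0].
  move=> [a [j [aA aj BE]]]; apply: noA.
  have [gA _ gb] := remove_colorK aA aj.
  have [|] := eqVneq a (unit_count j) => ae; rewrite ?ae ?eqxx ?(negbTE ae) in gA gb.
    exists (j, inl tt) => //; apply: val_inj; rewrite /= -[LHS]gA.
    by rewrite BE -ae.
  move: gb; rewrite /growable -BE -msuppE => gb.
  exists (j, inr [` gb]%fset) => //; apply: val_inj; rewrite /= -[LHS]gA.
  by rewrite -BE.
rewrite big_imset/=; last by move=> x y _ _; exact: PhiI.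
transitivity (\sum_j \sum_(o : lab) X (Phi (j, o))).
  by rewrite pair_big; apply: eq_big => [x|[j o] _] //; rewrite inE.
rewrite mulr_sumr; apply: eq_bigr => j _; rewrite big_sumType/= (bigD1 tt)//=.
rewrite [X in _ + X + _]big1 ?addr0; last by case.
have XE (o : lab) : X (Phi (j, o)) = coef B *
    ((if val_lab o is Some b then mset_of_cp B b else 1%N)%:R *
     f (enum_mset (grown B j (val_lab o)))).
  rewrite /X /= mulrAC [X in X * _]coef_grown; last exact: labP.
  by rewrite mulrA.
rewrite XE mul1r mulrDr; congr (_ * _ + _).
  exact/fp/perm_enum_mset1D.
rewrite sum_alterations_mem//.
under eq_bigr do rewrite XE.
rewrite -mulr_sumr; congr (_ * _).
rewrite big_mset/= [RHS]big_seq_fsetE/=; apply: eq_bigr => b _.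
rewrite mulr_natl; congr (_ *+ _); apply: fp.
rewrite (perm_trans (perm_enum_mset1D _ _))// perm_cons.
rewrite -(perm_cons (fsval b)) -(permPl (perm_enum_mset1D _ _)) msetB1K; last first.
  by rewrite -msuppE; exact: fsvalP.
by apply: perm_to_rem; rewrite -[_ \in _]msuppE; exact: fsvalP.
Qed.

End Transitions.

(** * Chains of transitions *)

Section Chains.
Variables (R : realType) (q : nat).
Implicit Types (A B : {mset color_count q}%mset).

Lemma transitionnn n A B : transition R n n A B = (A == B)%:R.
Proof. by case: n => [|n] /=; rewrite ?eqxx. Qed.

Lemma transitionS l n A B : (l <= n)%N -> transition R l n.+1 A B =
  \sum_(C : chromatic_partition q n) transition R l n C B * transition1 R n.+1 A C.
Proof. by move=> ln; rewrite /= gtn_eqF. Qed.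

Lemma chain_transition (V : forall k, chromatic_partition q k -> R) n N :
  (n <= N)%N ->
  (forall k (B : chromatic_partition q k), (n <= k < N)%N ->
    V k B = \sum_(A : chromatic_partition q k.+1) V k.+1 A * transition1 R k.+1 A B) ->
  forall B : chromatic_partition q n,
    V n B = \sum_(A : chromatic_partition q N) V N A * transition R n N A B.
Proof.
have base (B : chromatic_partition q n) :
    V n B = \sum_(A : chromatic_partition q n) V n A * transition R n n A B.
  rewrite (bigD1 B)//= transitionnn eqxx mulr1 big1 ?addr0// => A AB.
  rewrite transitionnn; case: eqP => [/val_inj e|_]; last by rewrite mulr0.
  by move: AB; rewrite e eqxx.
elim: N => [|N ih].
  by rewrite leqn0 => /eqP n0 _ B; subst n.
rewrite leq_eqVlt => /orP[/eqP nN|nN] VS B; first by subst n.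
rewrite ltnS in nN; rewrite ih//; last first.
  by move=> k C /andP[nk kN]; apply: VS; rewrite nk ltnS ltnW.
transitivity (\sum_(C : chromatic_partition q N) \sum_(A : chromatic_partition q N.+1)
    V N.+1 A * (transition R n N C B * transition1 R N.+1 A C)).
  apply: eq_bigr => C _; rewrite (VS _ C) ?nN ?ltnSn// mulr_suml.
  by apply: eq_bigr => A _; rewrite -mulrA [X in _ * X]mulrC.
rewrite exchange_big; apply: eq_bigr => A _.
by rewrite transitionS// mulr_sumr.
Qed.

Lemma chain_mass (V : forall k, chromatic_partition q k -> R) n N :
  (n <= N)%N ->
  (forall k (B : chromatic_partition q k), (n <= k < N)%N ->
    V k B = \sum_(A : chromatic_partition q k.+1) V k.+1 A * transition1 R k.+1 A B) ->
  \sum_B V n B = \sum_A V N A.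
Proof.
elim: N => [|N ih]; first by rewrite leqn0 => /eqP ->.
rewrite leq_eqVlt => /orP[/eqP -> //|nN] VS.
rewrite ltnS in nN; rewrite ih//; last first.
  by move=> k C /andP[nk kN]; apply: VS; rewrite nk ltnS ltnW.
under eq_bigr do rewrite VS ?nN ?ltnSn//.
by rewrite exchange_big/=; apply: eq_bigr => A _; rewrite -mulr_sumr sum_transition1 mulr1.
Qed.

End Chains.

(** * Sampling functions on the simplex *)

Section Simplex.
Variables (R : realType) (q : nat).
Implicit Types (x : nat -> 'I_q -> R) (b : color_count q) (l : seq (color_count q)).

Definition is_unit b : bool := [exists j, b == unit_count j].

Lemma is_unit_unit j : is_unit (unit_count j : color_count q).
Proof. by apply/existsP; exists j. Qed.

Lemma is_unitPn b c : nonempty_block b -> nonempty_block c -> is_unit (cadd b c) = false.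
Proof.
move=> b0 c0; apply/negbTE/existsP => -[j /eqP bc].
have := color_sizeD b c; rewrite bc color_size_unit.
by move: b0 c0; rewrite -[nonempty_block b]negbK -[nonempty_block c]negbK -!color_size_eq0; lia.
Qed.

Lemma monomial_unit (s : 'I_q -> R) j : monomial s (unit_count j) = s j.
Proof.
rewrite /monomial (bigD1 j)//= ffunE eqxx expr1 big1 ?mulr1// => k /negbTE kj.
by rewrite ffunE kj expr0.
Qed.

Lemma monomialD (s : 'I_q -> R) a b : monomial s (cadd a b) = monomial s a * monomial s b.
Proof. by rewrite /monomial -big_split; apply: eq_bigr => j _; rewrite ffunE exprD. Qed.

Lemma monomial_ge0 (s : 'I_q -> R) b : (forall j, 0 <= s j) -> 0 <= monomial s b.
Proof. by move=> s0; rewrite prodr_ge0// => j _; rewrite exprn_ge0. Qed.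

Definition flag_units l : seq (bool * color_count q) := [seq (is_unit b, b) | b <- l].

(** What membership in the Kingman simplex says apart from the order of the atoms. *)
Definition in_simplex x : Prop :=
  (forall i j, 0 <= x i j) /\ \esum_(i in [set: nat]) (\sum_j x i j)%:E = 1%E.

(** The dust, at index [0], is counted for the blocks that consist of a single item only. *)
Definition power_sum x b : R :=
  fine (total_weight (fun i b => monomial (x i) b) (is_unit b) b).

Definition sampling x l : R :=
  fine (seat_sum (fun i b => monomial (x i) b) (flag_units l)).

Section InSimplex.
Variable x : nat -> 'I_q -> R.
Hypothesis xS : in_simplex x.

Let x0 i j : 0 <= x i j. Proof. by have [+ _] := xS. Qed.

Let w0 i b : 0 <= monomial (x i) b. Proof. exact: monomial_ge0. Qed.

Lemma simplex_sum_le1 i : \sum_j x i j <= 1.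
Proof.
have [_ x1] := xS; rewrite -lee_fin -x1.
rewrite (esumID [set i]); last by move=> k _; rewrite lee_fin sumr_ge0.
rewrite setTI esum_set1 ?lee_fin ?sumr_ge0// leeDl// esum_ge0// => k _.
by rewrite lee_fin sumr_ge0.
Qed.

Lemma simplex_le1 i j : x i j <= 1.
Proof.
by apply: le_trans (simplex_sum_le1 i); rewrite (bigD1 j)//= lerDl sumr_ge0.
Qed.

Lemma monomial_le_sum i b : nonempty_block b -> monomial (x i) b <= \sum_j x i j.
Proof.
move=> b0; have [j bj] := nonempty_pos b0.
rewrite -(csubK bj) monomialD monomial_unit (bigD1 j)//=.
apply: (@le_trans _ _ (x i j)); last by rewrite lerDl sumr_ge0.
rewrite ler_piMl// /monomial prodr_ile1// => k _.
by rewrite exprn_ge0//= exprn_ile1// simplex_le1.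
Qed.

Lemma total_weight_fin b : nonempty_block b ->
  total_weight (fun i b => monomial (x i) b) (is_unit b) b = (power_sum x b)%:E.
Proof.
move=> b0; rewrite /power_sum fineK// ge0_fin_numE; last first.
  by apply: esum_ge0 => i _; rewrite lee_fin; case: ifP.
apply: (@le_lt_trans _ _ 1%E); last by rewrite ltry.
have [_ <-] := xS; apply: le_esum => i _; rewrite lee_fin.
by case: ifP => _; [rewrite sumr_ge0|exact: monomial_le_sum].
Qed.

Lemma power_sum_ge0 b : 0 <= power_sum x b.
Proof.
by rewrite fine_ge0//; apply: esum_ge0 => i _; rewrite lee_fin; case: ifP.
Qed.

Lemma power_sum_le1 b : nonempty_block b -> power_sum x b <= 1.
Proof.
move=> b0; rewrite -lee_fin -total_weight_fin//.
have [_ <-] := xS; apply: le_esum => i _; rewrite lee_fin.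
by case: ifP => _; [rewrite sumr_ge0|exact: monomial_le_sum].
Qed.

Lemma power_sum_unit j : (power_sum x (unit_count j))%:E = \esum_(i in [set: nat]) (x i j)%:E.
Proof.
rewrite -total_weight_fin ?nonempty_unit// /total_weight is_unit_unit.
by apply: eq_esum => i _; rewrite andbF monomial_unit.
Qed.

Lemma sum_power_sum_unit : \sum_j power_sum x (unit_count j) = 1.
Proof.
apply: EFin_inj; rewrite -sumEFin; have [_ <-] := xS.
under eq_bigr do rewrite power_sum_unit.
rewrite -(@esum_sum _ _ _ _ _ xpredT (fun i j => (x i j)%:E)); last by move=> *; rewrite lee_fin.
by apply: eq_esum => i _; rewrite sumEFin.
Qed.

Lemma seat_sum_simplex_le1 l : all nonempty_block l ->
  (seat_sum (fun i b => monomial (x i) b) (flag_units l) <= 1)%E.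
Proof.
elim: l => [|b l ih] /=; first by rewrite seat_sum_nil.
case/andP => b0 /ih l1.
apply: le_trans (seat_sum_cons_le w0 _ (total_weight_fin b0)) _.
rewrite -[leRHS]mule1; apply: lee_pmul => //; first by rewrite lee_fin power_sum_ge0.
- exact: seat_sum_ge0.
- by rewrite lee_fin power_sum_le1.
Qed.

Lemma seat_sum_sampling l : all nonempty_block l ->
  seat_sum (fun i b => monomial (x i) b) (flag_units l) = (sampling x l)%:E.
Proof.
move=> l0; rewrite fineK// ge0_fin_numE ?seat_sum_ge0//.
by apply: le_lt_trans (seat_sum_simplex_le1 l0) _; rewrite ltry.
Qed.

Lemma sampling_ge0 l : 0 <= sampling x l.
Proof. by rewrite fine_ge0// seat_sum_ge0. Qed.

Lemma sampling_le1 l : all nonempty_block l -> sampling x l <= 1.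
Proof.
by move=> l0; rewrite -lee_fin -seat_sum_sampling//; exact: seat_sum_simplex_le1.
Qed.

Lemma sampling_nil : sampling x [::] = 1.
Proof. by rewrite /sampling seat_sum_nil. Qed.

Lemma sampling_perm l l' : perm_eq l l' -> sampling x l = sampling x l'.
Proof. by move=> ll'; rewrite /sampling (seat_sum_perm _ (perm_map _ ll')). Qed.

Lemma flag_units_alterations b l : nonempty_block b -> all nonempty_block l ->
  alterations (fun c => (false, cadd c.2 b)) (flag_units l) =
  map flag_units (alterations (fun a => cadd a b) l).
Proof.
move=> b0 /allP l0;
rewrite (@map_alterations _ _ (fun b => (is_unit b, b)) _ (fun c => (false, cadd c.2 b)))//.
by move=> a al /=; rewrite is_unitPn// l0.
Qed.

Lemma alterations_nonempty b l l' : all nonempty_block l ->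
  l' \in alterations (fun a => cadd a b) l -> all nonempty_block l'.
Proof.
move=> l0 l'l; apply: alterations_all l'l l0 => a; exact: nonempty_cadd.
Qed.

(** The product of a power sum and a sampling function is a sum of sampling functions. So the
power sums determine the sampling functions, and these span an algebra. *)
Lemma sampling_rec b l : nonempty_block b -> all nonempty_block l ->
  power_sum x b * sampling x l = sampling x (b :: l) +
    \sum_(l' <- alterations (fun a => cadd a b) l) sampling x l'.
Proof.
move=> b0 l0; apply: EFin_inj.
have := seat_sum_rec w0 (m := fun a => cadd a b) (delta := fun=> 0) (l := flag_units l)
  (total_weight_fin b0).
move=> /(_ (fun=> lexx 0)) H.
rewrite EFinM -seat_sum_sampling// H//; last first.
  by move=> i a _; rewrite monomialD subr0.
rewrite big1_eq mul0e adde0.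
rewrite -[_ :: flag_units l]/(flag_units (b :: l)) seat_sum_sampling ?b0//= ?b0//.
rewrite EFinD flag_units_alterations// big_map -sumEFin; congr (_ + _)%E.
by apply: eq_big_seq => l' l'l; rewrite seat_sum_sampling// (alterations_nonempty l0 l'l).
Qed.

Lemma sampling1 b : nonempty_block b -> sampling x [:: b] = power_sum x b.
Proof.
move=> b0; have := sampling_rec b0 (isT : all nonempty_block [::]).
by rewrite sampling_nil big_nil mulr1 addr0.
Qed.

Definition sampling_prob A : R := coef R A * sampling x (enum_mset A).

Lemma sampling_prob_ge0 A : 0 <= sampling_prob A.
Proof. by rewrite mulr_ge0// ?sampling_ge0// ltW// coef_gt0. Qed.

(** The power sums of the unit blocks add up to [1], so that summing [sampling_rec] over them
gives the identity on lists required by [harmonic_partition]. *)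
Lemma sampling_prob_step n (B : chromatic_partition q n) :
  sampling_prob B =
  \sum_(A : chromatic_partition q n.+1) sampling_prob A * transition1 R n.+1 A B.
Proof.
rewrite harmonic_partition; last exact: sampling_perm.
congr (_ * _).
rewrite -[LHS]mul1r -sum_power_sum_unit mulr_suml; apply: eq_bigr => j _.
by rewrite sampling_rec ?nonempty_unit// chromatic_all.
Qed.

Lemma sampling_prob_chain m n (B : chromatic_partition q m) : (m <= n)%N ->
  sampling_prob B =
  \sum_(A : chromatic_partition q n) sampling_prob A * transition R m n A B.
Proof.
move=> mn; apply: (chain_transition (V := fun k (A : chromatic_partition q k) =>
  sampling_prob A)) => // k C _; exact: sampling_prob_step.
Qed.

Lemma sampling_prob_sum1 n : \sum_(A : chromatic_partition q n) sampling_prob A = 1.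
Proof.
rewrite -(chain_mass (V := fun k (A : chromatic_partition q k) => sampling_prob A) (leq0n n)).
  by rewrite sum_chromatic0 sampling_nil.
by move=> k C _; exact: sampling_prob_step.
Qed.

End InSimplex.
End Simplex.

(** * Sampling without replacement *)

Section Urn.
Variables (R : realType) (q N : nat) (A : chromatic_partition q N).
Hypothesis N_gt0 : (0 < N)%N.
Implicit Types (b c : color_count q) (l : seq (color_count q)).

Let nil_block : color_count q := [ffun=> 0%N].

(** Index [0] is the dust, which a partition does not have. *)
Definition block_at (i : nat) : color_count q :=
  nth [ffun=> 0%N] ([ffun=> 0%N] :: enum_mset (mset_of_cp A)) i.

Definition empirical (i : nat) (j : 'I_q) : R := (block_at i j)%:R / N%:R.

(** The number of ways of drawing an ordered sample of colours [b] from block [i]. *)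
Definition urn_weight (i : nat) b : R := (\prod_j (block_at i j) ^_ (b j))%:R.

Definition urn l : R := fine (seat_sum urn_weight [seq (false, b) | b <- l]).

Let urn_weight_ge0 i b : 0 <= urn_weight i b. Proof. exact: ler0n. Qed.

Lemma urn_weight_unit i j : urn_weight i (unit_count j) = (block_at i j)%:R.
Proof.
rewrite /urn_weight (bigD1 j)//= ffunE eqxx ffactn1 big1 ?muln1// => k /negbTE kj.
by rewrite ffunE kj ffactn0.
Qed.

Lemma urn_weight_add i j b :
  urn_weight i (add_color j b) = urn_weight i b * (urn_weight i (unit_count j) - (b j)%:R).
Proof.
rewrite urn_weight_unit /urn_weight (bigD1 j)//= [in RHS](bigD1 j)//=.
rewrite [X in (_ * X)%N](_ : _ = \prod_(k | k != j) (block_at i k) ^_ (b k))%N; last first.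
  by apply: eq_bigr => k /negbTE kj; rewrite !ffunE kj addn0.
rewrite !ffunE eqxx addn1 ffactnSr.
have [le|lt] := leqP (b j) (block_at i j); first by rewrite -natrB// -natrM mulnAC.
by rewrite (ffact_small lt) !mul0n mul0r.
Qed.

Lemma falling_nil b : nonempty_block b -> (\prod_j nil_block j ^_ b j = 0)%N.
Proof.
move=> b0; have [j bj] := nonempty_pos b0.
by rewrite (bigD1 j)//= ffunE ffact_small.
Qed.

Lemma total_urn_weight b : nonempty_block b ->
  total_weight urn_weight false b =
    (\sum_(c <- enum_mset (mset_of_cp A)) (\prod_j (c j) ^_ (b j))%:R)%:E.
Proof.
move=> b0; rewrite /total_weight esum_nat_recl/= ?add0e; last first.
  by move=> i; rewrite lee_fin; case: ifP.
rewrite -sumEFin -(esum_nth (z := nil_block) _ (f := fun c => (\prod_j (c j) ^_ (b j))%:R%:E))//.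
by rewrite falling_nil.
Qed.

Lemma total_urn_weight_unit j : total_weight urn_weight false (unit_count j) =
  (\sum_(c <- enum_mset (mset_of_cp A)) c j)%:R%:E.
Proof.
rewrite total_urn_weight ?nonempty_unit// natr_sum; congr (_%:E); apply: eq_bigr => c _.
rewrite (bigD1 j)//= ffunE eqxx ffactn1 big1 ?muln1// => k /negbTE kj.
by rewrite ffunE kj ffactn0.
Qed.

Lemma sum_colors_chromatic : (\sum_j \sum_(c <- enum_mset (mset_of_cp A)) c j = N)%N.
Proof.
transitivity (weight (mset_of_cp A)); last exact: chromatic_weight.
by rewrite exchange_big weight_enum.
Qed.

Lemma seat_sum_urn l : all nonempty_block l ->
  seat_sum urn_weight [seq (false, b) | b <- l] = (urn l)%:E.
Proof.
move=> l0; rewrite fineK// ge0_fin_numE ?seat_sum_ge0//.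
elim: l l0 => [_|b l ih /= /andP[b0 /ih l_fin]]; first by rewrite seat_sum_nil// ltry.
apply: le_lt_trans (seat_sum_cons_le urn_weight_ge0 _ (total_urn_weight b0)) _.
by rewrite lte_mul_pinfty// lee_fin sumr_ge0// => c _; rewrite ler0n.
Qed.

Lemma urn_perm l l' : perm_eq l l' -> urn l = urn l'.
Proof. by move=> ll'; rewrite /urn (seat_sum_perm _ (perm_map _ ll')). Qed.

Lemma urn_nil : urn [::] = 1.
Proof. by rewrite /urn seat_sum_nil. Qed.

Lemma urn_rec j l : all nonempty_block l ->
  (\sum_(c <- enum_mset (mset_of_cp A)) c j)%:R * urn l =
  urn (unit_count j :: l) + \sum_(l' <- alterations (add_color j) l) urn l' +
    (\sum_(c <- l) c j)%:R * urn l.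
Proof.
move=> l0; apply: EFin_inj.
have /(_ (fun a => ler0n _ _)) H := seat_sum_rec urn_weight_ge0 (m := add_color j)
  (delta := fun a => (a j)%:R) (l := [seq (false, b) | b <- l]) (total_urn_weight_unit j).
rewrite EFinM -seat_sum_urn// H; last 2 first.
- by move=> i a _; exact: urn_weight_add.
- by move=> c /mapP[b _ ->].
rewrite !EFinD EFinM -seat_sum_urn/= ?nonempty_unit// seat_sum_urn//.
rewrite big_map -natr_sum; congr (_ + _ + _)%E.
rewrite -(map_alterations (f := pair false) (g := add_color j))// big_map -sumEFin.
by apply: eq_big_seq => l' l'l; rewrite seat_sum_urn// (alterations_nonempty l0 l'l).
Qed.

(** The recursion for draws without replacement: an item drawn from the whole urn is either
new, or one of the items drawn before, which the term on the left discards. *)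
Lemma urn_step l : all nonempty_block l ->
  (N%:R - (\sum_(c <- l) color_size c)%:R) * urn l =
  \sum_j (urn (unit_count j :: l) + \sum_(l' <- alterations (add_color j) l) urn l').
Proof.
move=> l0; rewrite mulrBl -{1}sum_colors_chromatic natr_sum mulr_suml.
rewrite (eq_bigr _ (fun j _ => urn_rec j l0)) big_split/= -addrA -[RHS]addr0; congr (_ + _).
rewrite -mulr_suml -natr_sum exchange_big/=.
by rewrite -[X in X%:R * _ - _]/(\sum_(c <- l) color_size c)%N subrr.
Qed.

(** The law of the partition induced by [A] on a uniform sample of [k] of its [N] items. *)
Definition hypergeometric k (B : chromatic_partition q k) : R :=
  coef R B * urn (enum_mset (mset_of_cp B)) / (N ^_ k)%:R.

Lemma hypergeometric_step k (B : chromatic_partition q k) : (k < N)%N ->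
  hypergeometric B =
  \sum_(C : chromatic_partition q k.+1) hypergeometric C * transition1 R k.+1 C B.
Proof.
move=> kN; rewrite /hypergeometric.
transitivity ((\sum_(C : chromatic_partition q k.+1) coef R C *
  urn (enum_mset (mset_of_cp C)) * transition1 R k.+1 C B) / (N ^_ k.+1)%:R); last first.
  by rewrite mulr_suml; apply: eq_bigr => C _; rewrite mulrAC.
rewrite harmonic_partition; last exact: urn_perm.
rewrite -urn_step ?chromatic_all// -weight_enum chromatic_weight ffactnSr natrM natrB 1?ltnW//.
have Nk : N%:R - k%:R != 0 :> R by rewrite subr_eq0 eqr_nat gtn_eqF.
have Nf : (N ^_ k)%:R != 0 :> R by rewrite pnatr_eq0 -lt0n ffact_gt0 ltnW.
by field; rewrite Nk Nf.
Qed.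

Lemma hypergeometric0 : \sum_(B : chromatic_partition q 0) hypergeometric B = 1.
Proof.
rewrite -urn_nil -(sum_chromatic0 urn); apply: eq_bigr => B _.
by rewrite /hypergeometric ffactn0 divr1.
Qed.

Lemma seated_blocks l (t : seq nat) : size t = size l ->
  (forall p, p \in zip l t -> forall j, (p.1 j <= block_at p.2 j)%N) ->
  (\sum_(i <- t) color_size (block_at i) <= \sum_(c <- l) color_size c)%N ->
  l = map block_at t.
Proof.
have cs_le (b c : color_count q) : (forall j, b j <= c j)%N -> (color_size b <= color_size c)%N.
  by move=> bc; apply: leq_sum => j _; exact: bc.
elim: l t => [|c l ih] [|i t] //= [szt] le_ct.
have le_c : forall j, (c j <= block_at i j)%N by exact: (le_ct (c, i) (mem_head _ _)).
have le_t p : p \in zip l t -> forall j, (p.1 j <= block_at p.2 j)%N.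
  by move=> pz; apply: le_ct; rewrite in_cons pz orbT.
have le_sum : (\sum_(c <- l) color_size c <= \sum_(i <- t) color_size (block_at i))%N.
  elim: l t szt le_t {ih le_ct} => [|d l ih] [|k t] //= szt le_t; first by rewrite !big_nil.
  case: szt => szt.
  rewrite !big_cons leq_add//; first exact/cs_le/(le_t (d, k) (mem_head _ _)).
  by apply: ih => // p pz; apply: le_t; rewrite in_cons pz orbT.
rewrite !big_cons => le_tot.
have le_ci := cs_le _ _ le_c.
congr cons; last by apply: ih => //; lia.
apply/ffunP => j; apply/eqP; rewrite eqn_leq le_c/= leqNgt; apply/negP => lt.
have : (color_size c < color_size (block_at i))%N.
  rewrite /color_size (bigD1 j)//= [X in (_ < X)%N](bigD1 j)//= -addSn leq_add//.
  by apply: leq_sum => k _; exact: le_c.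
by lia.
Qed.

(** A sample of all the items is [A] itself: the sampled blocks fit into distinct blocks of
[A] and have the same total size, so that all of them are full and none is missing. *)
Lemma hypergeometric_top (B : chromatic_partition q N) : hypergeometric B != 0 -> B = A.
Proof.
move=> hB; apply: val_inj => /=.
set l := enum_mset (mset_of_cp B); set s := enum_mset (mset_of_cp A).
have l0 : all nonempty_block l := chromatic_all B.
have [t wt] : exists t, seat_weight urn_weight [seq (false, b) | b <- l] t != 0.
  apply: contrapT => no; case/eqP: hB; rewrite /hypergeometric /urn /seat_sum esum1 ?mulr0 ?mul0r//.
  move=> t _; congr (_%:E); apply/eqP/negPn/negP => wt; apply: no; by exists t.
have zipF : zip [seq (false, b) | b <- l] t = [seq ((false, p.1), p.2) | p <- zip l t].
  by elim: (l) (t) => [|? ? IH] [|? ?] //=; rewrite IH.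
move: wt; rewrite seat_weightE mulf_eq0 negb_or zipF big_map.
case: (boolP (_ && uniq _)); last by rewrite eqxx.
rewrite size_map => /andP[/eqP szt ut] /andP[_ ]; rewrite prodf_seq_neq0 => /allP prod0.
have t_neq0 p : p \in zip l t -> p.2 != 0%N.
  by move/prod0; rewrite implyTb; apply: contraNneq => ->; rewrite /= eqxx.
have le_block p : p \in zip l t -> forall j, (p.1 j <= block_at p.2 j)%N.
  move=> pz j; have := prod0 _ pz; rewrite /= (negbTE (t_neq0 _ pz))/= pnatr_eq0 -lt0n.
  by rewrite (bigD1 j)//= muln_gt0 ffact_gt0 => /andP[].
have t1 i : i \in t -> exists2 c, (c, i) \in zip l t & c \in l.
  move=> it; exists (nth [ffun=> 0%N] l (index i t)).
    apply/(nthP ([ffun=> 0%N], 0%N)); exists (index i t).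
      by rewrite size_zip szt minnn -szt index_mem.
    by rewrite nth_zip ?szt// nth_index.
  by rewrite mem_nth// -szt index_mem.
have t_sub : {subset t <= iota 1 (size s)}.
  move=> i it; have [c cz cl] := t1 _ it.
  rewrite mem_iota lt0n (t_neq0 _ cz)/= add1n ltnNge; apply/negP => lei.
  have /allP/(_ c cl) := l0; case/eqP; apply/ffunP => j; apply/eqP.
  have := le_block _ cz j; rewrite /block_at /= nth_default//=.
  by rewrite !ffunE leqn0.
have ut' : uniq t.
  rewrite (_ : t = [seq i <- t | i != 0%N])//; apply/esym/all_filterP/allP => i it.
  by have [c cz _] := t1 _ it; exact: t_neq0 cz.
have sE : s = map block_at (iota 1 (size s)).
  apply: (@eq_from_nth _ [ffun=> 0%N]); first by rewrite size_map size_iota.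
  by move=> i ltis; rewrite (nth_map 0%N) ?size_iota// nth_iota.
have sumN : (\sum_(i <- iota 1 (size s)) color_size (block_at i) = N)%N.
  rewrite -(chromatic_weight A) weight_enum -/s.
  by rewrite [in RHS]sE big_map.
have splitN : N = (\sum_(i <- t) color_size (block_at i) +
    \sum_(i <- iota 1 (size s) | i \notin t) color_size (block_at i))%N.
  rewrite -{1}sumN (bigID (mem t))/=; congr addn.
  rewrite -big_filter; apply: perm_big; apply: uniq_perm => //.
    by rewrite filter_uniq// iota_uniq.
  move=> i; rewrite mem_filter; case: (boolP (i \in t)) => // it.
  by rewrite (t_sub _ it).
have tE : (\sum_(i <- t) color_size (block_at i) <= N)%N by rewrite [leqRHS]splitN leq_addr.
have lN : (\sum_(c <- l) color_size c = N)%N by rewrite -weight_enum chromatic_weight.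
have lE : l = map block_at t by apply: seated_blocks => //; rewrite lN.
have pt : perm_eq t (iota 1 (size s)).
  apply: uniq_perm => //; first exact: iota_uniq.
  move=> i; apply/idP/idP; first exact: t_sub.
  move=> i1; apply: contraT => it.
  have : (\sum_(i <- t) color_size (block_at i) < N)%N.
    rewrite [ltnRHS]splitN.
    rewrite -[X in (X < _)%N]addn0 ltn_add2l (big_rem i)//= it addn_gt0; apply/orP; left.
    rewrite lt0n color_size_eq0 negbK.
    move: i1; rewrite mem_iota add1n => /andP[i1 ltis].
    apply: (allP (chromatic_all A)); rewrite /block_at -(prednK i1)/= mem_nth//.
    by rewrite -ltnS prednK.
  by rewrite -lN lE big_map ltnn.
have pls : perm_eq l s.
  by rewrite lE sE perm_map.
by rewrite -[LHS]seq_mset_id -[RHS]seq_mset_id; apply/eq_seq_msetP.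
Qed.

(** Removing items at random one by one leaves a uniform sample: by [hypergeometric_step] the
hypergeometric laws are consistent, and by [hypergeometric_top] they start from [A]. *)
Lemma transition_hypergeometric n (B : chromatic_partition q n) : (n <= N)%N ->
  transition R n N A B = hypergeometric B.
Proof.
move=> nN.
have top1 : hypergeometric A = 1.
  rewrite -hypergeometric0 (@chain_mass _ _ (fun k B => hypergeometric B) 0 N)//.
    rewrite (bigD1 A)//= big1 ?addr0// => C CA; apply/eqP/negPn/negP => /hypergeometric_top.
    by apply/eqP.
  by move=> k C /andP[_ kN]; exact: hypergeometric_step.
rewrite (@chain_transition _ _ (fun k B => hypergeometric B) n N)//; last first.
  by move=> k C /andP[_ kN]; exact: hypergeometric_step.
rewrite (bigD1 A)//= top1 mul1r big1 ?addr0// => C CA.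
rewrite (_ : hypergeometric C = 0) ?mul0r//; apply/eqP/negPn/negP => /hypergeometric_top.
by apply/eqP.
Qed.

Lemma empirical_simplex : in_simplex empirical.
Proof.
split=> [i j|]; first by rewrite /empirical divr_ge0.
transitivity (\esum_(i in [set: nat]) ((color_size (block_at i))%:R / N%:R : R)%:E).
  apply: eq_esum => i _; rewrite /empirical -mulr_suml; congr (_ / _)%:E.
  by rewrite /color_size natr_sum.
rewrite (esum_nth (z := [ffun=> 0%N]) _ (f := fun c => ((color_size c)%:R / N%:R : R)%:E));
  last 2 first.
- by move=> c; rewrite lee_fin divr_ge0.
- by rewrite /color_size big1 ?mul0r// => j _; rewrite ffunE.
rewrite big_cons [in X in (X + _)%E]/color_size big1 ?mul0r ?add0e; last first.
  by move=> j _; rewrite ffunE.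
rewrite sumEFin -mulr_suml -natr_sum -weight_enum chromatic_weight divff//.
by rewrite pnatr_eq0 -lt0n.
Qed.

Lemma urn_le_sampling l : all nonempty_block l ->
  urn l <= N%:R ^+ (\sum_(c <- l) color_size c)%N * sampling empirical l.
Proof.
move=> l0; have eS := empirical_simplex.
have e0 i b : 0 <= monomial (empirical i) b by apply: monomial_ge0; have [] := eS.
rewrite -lee_fin EFinM -seat_sum_urn// -(seat_sum_sampling eS)// -esumZl ?exprn_ge0//; last first.
  by move=> t _; rewrite lee_fin seat_weight_ge0.
apply: le_esum => t _; rewrite -EFinM lee_fin.
elim: l t {l0} => [|c l ih] [|i t] //=; rewrite ?big_nil ?big_cons ?mulr0 ?mul1r//.
rewrite exprD mulrACA; apply: ler_pM => //.
- by case: ifP.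
- exact: seat_weight_ge0.
have -> : admits false t i = (i != 0%N) && (i \notin t) by rewrite /admits; case: eqP.
case: ifPn => [/andP[i0 it]|_]; last first.
  by rewrite mulr_ge0// ?exprn_ge0//; case: ifP.
rewrite /admits (negbTE i0) it /urn_weight natr_prod /monomial.
rewrite /color_size -prodrXr -big_split/=; apply: ler_prod => j _.
rewrite ler0n /empirical/= expr_div_n mulrCA divff ?mulr1; last first.
  by rewrite expf_neq0// pnatr_eq0 -lt0n.
rewrite -natrX ler_nat; elim: (c j) => [|m ihm]; first by rewrite ffactn0.
by rewrite ffactnSr expnSr leq_mul// leq_subr.
Qed.

(** Sampling with and without replacement differ little. The probabilities of the latter are
at most those of the former multiplied by the ratio of [N ^ n] to [N ^_ n], and since both
add up to [1], this bound on one side controls the difference on the other side too. *)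
Lemma transition_sampling n (B : chromatic_partition q n) : (n <= N)%N ->
  `|transition R n N A B - sampling_prob empirical B| <= N%:R ^+ n / (N ^_ n)%:R - 1.
Proof.
move=> nN; have eS := empirical_simplex; rewrite transition_hypergeometric//.
set kappa := N%:R ^+ n / (N ^_ n)%:R.
have N0 : N%:R != 0 :> R by rewrite pnatr_eq0 -lt0n.
have Nn0 : 0 < (N ^_ n)%:R :> R by rewrite ltr0n ffact_gt0.
have dom (C : chromatic_partition q n) : hypergeometric C <= kappa * sampling_prob empirical C.
  rewrite /hypergeometric /sampling_prob /kappa.
  rewrite [leRHS](_ : _ = coef R C * (N%:R ^+ n * sampling empirical (enum_mset (mset_of_cp C)))
    / (N ^_ n)%:R); last by ring.
  apply: ler_wpM2r; first by rewrite invr_ge0 ltW.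
  apply: ler_wpM2l; first exact/ltW/coef_gt0.
  apply: le_trans (urn_le_sampling (chromatic_all C)) _.
  by rewrite -weight_enum chromatic_weight.
have mass_h : \sum_(C : chromatic_partition q n) hypergeometric C = 1.
  rewrite -hypergeometric0 (@chain_mass _ _ (fun k B => hypergeometric B) 0 n)//.
  by move=> k C /andP[_ kn]; apply: hypergeometric_step; exact: leq_trans nN.
have mass_s : \sum_(C : chromatic_partition q n) sampling_prob empirical C = 1.
  exact: sampling_prob_sum1.
have s_le1 : sampling_prob empirical B <= 1.
  rewrite -mass_s (bigD1 B)//= lerDl sumr_ge0// => C _; exact: sampling_prob_ge0.
have kappa1 : 0 <= kappa - 1.
  rewrite subr_ge0 /kappa ler_pdivlMr// mul1r -natrX ler_nat.
  elim: n {B nN kappa Nn0 dom mass_h mass_s s_le1} => [|n ih]; first by rewrite ffactn0.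
  by rewrite ffactnSr expnSr leq_mul// leq_subr.
have gap : kappa * sampling_prob empirical B - hypergeometric B <= kappa - 1.
  rewrite -{2}[kappa]mulr1 -{1}mass_s -mass_h mulr_sumr -sumrB (bigD1 B)//= lerDl.
  by rewrite sumr_ge0// => C _; rewrite subr_ge0.
have hB := dom B; have sB := sampling_prob_ge0 eS (mset_of_cp B).
clear dom mass_h mass_s; clearbody kappa; rewrite ler_norml; apply/andP.
by move: (sampling_prob _ _) (hypergeometric B) hB sB s_le1 gap => s h *; split; nra.
Qed.

End Urn.

(** * The sampling functions psi *)

Section Dust.
Variable q : nat.
Implicit Types (a b k m : color_count q) (A B : {mset color_count q}%mset) (j : 'I_q).

Let nil_block : color_count q := [ffun=> 0%N].

Lemma color_count_ind (P : color_count q -> Prop) :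
  P [ffun=> 0%N] -> (forall k j, P k -> P (add_color j k)) -> forall k, P k.
Proof.
move=> P0 PS k; have [n] := ubnP (color_size k); elim: n k => // n ih k.
rewrite ltnS => kn; have [/eqP|] := boolP (color_size k == 0%N).
  by move/eqP; rewrite color_size_eq0 negbK => /eqP ->.
rewrite color_size_eq0 negbK => k0.
have [j kj] := nonempty_pos k0.
rewrite -(csubK kj); apply/PS/ih.
by move: kn; rewrite -{1}(csubK kj) color_sizeD color_size_unit addn1.
Qed.

Lemma dustE m a : dust m a = (\sum_j (if a == unit_count j then m j else 0))%N.
Proof.
rewrite /dust (big_morph (fun A : {mset color_count q}%mset => A a) (id1 := 0%N) (op1 := addn)).
- by apply: eq_bigr => j _; rewrite msetnE.
- by move=> A B; rewrite msetE2.
- by rewrite mset0E.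
Qed.

Lemma dust_unit m j : dust m (unit_count j) = m j.
Proof.
rewrite dustE (bigD1 j)//= eqxx big1 ?addn0// => k kj.
by case: eqP => // /unit_count_inj jk; rewrite jk eqxx in kj.
Qed.

Lemma dust_nonunit m a : ~~ is_unit a -> dust m a = 0%N.
Proof.
move=> /existsPn au; rewrite dustE big1// => j _.
by case: eqP => // aj; move: (au j); rewrite aj eqxx.
Qed.

Lemma dust0 : dust nil_block = mset0.
Proof.
apply/msetP => a; rewrite dustE mset0E big1// => j _.
by rewrite ffunE if_same.
Qed.

Lemma dustS j m : dust (add_color j m) = (unit_count j +` dust m)%mset.
Proof.
apply/msetP => a; rewrite mset1DE.
have [/existsP[k /eqP ->]|au] := boolP (is_unit a).
  rewrite !dust_unit !ffunE addnC; congr (_ + _)%N; congr nat_of_bool.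
  by apply/eqP/eqP => [->//|/unit_count_inj].
rewrite !dust_nonunit// addn0; case: eqP => // aj.
by move: au; rewrite aj is_unit_unit.
Qed.

Lemma perm_enum_msetD A B :
  perm_eq (enum_mset (A `+` B)%mset) (enum_mset A ++ enum_mset B).
Proof.
rewrite perm_sym; have <- : seq_mset (enum_mset A ++ enum_mset B) = (A `+` B)%mset.
  by apply/msetP => a; rewrite mset_seqE count_cat !count_mem_mset msetE2.
by rewrite perm_sym; exact: perm_eq_seq_mset.
Qed.

Lemma enum_dust_unit m : all (@is_unit q) (enum_mset (dust m)).
Proof.
apply/allP => a; rewrite -[_ \in _]/(a \in dust m) -mset_gt0; apply: contraTT => au.
by rewrite dust_nonunit.
Qed.

Lemma weight_dust m : weight (dust m) = color_size m.
Proof.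
elim/color_count_ind: m => [|m j ih].
  rewrite dust0 weight_enum enum_mset0 big_nil; apply/esym/eqP.
  by rewrite color_size_eq0 negbK.
by rewrite dustS weightD1 ih color_sizeD color_size_unit addnC.
Qed.

Lemma weightD A B : weight (A `+` B)%mset = (weight A + weight B)%N.
Proof. by rewrite !weight_enum (perm_big _ (perm_enum_msetD A B))/= big_cat. Qed.

Lemma symfact_dust m B :
  (symfact (dust m `+` B)%mset * \prod_j (B (unit_count j))`! =
   symfact B * \prod_j (B (unit_count j) + m j)`!)%N.
Proof.
elim/color_count_ind: m => [|m j ih].
  by rewrite dust0 mset0D; congr (_ * _)%N; apply: eq_bigr => j _; rewrite ffunE addn0.
rewrite dustS -msetDA symfactD1 vfact_unit muln1 msetE2 dust_unit mulnAC ih.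
rewrite -mulnA; congr (_ * _)%N; rewrite [in LHS](bigD1 j)//= [in RHS](bigD1 j)//=.
rewrite [X in _ = (_ * X)%N](_ : _ = \prod_(i < q | i != j) (B (unit_count i) + m i)`!)%N;
  last first.
  by apply: eq_bigr => k /negbTE kj; rewrite !ffunE kj addn0.
rewrite !ffunE eqxx addn1 addnS factS [(m j + _)%N]addnC.
by move: (_ + _)%N (\prod_(_ < q | _) _)%N => u v; move: u`! => u'; ring.
Qed.

(** The number of ways of choosing which unit blocks are dust. *)
Definition choose_count k m : nat := (\prod_j 'C(k j, m j))%N.

Lemma choose_count0 k m : choose_count k m != 0%N -> forall j, (m j <= k j)%N.
Proof.
move=> km j; rewrite leqNgt; apply: contra km => km.
by rewrite /choose_count (bigD1 j)//= bin_small.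
Qed.

Lemma choose_countS k m j : choose_count (add_color j k) m =
  (choose_count k m + (if (0 < m j)%N then choose_count k (csub m (unit_count j)) else 0))%N.
Proof.
rewrite /choose_count (bigD1 j)//= [in RHS](bigD1 j)//= !ffunE eqxx addn1.
rewrite [X in (_ * X)%N](_ : _ = \prod_(i < q | i != j) 'C(k i, m i))%N; last first.
  by apply: eq_bigr => i /negbTE ij; rewrite !ffunE ij addn0.
case: (posnP (m j)) => [->|mj]; first by rewrite !bin0 addn0.
rewrite [X in (_ + X)%N](bigD1 j)//= !ffunE eqxx.
rewrite [X in (_ + _ * X)%N](_ : _ = \prod_(i < q | i != j) 'C(k i, m i))%N; last first.
  by apply: eq_bigr => i /negbTE ij; rewrite !ffunE ij subn0.
by rewrite -mulnDl; congr (_ * _)%N; rewrite -(prednK mj) binS subn1.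
Qed.

Lemma symfact_remove_dust k m A :
  (forall j, A (unit_count j) = k j) -> (dust m `<=` A)%mset ->
  symfact A = (vfact m * symfact (A `\` dust m)%mset * choose_count k m)%N.
Proof.
move=> Ak mA; set B := (A `\` dust m)%mset.
have Bk j : B (unit_count j) = (k j - m j)%N by rewrite msetE2 dust_unit Ak.
have mk j : (m j <= k j)%N by rewrite -Ak -(dust_unit m j); exact: (msubsetP mA).
have := symfact_dust m B; rewrite msetBDKC//.
under eq_bigr do rewrite Bk.
under [in X in _ = X -> _]eq_bigr do rewrite Bk subnK//.
move=> E.
have P0 : (0 < \prod_(j < q) (k j - m j)`!)%N by rewrite prodn_gt0// => j; exact: fact_gt0.
apply/eqP; rewrite -(eqn_pmul2r P0) E; apply/eqP.
rewrite /vfact /choose_count [RHS]mulnC [(_ * symfact B)%N]mulnC -!mulnA [RHS]mulnCA.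
congr (_ * _)%N.
rewrite [RHS]mulnC -!big_split/=; apply: eq_bigr => j _.
by rewrite -(bin_fact (mk j)); ring.
Qed.

End Dust.

Section Psi.
Variables (R : realType) (q : nat) (x : nat -> 'I_q -> R).
Hypothesis x_ge0 : forall i j, 0 <= x i j.
Implicit Types (a b k m : color_count q) (A B : {mset color_count q}%mset) (j : 'I_q).

Let w (i : nat) b := monomial (x i) b.

Let w_ge0 i b : 0 <= w i b. Proof. exact: monomial_ge0. Qed.

Let undust (L : seq (color_count q)) : seq (bool * color_count q) := [seq (false, b) | b <- L].
Let todust (L : seq (color_count q)) : seq (bool * color_count q) := [seq (true, b) | b <- L].

(** Injections into the positive integers, as in the definition of [phi], are placements in
which no item is flagged. *)
Lemma esum_injections (l : seq (color_count q)) (s := size l) :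
  \esum_(iota in [set iota : {ffun 'I_s -> nat} |
                   injective iota /\ forall h, (1 <= iota h)%N])
     (\prod_(h < s) monomial (x (iota h)) (nth [ffun=> 0%N] l h))%:E =
  seat_sum w (undust l).
Proof.
pose D := [set t : seq nat | size t = s /\ uniq t /\ forall i, i \in t -> i != 0%N].
have -> : seat_sum w (undust l) = \esum_(t in D) (seat_weight w (undust l) t)%:E.
  rewrite [RHS]esum_mkcond; apply: eq_esum => t _; case: ifPn => // tD.
  congr (_%:E); apply/eqP/negPn/negP; rewrite seat_weightE mulf_eq0 negb_or.
  case: (boolP (_ && uniq _)); last by rewrite eqxx.
  rewrite size_map => /andP[/eqP szt ut] /andP[_ prod0]; case/negP: tD; apply/mem_set.
  have t0 i : i \in t -> i != 0%N.
    move=> it; have : ((false, nth [ffun=> 0%N] l (index i t)), i) \in zip (undust l) t.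
      apply/(nthP ((false, [ffun=> 0%N]), 0%N)); exists (index i t).
        by rewrite size_zip size_map szt minnn -szt index_mem.
      rewrite nth_zip ?size_map ?szt// nth_index// (nth_map [ffun=> 0%N])//.
      by rewrite -szt index_mem.
    move: prod0; rewrite prodf_seq_neq0 => /allP H /H /=; rewrite andbT.
    by apply: contraNneq => ->; rewrite /= eqxx.
  split; [by []|split => //].
  by rewrite (_ : t = [seq i <- t | i != 0%N])//; apply/esym/all_filterP/allP.
have nthc (iota : {ffun 'I_s -> nat}) (h : 'I_s) : nth 0%N (codom iota) h = iota h.
  by rewrite /codom /image_mem (nth_map h) ?size_enum_ord// nth_ord_enum.
rewrite [RHS](reindex_esum [set iota : {ffun 'I_s -> nat} |
    injective iota /\ forall h, (1 <= iota h)%N] _ (fun iota => codom iota)).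
  apply: eq_esum => iota [iI i1]; congr (_%:E).
  have szc : size (codom iota) = s by rewrite size_codom card_ord.
  have szu : size (undust l) = s by rewrite size_map.
  rewrite seat_weightE szc szu eqxx/= (_ : [seq _ <- _ | _] = codom iota); last first.
    by apply/all_filterP/allP => _ /codomP[h ->]; rewrite -lt0n.
  have -> : uniq (codom iota) by exact/injectiveP.
  rewrite mul1r (big_nth ((false, [ffun=> 0%N]), 0%N)) size_zip szc szu minnn.
  rewrite big_mkord; apply: eq_bigr => h _.
  rewrite nth_zip ?szc ?szu//= nthc.
  by rewrite (nth_map [ffun=> 0%N])//= andbT eqn0Ngt i1.
split.
- move=> iota [iI i1]; split; first by rewrite size_codom card_ord.
  by split=> [|_ /codomP[h ->]]; [exact/injectiveP|rewrite -lt0n].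
- move=> i1 i2 _ _ /= E; apply/ffunP => h; by rewrite -!nthc E.
- move=> t [szt [ut t0]] /=; exists [ffun h : 'I_s => nth 0%N t h].
    split=> [h h'|h].
      rewrite !ffunE => /eqP; rewrite nth_uniq ?szt// => /eqP; exact: val_inj.
    by rewrite ffunE lt0n t0// mem_nth// szt.
  apply: (@eq_from_nth _ 0%N); first by rewrite size_codom card_ord szt.
  rewrite size_codom card_ord => i ltis.
  by rewrite (nthc _ (Ordinal ltis)) ffunE.
Qed.

Lemma phiE A : phi A x = ((coef R A)%:E * seat_sum w (undust (enum_mset A)))%E.
Proof.
rewrite /phi esum_injections; congr (_%:E * _)%E.
  by rewrite /coef /symfact natr_prod -prodfV; congr (_ * _); apply: eq_bigr => a _;
    rewrite natrM natrX.
apply: seat_sum_perm; apply: perm_map; rewrite /blocks; exact/permPl/perm_sort.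
Qed.

Lemma seat_sum_perm_dust k L (j : 'I_q) (d : bool) (f : color_count q -> bool * color_count q) :
  perm_eq ((d, unit_count j) :: map f (enum_mset (dust k)) ++ L)
          (map f (enum_mset (dust k)) ++ (d, unit_count j) :: L).
Proof. by rewrite -(cat1s (d, unit_count j) L) perm_sym perm_catCA. Qed.

(** Each of the flagged unit blocks in [dust k] goes to the dust or to a box of its own, as in
[seat_sum_dust]; grouping the choices by the number of dust items of each colour yields
binomial coefficients. The sum is over all [m], where only finitely many terms are nonzero,
which makes Pascal's rule a plain shift of the summation index. *)
Lemma seat_sum_dust_expand k L :
  seat_sum w (todust (enum_mset (dust k)) ++ L) =
  (\esum_(m in [set: color_count q]) (((choose_count k m)%:R * monomial (x 0%N) m)%:E *
     seat_sum w (undust (enum_mset (dust (csub k m))) ++ L)))%E.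
Proof.
have term0 k' m L' : (0 <= ((choose_count k' m)%:R * monomial (x 0%N) m)%:E *
     seat_sum w (undust (enum_mset (dust (csub k' m))) ++ L'))%E.
  by rewrite mule_ge0// ?seat_sum_ge0// lee_fin mulr_ge0// monomial_ge0.
elim/color_count_ind: k L => [|k j ih] L.
  rewrite (esumID [set [ffun=> 0%N]])// setTI esum_set1//.
  rewrite [X in (_ + X)%E]esum1 ?adde0; last first.
    move=> m [_ /= m0]; rewrite (_ : choose_count _ m = 0%N) ?mul0r ?mul0e//.
    apply/eqP/negPn/negP => /choose_count0 mj; apply: m0; apply/ffunP => j.
    by have := mj j; rewrite !ffunE leqn0 => /eqP.
  rewrite (_ : csub _ _ = [ffun=> 0%N]); last by apply/ffunP => j; rewrite !ffunE.
  rewrite dust0 enum_mset0 /choose_count /monomial !big1 ?mul1r ?mul1e//.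
  - by move=> j _; rewrite ffunE expr0.
  - by move=> j _; rewrite !ffunE bin0.
transitivity (seat_sum w ((true, unit_count j) :: todust (enum_mset (dust k)) ++ L)).
  apply: seat_sum_perm; rewrite dustS.
  by rewrite -cat_cons perm_cat2r (perm_map _ (perm_enum_mset1D _ _)).
rewrite seat_sum_dust// [X in (_ + X)%E](seat_sum_perm w (seat_sum_perm_dust _ _ _ _ _)) !ih.
rewrite -esumZl ?w_ge0// addeC.
transitivity (\esum_(m in [set: color_count q])
   ((((choose_count k m)%:R * monomial (x 0%N) m)%:E *
      seat_sum w (undust (enum_mset (dust (csub k m))) ++ (false, unit_count j) :: L)) +
    (if (0 < m j)%N then
      ((choose_count k (csub m (unit_count j)))%:R * monomial (x 0%N) m)%:E *
      seat_sum w (undust (enum_mset (dust (csub (add_color j k) m))) ++ L) else 0)))%E; last first.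
  apply: eq_esum => m _; rewrite choose_countS natrD mulrDl EFinD ge0_muleDl ?lee_fin; last 2 first.
  - by rewrite mulr_ge0// monomial_ge0.
  - by rewrite mulr_ge0// monomial_ge0.
  congr (_ + _)%E; last by case: ifP => // _; rewrite mul0r mul0e.
  have [->|/choose_count0 mk] := eqVneq (choose_count k m) 0%N; first by rewrite mul0r !mul0e.
  congr (_ * _)%E; rewrite -(seat_sum_perm w (seat_sum_perm_dust _ _ _ _ _)).
  apply: seat_sum_perm.
  rewrite (_ : csub (add_color j k) m = add_color j (csub k m)); last first.
    by apply/ffunP => i; rewrite !ffunE addnBAC.
  rewrite dustS -cat_cons perm_cat2r perm_sym.
  exact: (perm_map _ (perm_enum_mset1D _ _)).
rewrite esumD//; last first.
  move=> m _; case: ifP => // _; rewrite mule_ge0// ?seat_sum_ge0//.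
  by rewrite lee_fin mulr_ge0// monomial_ge0.
congr (_ + _)%E.
transitivity (\esum_(m in [set m : color_count q | (0 < m j)%N])
  (((choose_count k (csub m (unit_count j)))%:R * monomial (x 0%N) m)%:E *
      seat_sum w (undust (enum_mset (dust (csub (add_color j k) m))) ++ L)))%E; last first.
  rewrite esum_mkcond; apply: eq_esum => m _; congr (if _ then _ else _).
  by apply/idP/idP; rewrite in_setE.
rewrite [RHS](reindex_esum [set: color_count q] _ (add_color j)).
  apply: eq_esum => m _; rewrite /add_color caddK monomialD monomial_unit muleA.
  congr (_ * _)%E; first by rewrite /w monomial_unit -EFinM; congr (_%:E); ring.
  rewrite (_ : csub (cadd k _) _ = csub k m)//.
  by apply/ffunP => i; rewrite !ffunE subnDr.
split => //.
- by move=> m _; rewrite /= !ffunE eqxx addn1.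
- by move=> m m' _ _; exact: caddI.
- by move=> m /= mj; exists (csub m (unit_count j)) => //; exact: csubK.
Qed.

Lemma dust_set_finite A : finite_set [set m : color_count q | (dust m `<=` A)%mset].
Proof.
pose n := (\sum_j A (unit_count j))%N.
apply: (@sub_finite_set _ _
  [set [ffun j => nat_of_ord (f j)] | f in [set: {ffun 'I_q -> 'I_n.+1}]]).
  move=> m /= mA; exists [ffun j => inord (m j)] => //.
  apply/ffunP => j; rewrite !ffunE inordK// ltnS -(dust_unit m j).
  by apply: leq_trans (msubsetP mA _) _; rewrite /n (bigD1 j)//= leq_addr.
apply: finite_image; exact: finite_finset.
Qed.

(** The sum over [m] in [psi] is the expansion of a single sum over placements in which
exactly the unit blocks may go to the dust. *)
Lemma psiE A : psi A x =
  ((coef R A)%:E * seat_sum w (flag_units (enum_mset A)))%E.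
Proof.
pose k : color_count q := [ffun j => A (unit_count j)].
have Ak j : A (unit_count j) = k j by rewrite ffunE.
have dkA : (dust k `<=` A)%mset.
  apply/msubsetP => a; have [/existsP[j /eqP ->]|au] := boolP (is_unit a).
    by rewrite dust_unit Ak.
  by rewrite dust_nonunit.
pose C := (A `\` dust k)%mset.
have mk m : (dust m `<=` A)%mset <-> forall j, (m j <= k j)%N.
  split=> [mA j|le_mk]; first by rewrite -Ak -(dust_unit m j); exact: (msubsetP mA).
  apply/msubsetP => a; have [/existsP[j /eqP ->]|au] := boolP (is_unit a).
    by rewrite dust_unit Ak.
  by rewrite dust_nonunit.
have -> : seat_sum w (flag_units (enum_mset A)) =
          seat_sum w (todust (enum_mset (dust k)) ++ undust (enum_mset C)).
  apply: seat_sum_perm; rewrite -{1}(msetBDKC dkA).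
  apply: (perm_trans (perm_map _ (perm_enum_msetD _ _))).
  rewrite map_cat (_ : map _ (enum_mset (dust k)) = todust (enum_mset (dust k))); last first.
    by apply/eq_in_map => a /(allP (enum_dust_unit k)) ->.
  rewrite (_ : map _ (enum_mset (A `\` dust k)%mset) = undust (enum_mset C))//.
  apply/eq_in_map => a; rewrite -[_ \in _]/(a \in C) in_msetB => aC.
  congr pair; apply/negbTE/negP => /existsP[j /eqP aj].
  by move: aC; rewrite aj dust_unit Ak ltnn.
rewrite seat_sum_dust_expand -esumZl ?(ltW (coef_gt0 _ _))//; last first.
  by move=> m _; rewrite mule_ge0// ?seat_sum_ge0// lee_fin mulr_ge0// monomial_ge0.
rewrite /psi.
have phi0 m : (0 <= (monomial (x 0%N) m / ((vfact m)%:R * (weight A - color_size m)`!%:R))%:E *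
     phi (A `\` dust m)%mset x)%E.
  rewrite phiE mule_ge0// ?lee_fin ?divr_ge0 ?mulr_ge0 ?monomial_ge0// mule_ge0//.
    by rewrite lee_fin ltW// coef_gt0.
  exact: seat_sum_ge0.
rewrite -esum_fset//; last exact: dust_set_finite.
rewrite -esumZl// esum_mkcond; apply: eq_esum => m _.
case: ifPn => mA; last first.
  rewrite (_ : choose_count k m = 0%N) ?mul0r ?mul0e ?mule0//.
  apply/eqP/negPn/negP => /choose_count0 /mk mA'; case/negP: mA; exact/mem_set.
rewrite in_setE/= in mA; have le_mk := (mk m).1 mA.
rewrite phiE !muleA -!EFinM; congr (_%:E * _)%E; last first.
  apply: seat_sum_perm.
  rewrite (_ : (A `\` dust m)%mset = (dust (csub k m) `+` C)%mset); last first.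
    apply/msetP => a; rewrite !msetE2; have [/existsP[j /eqP ->]|au] := boolP (is_unit a).
      rewrite !dust_unit !ffunE; have := le_mk j; rewrite ffunE; lia.
    by rewrite !dust_nonunit.
  by apply: (perm_trans (perm_map _ (perm_enum_msetD _ _))); rewrite map_cat.
have wA : (weight (A `\` dust m)%mset = weight A - color_size m)%N.
  by rewrite -{2}(msetBDKC mA) weightD weight_dust addKn.
rewrite /coef wA (symfact_remove_dust Ak mA) !natrM.
have nz (n : nat) : (0 < n)%N -> n%:R != 0 :> R by rewrite pnatr_eq0 -lt0n.
have c0 : (0 < choose_count k m)%N.
  by rewrite /choose_count prodn_gt0// => j; rewrite bin_gt0.
have h1 := nz _ c0; have h2 := nz _ (vfact_gt0 m).
have h3 := nz _ (symfact_gt0 (A `\` dust m)%mset).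
have h4 := nz _ (fact_gt0 (weight A - color_size m)).
by field; rewrite h1 h2 h3 h4.
Qed.

Lemma psi_simplex n (A : chromatic_partition q n) : in_simplex x ->
  psi A x = (sampling_prob x A)%:E.
Proof. by move=> xS; rewrite psiE seat_sum_sampling ?chromatic_all// -EFinM. Qed.

End Psi.

(** * Limits along ultrafilters *)

Section UltraLimits.
Variables (R : realType) (T : Type) (U : set_system T).
Hypothesis U_ultra : UltraFilter U.

Lemma fmap_ultra (V : Type) (f : T -> V) : UltraFilter (f @ U).
Proof.
split; first exact: fmap_proper_filter.
move=> G GP sG; apply/seteqP; split => A; last exact: sG.
move=> GA; have [//|nA] := in_ultra_setVsetC (f @^-1` A) U_ultra.
have : G (A `&` ~` A) by apply: filterI => //; exact: sG.
by rewrite setICr => /filter_not_empty.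
Qed.

Lemma ultra_cvg (u : T -> R) (a b : R) : (forall n, a <= u n <= b) -> cvg (u n @[n --> U]).
Proof.
move=> uab; have := @segment_compact R a b; rewrite compact_ultra.
move=> /(_ _ (fmap_ultra u))[|l [_ ul]]; last by apply/cvg_ex; exists l.
have PU : ProperFilter U := ultra_proper.
by apply: (@filterS _ U) filterT => n _ /=; rewrite in_itv/=.
Qed.

Lemma ultra_ge (u : T -> R) (a l : R) :
  u n @[n --> U] --> l -> (forall n, a <= u n) -> a <= l.
Proof.
have PU : ProperFilter U := ultra_proper.
move=> ul au; apply: (cvgr_to_ge ul).
by apply: (@filterS _ U) filterT => n _.
Qed.

Lemma ultra_le (u : T -> R) (b l : R) :
  u n @[n --> U] --> l -> (forall n, u n <= b) -> l <= b.
Proof.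
have PU : ProperFilter U := ultra_proper.
move=> ul au; apply: (cvgr_to_le ul).
by apply: (@filterS _ U) filterT => n _.
Qed.

Lemma ultra_unique (u : T -> R) (l l' : R) :
  u n @[n --> U] --> l -> u n @[n --> U] --> l' -> l = l'.
Proof.
have PU : ProperFilter U := ultra_proper.
by move=> ul ul'; rewrite -(cvg_lim (@Rhausdorff R) ul) -(cvg_lim (@Rhausdorff R) ul').
Qed.

Lemma cvg_bigsum (I : Type) (r : seq I) (P : pred I) (u : I -> T -> R) (l : I -> R) :
  (forall i, P i -> u i n @[n --> U] --> l i) ->
  (\sum_(i <- r | P i) u i n) @[n --> U] --> \sum_(i <- r | P i) l i.
Proof.
move=> ul; elim: r => [|i r ih].
  by rewrite big_nil; under eq_fun do rewrite big_nil; exact: cvg_cst.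
rewrite big_cons; under eq_fun do rewrite big_cons.
by case: ifPn => // Pi; apply: cvgD => //; exact: ul.
Qed.

End UltraLimits.

(** * Binary digits *)

Section Digits.
Variable R : realType.

(** What remains of [r] after its first [d] binary digits; the number [1] has all its digits
equal to [1]. *)
Fixpoint residue (d : nat) (r : R) : R :=
  if d is d'.+1 then
    let s := residue d' r in
    if 2 ^- d <= s then s - 2 ^- d else s
  else r.

Definition digit (d : nat) (r : R) : bool := 2 ^- d.+1 <= residue d r.

Lemma half_pow d : 2 ^- d = 2 ^- d.+1 + 2 ^- d.+1 :> R.
Proof.
have p0 : (2 : R) ^+ d != 0 by rewrite expf_neq0.
by rewrite exprS; field; rewrite p0.
Qed.

Lemma half_pow_gt0 d : 0 < 2 ^- d :> R.
Proof. by rewrite invr_gt0 exprn_gt0. Qed.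

Lemma residue_itv d r : 0 <= r <= 1 -> 0 <= residue d r <= 2 ^- d.
Proof.
move=> r01; elim: d => [|d /andP[ge0 le]]; first by rewrite expr0 invr1.
rewrite [residue _ _]/=; case: ifPn => [h|]; first by rewrite subr_ge0 h lerBlDr -half_pow.
by rewrite -ltNge => /ltW ->; rewrite ge0.
Qed.

Lemma digit_expansion D r :
  r = \sum_(0 <= d < D) (digit d r)%:R * 2 ^- d.+1 + residue D r.
Proof.
elim: D => [|D ih]; first by rewrite big_nil add0r.
rewrite big_nat_recr//= -addrA {1}ih; congr (_ + _).
by rewrite /digit; case: ifP => _; rewrite ?mul1r ?mul0r ?add0r// subrKC.
Qed.

End Digits.

(** * From finitely additive to Lebesgue measure *)

Section Realization.
Variables (R : realType) (G : Type) (m : (G -> bool) -> R).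
Hypothesis m_ge0 : forall A, 0 <= m A.
Hypothesis m_full : m xpredT = 1.
Hypothesis m_split : forall A B : G -> bool,
  m B = m (fun y => (A y == true) && B y) + m (fun y => (A y == false) && B y).
Variable beta : nat -> G -> bool.
Implicit Type w : seq bool.

(** Lebesgue measure on the unit interval, which is countably additive, takes the place of the
finitely additive [m]: the event that the first tests [beta] have given outcomes becomes a
cell, an interval of the same length, and the cells refine each other. A point of the unit
interval is only a sequence of outcomes, but each of its finite parts is realized in [G].
Words of outcomes start with the most recent one. *)
Fixpoint cylinder w : G -> bool :=
  if w is b :: w' then fun y => (beta (size w') y == b) && cylinder w' y else xpredT.

Fixpoint left_end w : R :=
  if w is b :: w' then
    left_end w' + (if b then m (cylinder (false :: w')) else 0)
  else 0.

Definition cell w : set R := `[left_end w, left_end w + m (cylinder w)[%classic.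

Fixpoint word (n : nat) (omega : R) : seq bool :=
  if n is n'.+1 then (left_end (true :: word n' omega) <= omega) :: word n' omega
  else [::].

Definition random_bit (n : nat) (omega : R) : bool :=
  left_end (true :: word n omega) <= omega.

Lemma size_word n omega : size (word n omega) = n.
Proof. by elim: n => //= n ->. Qed.

Lemma cylinder_split w : m (cylinder w) =
  m (cylinder (false :: w)) + m (cylinder (true :: w)).
Proof. by rewrite (m_split (beta (size w))) addrC. Qed.

Lemma right_end_true w : left_end (true :: w) + m (cylinder (true :: w)) =
  left_end w + m (cylinder w).
Proof. by rewrite [in RHS]cylinder_split addrA. Qed.

Lemma cell_nil : cell [::] = `[0, 1[%classic.
Proof. by rewrite /cell /= m_full add0r. Qed.

Lemma cellU w : cell w = cell (false :: w) `|` cell (true :: w).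
Proof.
rewrite /cell right_end_true; apply/seteqP; split => t /=; rewrite !in_itv/= addr0.
  move=> /andP[lt tr]; case: (ltP t (left_end w + m (cylinder (false :: w)))) => h.
    by left; rewrite lt.
  by right; rewrite tr andbT.
have f0 := m_ge0 (cylinder (false :: w)); have t0 := m_ge0 (cylinder (true :: w)).
have := cylinder_split w; rewrite /= in f0 t0 * => E.
by case=> /andP[h1 h2]; apply/andP; split; lra.
Qed.

Lemma cellI w : cell (false :: w) `&` cell (true :: w) = set0.
Proof.
apply/seteqP; split => t //=; rewrite /cell /= !in_itv/= addr0.
by move=> [/andP[_ h1] /andP[h2 _]]; lra.
Qed.

Lemma cell_cons b w : cell (b :: w) `<=` cell w.
Proof. by rewrite [X in _ `<=` X]cellU; case: b; [exact: subsetUr|exact: subsetUl]. Qed.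

Lemma word_cell w omega : cell w omega -> word (size w) omega = w.
Proof.
elim: w => [//|b w ih] cbw /=; have cw := cell_cons cbw.
rewrite ih//; congr cons; case: b cbw; rewrite /cell /= in_itv/=.
  by move=> /andP[].
by rewrite addr0 => /andP[_ h]; apply/negbTE; rewrite -ltNge.
Qed.

Lemma cell_word n omega : `[0, 1[%classic omega -> cell (word n omega) omega.
Proof.
move=> o01; elim: n => [|n ih]; first by rewrite /= cell_nil.
move: ih; rewrite {1}cellU => -[h|h] /=.
- rewrite (_ : _ <= omega = false)//; apply/negbTE; rewrite -ltNge.
  by move: h; rewrite /cell /= in_itv/= addr0 => /andP[].
- by rewrite (_ : _ <= omega = true)//; move: h; rewrite /cell /= in_itv/= => /andP[].
Qed.

Lemma m_empty : m (fun=> false) = 0.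
Proof.
have : m xpredT = m xpredT + m (fun=> false) by exact: (m_split xpredT xpredT).
rewrite m_full; lra.
Qed.

(** A cell that contains a point has positive length. *)
Lemma cylinder_nonempty n omega : `[0, 1[%classic omega ->
  exists y, cylinder (word n omega) y.
Proof.
move=> /(cell_word n); rewrite /cell /= in_itv/= => /andP[h1 h2].
apply: contrapT => no; have E : cylinder (word n omega) = fun=> false.
  by apply/funext => y; apply/negbTE/negP => cy; apply: no; exists y.
by move: h2; rewrite E m_empty addr0 ltNge h1.
Qed.

Lemma cylinder_word n N omega y : (n < N)%N -> cylinder (word N omega) y ->
  beta n y = random_bit n omega.
Proof.
elim: N => [//|N ih]; rewrite ltnS leq_eqVlt => /predU1P[->|nN] /= /andP[/eqP h1 h2].
  by move: h1; rewrite /random_bit /= size_word.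
exact: ih.
Qed.

Lemma measurable_cell w : measurable (cell w).
Proof. exact: measurable_itv. Qed.

Lemma lebesgue_cell w : lebesgue_measure (cell w) = (m (cylinder w))%:E.
Proof.
rewrite /cell lebesgue_measure_itv/= lte_fin -EFinD addrAC subrr add0r.
case: ifPn => //; rewrite -leNgt => h; congr (_%:E); apply/eqP.
by rewrite eq_le m_ge0/=; lra.
Qed.

Lemma random_bit_cell n w : (size w <= n)%N ->
  measurable (cell w `&` [set omega | random_bit n omega]) /\
  lebesgue_measure (cell w `&` [set omega | random_bit n omega]) =
    (m (fun y => (beta n y == true) && cylinder w y))%:E.
Proof.
move=> wn; move: {2}(n - size w)%N (erefl (n - size w)%N) => k.
elim: k w wn => [|k ih] w wn wk.
  have {wk}wn : size w = n by apply/eqP; rewrite eqn_leq wn -subn_eq0 wk.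
  have -> : cell w `&` [set omega | random_bit n omega] = cell (true :: w).
    apply/seteqP; split => t /=.
      move=> [cw]; rewrite /random_bit -wn (word_cell cw) => h.
      rewrite /cell /= in_itv/=; apply/andP; split => //.
      have := right_end_true w; rewrite /= => ->.
      by move: cw; rewrite /cell/= in_itv/= => /andP[].
    move=> ct; split; first exact: cell_cons ct.
    rewrite /random_bit -wn (word_cell (cell_cons ct)).
    by move: ct; rewrite /cell/= in_itv/= => /andP[].
  by split; [exact: measurable_cell|rewrite lebesgue_cell/= wn].
have sw : (size w < n)%N by rewrite -subn_gt0 wk.
have sk : (n - (size w).+1)%N = k by rewrite subnS wk.
have [mf ef] := ih (false :: w) sw sk; have [mt et] := ih (true :: w) sw sk.
rewrite cellU setIUl; split; first exact: measurableU.
rewrite measureU//; last first.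
  by rewrite setIACA cellI set0I.
apply: (etrans (congr2 adde ef et)).
rewrite /adde/= [in RHS](m_split (beta (size w))) addrC; congr (_ + _)%:E; congr m;
  by apply/funext => y /=; rewrite andbCA.
Qed.

Lemma measurable_random_bit n :
  measurable (`[0, 1[%classic `&` [set omega : R | random_bit n omega]).
Proof. by rewrite -cell_nil; have [] := @random_bit_cell n [::] (leq0n _). Qed.

Lemma lebesgue_random_bit n :
  lebesgue_measure (`[0, 1[%classic `&` [set omega : R | random_bit n omega]) =
  (m (beta n))%:E.
Proof.
rewrite -cell_nil; have [_ ->] := @random_bit_cell n [::] (leq0n _).
by congr (m _)%:E; apply/funext => y /=; rewrite andbT eqb_id.
Qed.

End Realization.

(** * Random limits *)

Section RandomLimits.
Variables (R : realType) (T : Type) (g : nat -> T -> R).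
Hypothesis g01 : forall k y, 0 <= g k y <= 1.
Variables (I : nat -> finType) (p : forall N, I N -> R) (y : forall N, I N -> T).
Hypothesis p_ge0 : forall N i, 0 <= p (N := N) i.
Hypothesis p_sum : forall N, \sum_i p (N := N) i = 1.

Let mean (N : nat) (f : T -> R) : R := \sum_i p i * f (y (N := N) i).

Let mean_ge0 N f : (forall t, 0 <= f t) -> 0 <= mean N f.
Proof. by move=> f0; rewrite sumr_ge0// => i _; rewrite mulr_ge0. Qed.

Let mean_le1 N f : (forall t, f t <= 1) -> mean N f <= 1.
Proof.
move=> f1; rewrite -(p_sum N); apply: ler_sum => i _.
by rewrite ler_piMr.
Qed.

Section Along.
Variable U : set_system nat.
Hypothesis U_ultra : UltraFilter U.
Hypothesis U_oo : \oo `<=` U.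

(** A finitely additive probability on all the subsets of [T]. *)
Let m (A : T -> bool) : R := lim ((mean N (fun t => (A t)%:R)) @[N --> U]).

Let m_cvg (A : T -> bool) : (mean N (fun t => (A t)%:R)) @[N --> U] --> m A.
Proof.
apply: (@ultra_cvg _ _ _ U_ultra _ 0 1) => N.
by rewrite mean_ge0 ?mean_le1// => t; case: (A t).
Qed.

Let m_ge0 A : 0 <= m A.
Proof.
apply: (ultra_ge U_ultra (@m_cvg A)) => N.
by apply: mean_ge0 => t; case: (A t).
Qed.

Let m_full : m xpredT = 1.
Proof.
rewrite /m (_ : (fun N => _) = fun=> 1) ?lim_cst//.
by apply/funext => N; rewrite /mean; under eq_bigr do rewrite mulr1; exact: p_sum.
Qed.

Let m_split (A B : T -> bool) :
  m B = m (fun y => (A y == true) && B y) + m (fun y => (A y == false) && B y).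
Proof.
apply: (ultra_unique U_ultra (@m_cvg B)).
rewrite (_ : (fun N => mean N (fun t => (B t)%:R)) =
  (fun N => mean N (fun t => ((A t == true) && B t)%:R) +
            mean N (fun t => ((A t == false) && B t)%:R))).
  by apply: cvgD.
apply/funext => N; rewrite /mean -big_split; apply: eq_bigr => i _ /=.
by rewrite -mulrDr -natrD; case: (A _); case: (B _).
Qed.

(** The tests are the binary digits of the observables [g k]. *)
Let beta (n : nat) (t : T) : bool :=
  if choice.unpickle n is Some (k, d) then digit d (g k t) else false.

Let betaE (k d : nat) t : beta (choice.pickle (k, d)) t = digit d (g k t).
Proof. by rewrite /beta choice.pickleK. Qed.

Let bitset (k d : nat) : set R :=
  `[0, 1[%classic `&` [set omega | random_bit m beta (choice.pickle (k, d)) omega].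

Let partial k D (omega : R) : R :=
  \sum_(0 <= d < D) \1_(bitset k d) omega * 2 ^- d.+1.

Let m_bitset k d : measurable (bitset k d).
Proof. apply: measurable_random_bit; [exact: m_ge0|exact: m_full|exact: m_split]. Qed.

Let partial_step k D omega : partial k D omega <= partial k D.+1 omega.
Proof.
rewrite /partial big_nat_recr//= lerDl mulr_ge0// ?(ltW (half_pow_gt0 _ _)).
Qed.

Let partial_nd k omega : nondecreasing_seq (fun D => partial k D omega).
Proof. by apply/nondecreasing_seqP => D; exact: partial_step. Qed.

Let partial_tail k D n omega : partial k (D + n) omega <= partial k D omega + 2 ^- D - 2 ^- (D + n).
Proof.
elim: n => [|n ih]; first by rewrite addn0 addrK.
have pS : partial k (D + n).+1 omega =
    partial k (D + n) omega + \1_(bitset k (D + n)) omega * 2 ^- (D + n).+1.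
  by rewrite /partial big_nat_recr.
rewrite addnS pS.
have : \1_(bitset k (D + n)) omega * 2 ^- (D + n).+1 <= 2 ^- (D + n).+1 :> R.
  apply: ler_piMl; first exact/ltW/half_pow_gt0.
  by rewrite indicE lern1 leq_b1.
by have := half_pow R (D + n); lra.
Qed.

Let partial_le k D D' omega : (D <= D')%N ->
  partial k D' omega <= partial k D omega + 2 ^- D.
Proof.
move=> /subnKC <-; apply: le_trans (partial_tail _ _ _ _) _.
by rewrite lerBlDr lerDl (ltW (half_pow_gt0 _ _)).
Qed.

Let partial_cvg k omega : cvgn (fun D => partial k D omega).
Proof.
apply: nondecreasing_is_cvgn; first exact: partial_nd.
exists (partial k 0 omega + 2 ^- 0) => _ [D _ <-]; exact: partial_le.
Qed.

(** The number whose binary digits are the random bits of the observable [g k]. *)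
Let s k omega := limn (fun D => partial k D omega).

Let s_ge k D omega : partial k D omega <= s k omega.
Proof.
apply: limr_ge; first exact: partial_cvg.
by exists D => // D' /= DD'; exact: partial_nd.
Qed.

Let s_le k D omega : s k omega <= partial k D omega + 2 ^- D.
Proof.
apply: limr_le; first exact: partial_cvg.
by exists D => // D' /= DD'; exact: partial_le.
Qed.

Let measurable_partial k D : measurable_fun [set: R] (partial k D).
Proof.
rewrite /partial; apply: measurable_sum => d.
apply: measurable_funM => //; exact: measurable_indic.
Qed.

Let measurable_s k : measurable_fun [set: R] (s k).
Proof.
apply: (@measurable_fun_cvg _ _ _ _ (partial k)) => [D|omega _].
  exact: measurable_partial.
exact: partial_cvg.
Qed.

Let approx k D (t : T) : g k t =
  \sum_(0 <= d < D) (beta (choice.pickle (k, d)) t)%:R * 2 ^- d.+1 + residue D (g k t).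
Proof.
rewrite {1}(digit_expansion D (g k t)); congr (_ + _); apply: eq_bigr => d _.
by rewrite betaE.
Qed.

Let s_cvg omega : `[0, 1[%classic omega ->
  exists z : nat -> T, forall k, g k (z n) @[n --> \oo] --> s k omega.
Proof.
move=> o01.
have /choice[z zP] : forall n, exists t, cylinder beta (word m beta n omega) t.
  by move=> n; apply: cylinder_nonempty => //; exact: m_split.
exists z => k; apply/cvgrPdist_le => eps eps0.
have [D De] : exists D, 2 ^- D <= eps :> R.
  have : (2^-1 : R) ^+ n @[n --> \oo] --> 0.
    by apply: cvg_expr; rewrite ger0_norm// invf_lt1// ltr1n.
  move=> /cvgrPdist_le/(_ _ eps0)[D _ /(_ D (leqnn D))].
  by rewrite sub0r normrN ger0_norm ?exprn_ge0// exprVn => h; exists D.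
exists (\sum_(0 <= d < D) (choice.pickle (k, d)).+1)%N => // n /= nN.
have E : partial k D omega = \sum_(0 <= d < D) (beta (choice.pickle (k, d)) (z n))%:R * 2 ^- d.+1.
  apply: eq_big_nat => d /andP[_ dD]; congr (_ * _).
  rewrite (@cylinder_word _ _ m beta (choice.pickle (k, d)) n omega)//; last first.
    apply: leq_trans nN; rewrite big_mkord (bigD1 (Ordinal dD))//= leq_addr//.
  rewrite indicE /bitset; congr (_%:R); congr nat_of_bool.
  by apply/idP/idP => [/set_mem[]//|h]; apply/mem_set.
have := approx k D (z n); rewrite -E => ->.
have /andP[r0 r1] := residue_itv D (g01 k (z n)).
have := s_ge k D omega; have := s_le k D omega.
by rewrite ler_norml => *; apply/andP; split; lra.
Qed.

Let integral_partial k D :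
  (\int[lebesgue_measure]_(omega in `[0%R, 1%R[) (partial k D omega)%:E =
   (\sum_(0 <= d < D) m (beta (choice.pickle (k, d))) * 2 ^- d.+1)%:E)%E.
Proof.
rewrite /partial; under eq_integral do rewrite -sumEFin.
rewrite ge0_integral_sum//; last first.
  move=> d; apply/measurable_EFinP; apply: measurable_funM; last exact: measurable_cst.
  by apply: measurable_indic; exact: m_bitset.
rewrite -sumEFin; apply: eq_bigr => d _.
under eq_integral do rewrite mulrC EFinM.
have mi : measurable_fun (`[0%R, 1%R[%classic : set R) (EFin \o (\1_(bitset k d) : R -> R)).
  by apply/measurable_EFinP; apply: measurable_indic; exact: m_bitset.
have pos : (0 <= (2 ^- d.+1 : R)%:E)%E by rewrite lee_fin (ltW (half_pow_gt0 _ _)).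
rewrite ge0_integralZl//.
have mb : measurable (bitset k d) by exact: m_bitset.
rewrite integral_indic// [in RHS]mulrC EFinM; congr (_ * _)%E.
rewrite (_ : _ `&` _ = bitset k d); first by apply: lebesgue_random_bit => //; exact: m_split.
by rewrite /bitset setIAC setIid.
Qed.

Let m_sum_cvg (k D : nat) :
  (mean N (fun t => \sum_(0 <= d < D) (beta (choice.pickle (k, d)) t)%:R * 2 ^- d.+1)) @[N --> U]
  --> \sum_(0 <= d < D) m (beta (choice.pickle (k, d))) * 2 ^- d.+1.
Proof.
rewrite (_ : (fun N => _) = (fun N => \sum_(0 <= d < D)
    mean N (fun t => (beta (choice.pickle (k, d)) t)%:R) * 2 ^- d.+1)).
  apply: cvg_bigsum => d _; apply: cvgMl; exact: m_cvg.
apply/funext => N; rewrite /mean; under eq_bigr do rewrite mulr_sumr.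
rewrite exchange_big/=; apply: eq_bigr => d _; rewrite mulr_suml.
by apply: eq_bigr => i _; rewrite mulrA.
Qed.

Let mean_partial (k D N : nat) : R :=
  mean N (fun t => \sum_(0 <= d < D) (beta (choice.pickle (k, d)) t)%:R * 2 ^- d.+1).

Let mean_sandwich k D N :
  mean_partial k D N <= mean N (g k) <= mean_partial k D N + 2 ^- D.
Proof.
set M := mean_partial k D N; have -> : mean N (g k) = M + mean N (fun t => residue D (g k t)).
  rewrite /M /mean_partial /mean -big_split; apply: eq_bigr => i _ /=.
  by rewrite -mulrDr -approx.
rewrite lerDl lerD2l; apply/andP; split.
  by apply: mean_ge0 => t; have /andP[] := residue_itv D (g01 k t).
rewrite -[leRHS]mul1r -[X in _ <= X * _](p_sum N) mulr_suml; apply: ler_sum => i _.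
by rewrite ler_wpM2l//; have /andP[] := residue_itv D (g01 k (y i)).
Qed.

Let integral_s k c : (mean N (g k)) @[N --> \oo] --> c ->
  (\int[lebesgue_measure]_(omega in `[0%R, 1%R[) (s k omega)%:E = c%:E)%E.
Proof.
move=> gc; have gU : (mean N (g k)) @[N --> U] --> c.
  by apply: cvg_trans gc => A; exact: U_oo.
pose M D := \sum_(0 <= d < D) m (beta (choice.pickle (k, d))) * 2 ^- d.+1.
have Mc D : M D <= c <= M D + 2 ^- D.
  have h : (mean N (g k) - mean_partial k D N) @[N --> U] --> c - M D.
    by apply: cvgB => //; exact: m_sum_cvg.
  apply/andP; split.
    rewrite -subr_ge0; apply: (ultra_ge U_ultra h) => N.
    by rewrite subr_ge0; have /andP[] := mean_sandwich k D N.
  rewrite -lerBlDl; apply: (ultra_le U_ultra h) => N.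
  by rewrite lerBlDl; have /andP[] := mean_sandwich k D N.
set J := (\int[_]_(_ in _) _)%E.
have s0 omega : 0 <= s k omega.
  by have := s_ge k 0 omega; rewrite /partial big_nil.
have ms : measurable_fun (`[0%R, 1%R[%classic : set R) (EFin \o s k).
  by apply/measurable_EFinP; apply: measurable_funTS.
have part0 D omega : 0 <= partial k D omega.
  by have := partial_nd k omega (leq0n D); rewrite /partial big_nil.
have mpart D : measurable_fun (`[0%R, 1%R[%classic : set R) (EFin \o partial k D).
  by apply/measurable_EFinP; apply: measurable_funTS.
have JM D : ((M D)%:E <= J <= (M D + 2 ^- D)%:E)%E.
  have mp := mpart D; rewrite EFinD -integral_partial; apply/andP; split.
    apply: ge0_le_integral => //.
    - by move=> omega _; rewrite lee_fin.
    - by move=> omega _; rewrite lee_fin s_ge.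
  apply: (@le_trans _ _ (\int[lebesgue_measure]_(omega in `[0%R, 1%R[)
     ((partial k D omega)%:E + (2 ^- D)%:E))%E).
    apply: ge0_le_integral => //.
    - by move=> omega _; rewrite lee_fin.
    - apply: emeasurable_funD => //; exact: mpart.
    - by move=> omega _; rewrite -EFinD lee_fin s_le.
  rewrite ge0_integralD//; last by move=> omega _; rewrite lee_fin.
  rewrite integral_cst//= lebesgue_measure_itv/= lte_fin ltr01 oppr0 adde0 mule1.
  exact: lexx.
have Jfin : J \is a fin_num.
  have /andP[h1 h2] := JM 0%N.
  by rewrite fin_numE -ltNye -ltey (lt_le_trans _ h1) ?ltNyr//= (le_lt_trans h2) ?ltry.
rewrite -(fineK Jfin); congr (_%:E); apply/eqP; rewrite -subr_eq0 -normr_le0.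
apply/ler_addgt0Pr => eps eps0; rewrite add0r.
have [D De] : exists D, 2 ^- D <= eps :> R.
  have : (2^-1 : R) ^+ n @[n --> \oo] --> 0.
    by apply: cvg_expr; rewrite ger0_norm// invf_lt1// ltr1n.
  move=> /cvgrPdist_le/(_ _ eps0)[D _ /(_ D (leqnn D))].
  by rewrite sub0r normrN ger0_norm ?exprn_ge0// exprVn => h; exists D.
have := JM D; rewrite -(fineK Jfin) !lee_fin => /andP[? ?].
have /andP[? ?] := Mc D.
by rewrite ler_norml; apply/andP; split; lra.
Qed.

Lemma random_limits_along : exists s : nat -> R -> R,
  [/\ forall k, measurable_fun [set: R] (s k),
      forall omega, `[0, 1[%classic omega ->
        exists z : nat -> T, forall k, g k (z n) @[n --> \oo] --> s k omega &
      forall k c, (\sum_i p i * g k (y (N := N) i)) @[N --> \oo] --> c ->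
        (\int[lebesgue_measure]_(omega in `[0%R, 1%R[) (s k omega)%:E = c%:E)%E].
Proof. by exists s; split; [exact: measurable_s|exact: s_cvg|exact: integral_s]. Qed.

End Along.

(** Whatever the space [T], the laws given by the masses [p] at the points [y] have a limit
law for the observables [g], carried by limits of observables at points of [T]. The means
along an ultrafilter define a finitely additive probability, whose digits of the observables
are realized on the unit interval; finitely many digits at a time come from a point of [T],
and determine the observables up to a small error. *)
Theorem random_limits : exists s : nat -> R -> R,
  [/\ forall k, measurable_fun [set: R] (s k),
      forall omega, `[0, 1[%classic omega ->
        exists z : nat -> T, forall k, g k (z n) @[n --> \oo] --> s k omega &
      forall k c, (\sum_i p i * g k (y (N := N) i)) @[N --> \oo] --> c ->
        (\int[lebesgue_measure]_(omega in `[0%R, 1%R[) (s k omega)%:E = c%:E)%E].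
Proof.
have [U [UU ooU]] := ultraFilterLemma (eventually_filter : ProperFilter \oo).
exact: random_limits_along UU ooU.
Qed.

End RandomLimits.

(** * Sorting in shortlex order *)

Section Shortlex.
Variables (R : realType) (q : nat).
Implicit Types u v : 'I_q -> R.

Lemma shortlex_refl u : shortlex_le u u.
Proof. by rewrite /shortlex_le. Qed.

Lemma shortlex_trans u v t : shortlex_le u v -> shortlex_le v t -> shortlex_le u t.
Proof. exact: le_trans. Qed.

Lemma shortlex_total u v : shortlex_le u v || shortlex_le v u.
Proof. exact: le_total. Qed.

Lemma shortlex_norm u v : shortlex_le u v -> vnorm u <= vnorm v.
Proof. by rewrite /shortlex_le lexi_cons => /andP[]. Qed.

Lemma shortlex_norm_lt u v : vnorm u < vnorm v -> shortlex_le u v.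
Proof. by move=> uv; rewrite /shortlex_le lexi_cons (ltW uv)/= leNgt uv. Qed.

Lemma vnorm_sum u : (forall j, 0 <= u j) -> vnorm u = \sum_j u j.
Proof. by move=> u0; apply: eq_bigr => j _; rewrite ger0_norm. Qed.

Lemma vnorm_eq0 u : vnorm u = 0 -> u = fun=> 0.
Proof.
move=> /eqP; rewrite psumr_eq0// => /allP u0; apply/funext => j.
by apply/eqP; rewrite -normr_eq0; apply: u0; rewrite mem_index_enum.
Qed.

Lemma seq_argmax (T : eqType) (le : T -> T -> bool) (s : seq T) :
  (forall x, le x x) -> (forall x y z, le x y -> le y z -> le x z) ->
  (forall x y, le x y || le y x) -> s != [::] ->
  exists2 i, i \in s & forall k, k \in s -> le k i.
Proof.
move=> le_refl le_trans le_total; elim: s => // c [|d s] ih _.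
  by exists c; [rewrite mem_head|move=> k; rewrite inE => /eqP ->].
have [//|i id imax] := ih; case/orP: (le_total c i) => ci.
  exists i; first by rewrite in_cons id orbT.
  by move=> k; rewrite in_cons => /predU1P[->//|/imax].
exists c; first by rewrite mem_head.
by move=> k; rewrite in_cons => /predU1P[->//|/imax ki]; exact: le_trans ki ci.
Qed.

End Shortlex.

Section Sorting.
Variables (R : realType) (q : nat) (z : nat -> 'I_q -> R).
Hypothesis zS : in_simplex z.

Let z0 i j : 0 <= z i j. Proof. by have [+ _] := zS. Qed.

Let vnorm_ge0 i : 0 <= vnorm (z i). Proof. by rewrite sumr_ge0. Qed.

Let sum_vnorm (s : seq nat) : uniq s -> \sum_(i <- s) vnorm (z i) <= 1.
Proof.
move=> us; have [_ z1] := zS; rewrite -lee_fin -z1 -sumEFin.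
rewrite (eq_bigr (fun i => (\sum_j z i j)%:E)); last by move=> i _; rewrite vnorm_sum.
by apply: sum_le_esum => // i; rewrite lee_fin sumr_ge0.
Qed.

Let large_bounded (r : R) (s : seq nat) : 0 < r -> uniq s ->
  (forall i, i \in s -> r <= vnorm (z i)) -> (size s)%:R * r <= 1.
Proof.
move=> r0 us sr; apply: le_trans (sum_vnorm us).
rewrite -sum1_size natr_sum mulr_suml big_seq [leRHS]big_seq; apply: ler_sum => i /sr.
by rewrite mul1r.
Qed.

Let no_long_list (r : R) : 0 < r ->
  ~ forall N, exists s : seq nat, [/\ size s = N, uniq s & forall i, i \in s -> r <= vnorm (z i)].
Proof.
move=> r0 H; have [s [sz us sr]] := H (Num.truncn r^-1).+1.
have := large_bounded r0 us sr; rewrite sz -ler_pdivlMr// mul1r leNgt.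
by rewrite truncnS_gt.
Qed.

Let fresh (s : seq nat) k : (\sum_(i <- s) i < k)%N -> k \notin s.
Proof.
move=> sk; apply/negP => ks.
by move: sk; rewrite ltnNge (big_rem _ ks)/= leq_addr.
Qed.

Let eventually_small (r : R) : 0 < r -> exists M, forall k, (M <= k)%N -> vnorm (z k) < r.
Proof.
move=> r0; apply: contrapT => noM; apply: (no_long_list r0) => N.
elim: N => [|N [s [sz us sr]]]; first by exists [::].
have [k [kM kr]] : exists k, ((\sum_(i <- s) i).+1 <= k)%N /\ r <= vnorm (z k).
  apply: contrapT => nok; apply: noM; exists (\sum_(i <- s) i).+1 => k kM.
  by rewrite ltNge; apply/negP => kr; apply: nok; exists k.
exists (k :: s); split; [by rewrite /= sz| |].
  by rewrite /= us andbT fresh.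
by move=> i; rewrite in_cons => /predU1P[->//|/sr].
Qed.

Let admissible (used : seq nat) (i : nat) : bool := (0 < i)%N && (i \notin used).

(** Only finitely many boxes exceed a given positive size, so that the unused ones have a
shortlex maximum. *)
Let next_exists (used : seq nat) : exists i, admissible used i /\
  forall k, admissible used k -> shortlex_le (z k) (z i).
Proof.
have [k0 k0P] : exists k0, admissible used k0.
  by exists (\sum_(i <- used) i).+1; rewrite /admissible /= fresh.
have [[k1 [k1P k1n]]|none] := pselect (exists k, admissible used k /\ vnorm (z k) != 0); last first.
  have zk k : admissible used k -> z k = fun=> 0.
    move=> kP; apply: vnorm_eq0; apply/eqP/negPn/negP => kn; apply: none; by exists k.
  by exists k0; split => // k kP; rewrite (zk k)// (zk k0)// shortlex_refl.
have r0 : 0 < vnorm (z k1) by rewrite lt_neqAle eq_sym k1n vnorm_ge0.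
have [M small] := eventually_small r0.
have k1M : (k1 < M)%N by rewrite ltnNge; apply/negP => /small; rewrite ltxx.
have k1s : k1 \in [seq k <- iota 0 M | admissible used k].
  by rewrite mem_filter k1P mem_iota.
have [||||i] := @seq_argmax _ (fun k i => shortlex_le (z k) (z i))
  [seq k <- iota 0 M | admissible used k].
- by move=> k; exact: shortlex_refl.
- by move=> a b c; exact: shortlex_trans.
- by move=> a b; exact: shortlex_total.
- by apply/eqP => E; move: k1s; rewrite E.
rewrite mem_filter => /andP[iP _] imax; exists i; split => // k kP.
have [kM|Mk] := ltnP k M; first by apply: imax; rewrite mem_filter kP mem_iota.
apply: shortlex_norm_lt; apply: lt_le_trans (small _ Mk) _.
exact/shortlex_norm/imax.
Qed.

Let next : seq nat -> nat := projT1 (choice next_exists).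

Let nextP used : admissible used (next used) /\
  forall k, admissible used k -> shortlex_le (z k) (z (next used)).
Proof. exact: projT2 (choice next_exists) used. Qed.

Let used := fix used n := if n is n'.+1 then next (used n') :: used n' else [::].

Let sigma n := next (used n).

Let used_uniq n : uniq (used n).
Proof.
elim: n => //= n ->; rewrite andbT.
by have [/andP[_ ?] _] := nextP (used n).
Qed.

Let size_used n : size (used n) = n.
Proof. by elim: n => //= n ->. Qed.

Let mem_used n k : (k < n)%N -> sigma k \in used n.
Proof.
elim: n => // n ih; rewrite ltnS leq_eqVlt => /predU1P[->|/ih h] /=.
  by rewrite mem_head.
by rewrite in_cons h orbT.
Qed.

Let used_mem n i : i \in used n -> exists k, i = sigma k.
Proof.
elim: n => //= n ih; rewrite in_cons => /predU1P[->|//].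
by exists n.
Qed.

Let sigma_inj : injective sigma.
Proof.
have lt k n : (k < n)%N -> sigma k != sigma n.
  move=> kn; apply/eqP => E; have [/andP[_]] := nextP (used n).
  by rewrite -/(sigma n) -E mem_used.
move=> k n E; apply/eqP; apply: contraT; rewrite neq_ltn => /orP[/lt|/lt]; rewrite E eqxx//.
Qed.

Let sigma_gt0 n : (0 < sigma n)%N.
Proof. by have [/andP[]] := nextP (used n). Qed.

Let sigma_sorted n : shortlex_le (z (sigma n.+1)) (z (sigma n)).
Proof.
have [_] := nextP (used n); apply; rewrite /admissible sigma_gt0/=.
have [/andP[_ +] _] := nextP (used n.+1); rewrite -/(sigma n.+1).
by apply: contra => h; rewrite /= in_cons h orbT.
Qed.

Let sigma_onto i : (0 < i)%N -> vnorm (z i) != 0 -> exists n, i = sigma n.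
Proof.
move=> i0 zi; apply: contrapT => no.
have r0 : 0 < vnorm (z i) by rewrite lt_neqAle eq_sym zi vnorm_ge0.
apply: (no_long_list r0) => N; exists (used N); split => // k kN.
have [n ->] := used_mem kN.
have [_ nmax] := nextP (used n); apply/shortlex_norm/nmax.
by rewrite /admissible i0/=; apply/negP => /used_mem.
Qed.

Let sorted_point (i : nat) : 'I_q -> R := if i is n.+1 then z (sigma n) else z 0%N.

Let sorted_ge0 i j : 0 <= sorted_point i j.
Proof. by case: i => [|n]; exact: z0. Qed.

Let esum_sorted (f : ('I_q -> R) -> \bar R) :
  (forall i, 0 <= f (z i))%E -> f (fun=> 0) = 0%E ->
  (\esum_(i in [set: nat]) f (sorted_point i.+1) = \esum_(i in [set: nat]) f (z i.+1))%E.
Proof.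
move=> f0 fz; rewrite /sorted_point.
transitivity (\esum_(i in range sigma) f (z i)).
  rewrite esum_image//; by move=> m n _ _; exact: sigma_inj.
transitivity (\esum_(i in [set i | (0 < i)%N]) f (z i)).
  rewrite esum_mkcond [RHS]esum_mkcond; apply: eq_esum => i _.
  case: ifPn => [/set_mem[n _ <-]|ni].
    by rewrite mem_set//=; exact: sigma_gt0.
  case: ifPn => // /set_mem /= i0; have [zi|zi] := eqVneq (vnorm (z i)) 0.
    by rewrite (vnorm_eq0 zi) fz.
  have [n iE] := sigma_onto i0 zi; case/negP: ni; apply/mem_set; by exists n.
apply: (reindex_esum _ _ S); split => //=.
- by move=> i j _ _ [].
- by move=> [|i]//= _; exists i.
Qed.

(** Always picking the largest unused box visits every nonzero box, since only finitely many
are at least as large as it. The power sums do not depend on the order of the boxes. *)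
Lemma shortlex_sort : exists x : nat -> 'I_q -> R,
  [/\ in_simplex x, forall i, (1 <= i)%N -> shortlex_le (x i.+1) (x i) &
      forall b, nonempty_block b -> power_sum x b = power_sum z b].
Proof.
exists sorted_point; split.
- split=> [//|].
  have [_ <-] := zS; rewrite esum_nat_recl; last first.
    by move=> i; rewrite lee_fin sumr_ge0.
  rewrite [RHS]esum_nat_recl; last by move=> i; rewrite lee_fin sumr_ge0.
  congr (_ + _)%E; apply: (esum_sorted (f := fun u => (\sum_j u j)%:E)).
    by move=> i; rewrite lee_fin sumr_ge0.
  by rewrite big1.
- by case=> // n _; exact: sigma_sorted.
- move=> b b0; rewrite /power_sum; congr fine; rewrite /total_weight.
  have ge0 y : (forall i j, 0 <= y i j) -> forall i : nat,
      (0 <= (if (i == 0%N) && ~~ is_unit b then 0 else monomial (y i) b : R)%:E)%E.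
    by move=> y0 i; rewrite lee_fin; case: ifP => // _; exact: monomial_ge0.
  rewrite esum_nat_recl; last exact: ge0.
  rewrite [RHS]esum_nat_recl; last exact: ge0.
  congr (_ + _)%E; apply: (esum_sorted (f := fun u => (monomial u b)%:E)).
    by move=> i; rewrite lee_fin monomial_ge0.
  have [j bj] := nonempty_pos b0.
  by rewrite /monomial (bigD1 j)//= expr0n gtn_eqF// mul0r.
Qed.

End Sorting.

(** * Limits of sampling functions *)

Section SamplingExt.
Variables (R : realType) (q : nat).
Implicit Types (x y : nat -> 'I_q -> R) (l : seq (color_count q)).

Lemma sampling_unique x f : in_simplex x -> f [::] = 1 ->
  (forall b l, nonempty_block b -> all nonempty_block l ->
    power_sum x b * f l = f (b :: l) +
      \sum_(l' <- alterations (fun a => cadd a b) l) f l') ->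
  forall l, all nonempty_block l -> sampling x l = f l.
Proof.
move=> xS f1 f_rec l; move Es: (size l) => n; elim: n l Es => [|n ih] [|b l] //=.
  by rewrite f1 sampling_nil.
case=> sz /andP[b0 l0]; have := sampling_rec xS b0 l0.
have := f_rec b l b0 l0; rewrite (ih l)// => ->.
rewrite [in X in _ = X -> _](eq_big_seq f) => [/addIr ->//|l' l'l].
by apply: ih; rewrite ?(size_alterations l'l)// (alterations_nonempty l0 l'l).
Qed.

End SamplingExt.

Section TailBound.
Variables (R : realType) (q : nat) (y : nat -> 'I_q -> R).
Hypothesis yS : in_simplex y.

Let y0 i j : 0 <= y i j. Proof. by have [+ _] := yS. Qed.

Definition head_sum (x : nat -> 'I_q -> R) b I := \sum_(i < I) monomial (x i.+1) b.

(** Blocks with at least two items do not see the dust. *)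
Lemma power_sum_tail b : nonempty_block b -> ~~ is_unit b -> forall I,
  (power_sum y b)%:E =
  ((head_sum y b I)%:E + \esum_(i in [set: nat]) (monomial (y (I + i).+1) b)%:E)%E.
Proof.
move=> b0 bu I; rewrite -total_weight_fin// /total_weight bu.
rewrite esum_nat_recl/= ?add0e; last first.
  by move=> i; rewrite lee_fin; case: ifP => // _; exact: monomial_ge0.
rewrite (esum_nat_split I); last by move=> i; rewrite lee_fin monomial_ge0.
by rewrite -sumEFin.
Qed.

Lemma head_sum_le b I : nonempty_block b -> ~~ is_unit b -> head_sum y b I <= power_sum y b.
Proof.
move=> b0 bu; rewrite -lee_fin (power_sum_tail b0 bu I) leeDl//.
by apply: esum_ge0 => i _; rewrite lee_fin monomial_ge0.
Qed.

Lemma head_sum_unit_le j I : head_sum y (unit_count j) I <= power_sum y (unit_count j).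
Proof.
rewrite -lee_fin power_sum_unit// esum_nat_recl; last by move=> i; rewrite lee_fin.
rewrite (esum_nat_split I); last by move=> i; rewrite lee_fin.
apply: (@le_trans _ _ (\sum_(i < I) (y i.+1 j)%:E)%E).
  by rewrite -sumEFin /head_sum; under eq_bigr do rewrite monomial_unit.
rewrite -[leLHS]add0e leeD ?lee_fin// leeDl//.
by apply: esum_ge0 => i _; rewrite lee_fin.
Qed.

Hypothesis y_sorted : forall i, (1 <= i)%N -> shortlex_le (y i.+1) (y i).

Let norm i : R := \sum_j y i j.

Let norm_ge0 i : 0 <= norm i. Proof. exact: sumr_ge0. Qed.

Let esum_norm : \esum_(i in [set: nat]) (norm i)%:E = 1%E.
Proof. by have [] := yS. Qed.

Let norm_mono i k : (i <= k)%N -> norm k.+1 <= norm i.+1.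
Proof.
elim: k => [|k ih]; first by rewrite leqn0 => /eqP ->.
rewrite leq_eqVlt => /predU1P[->//|]; rewrite ltnS => /ih; apply: le_trans.
by have := shortlex_norm (y_sorted (ltn0Sn k)); rewrite !vnorm_sum.
Qed.

(** There are [i.+1] atoms at least as large as this one, and their sizes add up to at most
[1]. *)
Lemma sorted_norm_small i : \sum_j y i.+1 j <= i.+1%:R^-1.
Proof.
rewrite -/(norm i.+1) -[leRHS]mul1r ler_pdivlMr ?ltr0n// mulrC.
have : \sum_(k < i.+1) norm k.+1 <= 1.
  rewrite -lee_fin -esum_norm -sumEFin.
  rewrite esum_nat_recl; last by move=> k; rewrite lee_fin.
  rewrite (esum_nat_split i.+1); last by move=> k; rewrite lee_fin.
  rewrite -[leLHS]add0e leeD ?lee_fin ?norm_ge0// leeDl//.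
  by apply: esum_ge0 => k _; rewrite lee_fin.
apply: le_trans; have -> : i.+1%:R * norm i.+1 = \sum_(k < i.+1) norm i.+1.
  by rewrite sumr_const card_ord mulr_natl.
by apply: ler_sum => k _; rewrite norm_mono// -ltnS.
Qed.

(** A monomial of degree at least two is at most the size times a size that is small in the
tail; this bound is uniform over the simplex. *)
Lemma tail_bound b I : nonempty_block b -> ~~ is_unit b ->
  power_sum y b <= head_sum y b I + I.+1%:R^-1.
Proof.
move=> b0 bu; rewrite -lee_fin (power_sum_tail b0 bu I) EFinD leeD2l//.
have [j bj] := nonempty_pos b0.
have c0 : nonempty_block (csub b (unit_count j)).
  by apply: csub_unit_nonempty => //; apply: contraNneq bu => ->; exact: is_unit_unit.
apply: (@le_trans _ _ (\esum_(i in [set: nat]) (I.+1%:R^-1%:E * (norm (I + i).+1)%:E))%E).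
  apply: le_esum => i _; rewrite lee_fin -(csubK bj) monomialD monomial_unit mulrC.
  apply: ler_pM => //; first exact: monomial_ge0.
    apply: (@le_trans _ _ (norm (I + i).+1)); first by rewrite /norm (bigD1 j)//= lerDl sumr_ge0.
    apply: le_trans (sorted_norm_small I); apply: norm_mono; exact: leq_addr.
  exact: monomial_le_sum.
rewrite (esumZl (a := fun i => (norm (I + i).+1)%:E))//; last by move=> i _; rewrite lee_fin.
rewrite -[leRHS]mule1; apply: lee_wpmul2l; first by rewrite lee_fin.
rewrite -esum_norm [leRHS]esum_nat_recl; last by move=> k; rewrite lee_fin norm_ge0.
rewrite (esum_nat_split I (a := fun i => (norm i.+1)%:E)); last by move=> k; rewrite lee_fin.
rewrite -[leLHS]add0e leeD//; first by rewrite lee_fin norm_ge0.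
by rewrite leeDr// sume_ge0// => k _; rewrite lee_fin.
Qed.

End TailBound.

Section Closedness.
Variables (R : realType) (q : nat) (y : nat -> nat -> 'I_q -> R).
Variable s : seq (color_count q) -> R.
Hypothesis yS : forall n, in_simplex (y n).
Hypothesis y_s : forall l, all nonempty_block l -> sampling (y n) l @[n --> \oo] --> s l.

Let sorted_y : exists y', forall n, [/\ in_simplex (y' n),
  forall i, (1 <= i)%N -> shortlex_le (y' n i.+1) (y' n i) &
  forall b, nonempty_block b -> power_sum (y' n) b = power_sum (y n) b].
Proof.
have /choice[y' y'P] n := shortlex_sort (yS n).
by exists y'.
Qed.

(** A limit of sampling functions is a sampling function: each box has a limit along an
ultrafilter, and the mass that escapes in infinitely many small boxes is added to the dust.
Dust only contributes to the power sums of the unit blocks, and for every other block the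
tail of the power sum is uniformly small. *)
Lemma sampling_closed : exists x, [/\ in_simplex x,
  forall i, (1 <= i)%N -> shortlex_le (x i.+1) (x i) &
  forall l, all nonempty_block l -> sampling x l = s l].
Proof.
have [y' y'P] := sorted_y.
have y'S n : in_simplex (y' n) by have [] := y'P n.
have [U [U_ultra Uoo]] := ultraFilterLemma (F := \oo) _.
have PU : ProperFilter U := ultra_proper.
have lim_p b : nonempty_block b -> power_sum (y' n) b @[n --> U] --> s [:: b].
  move=> b0; have := y_s (l := [:: b]); rewrite /= b0 => /(_ isT) h.
  apply: cvg_trans h; apply: cvg_trans (cvg_app _ Uoo).
  rewrite (_ : (fun n => power_sum (y' n) b) = fun n => sampling (y n) [:: b])//.
  by apply/funext => n; have [_ _ ->//] := y'P n; rewrite sampling1.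
have y'0 n i j : 0 <= y' n i j by have [+ _] := y'S n.
have zt_ex : forall ij : nat * 'I_q,
    exists c : R, y' n ij.1 ij.2 @[n --> U] --> c.
  move=> ij; apply/cvg_ex/(@ultra_cvg _ _ _ U_ultra _ 0 1) => n.
  by rewrite y'0 simplex_le1.
have [zt zt_lim] := choice zt_ex.
pose zp i j := zt (i, j).
have zp_lim i j : y' n i j @[n --> U] --> zp i j by exact: zt_lim (i, j).
have zp0 i j : 0 <= zp i j by apply: (ultra_ge U_ultra (zp_lim i j)) => n.
have lim_mono i b : monomial (y' n i) b @[n --> U] --> monomial (zp i) b.
  rewrite /monomial; elim: (index_enum _) => [|j r ih].
    by rewrite big_nil; under eq_fun do rewrite big_nil; exact: cvg_cst.
  rewrite big_cons; under eq_fun do rewrite big_cons.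
  apply: cvgM => //; elim: (b j) => [|k ihk].
    by rewrite expr0; under eq_fun do rewrite expr0; exact: cvg_cst.
  rewrite exprS; under eq_fun do rewrite exprS.
  exact: cvgM.
have lim_head b I : head_sum (y' n) b I @[n --> U] --> head_sum zp b I.
  by rewrite /head_sum; exact: cvg_bigsum.
have head_unit j I : head_sum zp (unit_count j) I <= s [:: unit_count j].
  apply: (ler_cvg_to (lim_head _ I) (lim_p _ (nonempty_unit j))).
  by apply: (@filterS _ U) filterT => n _; exact: head_sum_unit_le.
have col_le j : (\esum_(i in [set: nat]) (zp i.+1 j)%:E <= (s [:: unit_count j])%:E)%E.
  rewrite -nneseries_esumT; last by move=> i; rewrite lee_fin.
  apply: lime_le; first by apply: is_cvg_nneseries => i _ _; rewrite lee_fin.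
  apply: nearW => I; rewrite big_mkord sumEFin lee_fin.
  by have := head_unit j I; rewrite /head_sum; under eq_bigr do rewrite monomial_unit.
have col_fin j : \esum_(i in [set: nat]) (zp i.+1 j)%:E =
    (fine (\esum_(i in [set: nat]) (zp i.+1 j)%:E))%:E.
  rewrite fineK// ge0_fin_numE; last by apply: esum_ge0 => i _; rewrite lee_fin.
  by apply: le_lt_trans (col_le j) _; rewrite ltry.
pose z i j := if i is i'.+1 then zp i j else
  s [:: unit_count j] - fine (\esum_(i in [set: nat]) (zp i.+1 j)%:E).
have z0 i j : 0 <= z i j.
  by case: i => [|i]//=; rewrite subr_ge0 -lee_fin -col_fin.
have z_col j : \esum_(i in [set: nat]) (z i j)%:E = (s [:: unit_count j])%:E.
  rewrite esum_nat_recl; last by move=> i; rewrite lee_fin.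
  by rewrite /z col_fin -EFinD subrK.
have zS : in_simplex z.
  split=> //; under eq_esum do rewrite -sumEFin.
  rewrite (@esum_sum _ _ _ _ _ xpredT (fun i j => (z i j)%:E)); last by move=> *; rewrite lee_fin.
  rewrite (eq_bigr (fun j => (s [:: unit_count j])%:E)) ?sumEFin//; congr (_%:E).
  apply: (ultra_unique U_ultra (u := fun n => \sum_j power_sum (y' n) (unit_count j))).
    by apply: cvg_bigsum => j _; apply: lim_p; exact: nonempty_unit.
  by under eq_fun do rewrite sum_power_sum_unit//; exact: cvg_cst.
have z_p b : nonempty_block b -> power_sum z b = s [:: b].
  move=> b0; have [/existsP[j /eqP ->]|bu] := boolP (is_unit b).
    by apply: EFin_inj; rewrite power_sum_unit// z_col.
  have hz I : head_sum z b I = head_sum zp b I by [].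
  apply/eqP; rewrite eq_le; apply/andP; split.
    rewrite -lee_fin (power_sum_tail zS b0 bu 0) /head_sum big_ord0 add0e.
    rewrite -nneseries_esumT; last by move=> i; rewrite lee_fin monomial_ge0.
    apply: lime_le; first by apply: is_cvg_nneseries => i _ _; rewrite lee_fin monomial_ge0.
    apply: nearW => I; rewrite big_mkord sumEFin lee_fin.
    apply: (ler_cvg_to (lim_head b I) (lim_p _ b0)).
    by apply: (@filterS _ U) filterT => n _; exact: head_sum_le.
  apply/ler_addgt0Pr => e e0.
  pose I := Num.truncn e^-1.
  apply: (@le_trans _ _ (head_sum zp b I + I.+1%:R^-1)).
    apply: (ler_cvg_to (lim_p _ b0) (cvgD (lim_head b I) (cvg_cst _))).
    apply: (@filterS _ U) filterT => n _; have [_ sy _] := y'P n.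
    exact: tail_bound.
  rewrite -hz lerD ?head_sum_le//.
  by rewrite invf_ple ?posrE ?ltr0n// ltW// truncnS_gt.
have [x [xS xsort xp]] := shortlex_sort zS.
have lim_s l : all nonempty_block l -> sampling (y n) l @[n --> U] --> s l.
  by move=> l0; apply: cvg_trans (y_s l0); exact: cvg_app Uoo.
exists x; split => //; apply: sampling_unique => // [|b l b0 l0].
  apply: (ultra_unique U_ultra (lim_s [::] isT)).
  rewrite (_ : (fun n => _) = fun=> 1); first exact: cvg_cst.
  by apply/funext => n; rewrite sampling_nil.
rewrite xp// z_p//.
apply: (ultra_unique U_ultra (cvgM (lim_s [:: b] _) (lim_s l l0))); first by rewrite /= b0.
rewrite (_ : (fun n => _) = fun n => sampling (y n) (b :: l) +
    \sum_(l' <- alterations (fun a => cadd a b) l) sampling (y n) l'); last first.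
  by apply/funext => n /=; rewrite -sampling_rec// sampling1.
apply: cvgD; first by apply: lim_s; rewrite /= b0.
rewrite !big_seq; under eq_fun do rewrite big_seq.
by apply: cvg_bigsum => l' l'l; apply: lim_s; exact: alterations_nonempty l0 l'l.
Qed.

End Closedness.

(** * Classes of functions closed under bounded limits *)

Section Thresholds.
Variable R : realType.
Implicit Types (a t : R).

Lemma bernoulli_ge a n : 0 <= a <= 1 -> 1 - n%:R * a <= (1 - a) ^+ n.
Proof.
move=> /andP[a0 a1]; elim: n => [|n ih]; first by rewrite mul0r subr0 expr0.
rewrite exprSr; apply: le_trans (ler_wpM2r _ ih); last by rewrite subr_ge0.
have : 0 <= n%:R * (a * a) by rewrite !mulr_ge0.
rewrite -natr1; set N := n%:R; lra.
Qed.

Lemma bernoulli_le a n : 0 <= a <= 1 -> (1 - a) ^+ n <= (1 + n%:R * a)^-1.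
Proof.
move=> /andP[a0 a1]; rewrite -[leRHS]mul1r ler_pdivlMr; last first.
  by rewrite ltr_pwDl// mulr_ge0.
elim: n => [|n ih]; first by rewrite mul0r addr0 expr0 mulr1.
apply: le_trans ih; rewrite exprSr -mulrA; apply: ler_wpM2l.
  by rewrite exprn_ge0// subr_ge0.
have : 0 <= n%:R * (a * a) by rewrite !mulr_ge0.
have : 0 <= a * a by rewrite mulr_ge0.
rewrite -natr1; set N := n%:R; lra.
Qed.

Lemma bernoulli_grow a n : 0 <= a -> 1 + n%:R * a <= (1 + a) ^+ n.
Proof.
move=> a0; elim: n => [|n ih]; first by rewrite mul0r addr0 expr0.
rewrite exprSr; apply: le_trans (ler_wpM2r _ ih); last by rewrite addr_ge0.
have : 0 <= n%:R * (a * a) by rewrite !mulr_ge0.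
rewrite -natr1; set N := n%:R; lra.
Qed.

Lemma cvg_nat_expr a : 0 <= a < 1 -> n%:R * a ^+ n @[n --> \oo] --> (0 : R).
Proof.
move=> /andP[]; rewrite le_eqVlt => /predU1P[<-|a0] a1.
  apply: cvg_near_cst; exists 1%N => // -[|n]//= _.
  by rewrite expr0n/= mulr0.
pose s := Num.sqrt a; have s0 : 0 < s by rewrite sqrtr_gt0.
have s1 : s < 1 by rewrite -[ltRHS]sqrtr1 ltr_sqrt.
have aE : a = s ^+ 2 by rewrite sqr_sqrtr// ltW.
have h0 : 0 < s^-1 - 1 by rewrite subr_gt0 invf_gt1.
apply: (@squeeze_cvgr _ _ _ _ (fun=> 0) (fun n => (s^-1 - 1)^-1 * s ^+ n)).
- near=> n; rewrite mulr_ge0//=; last by rewrite exprn_ge0// ltW.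
  rewrite aE -exprM mulnC exprM expr2 mulrA ler_wpM2r ?exprn_ge0 ?(ltW s0)//.
  rewrite -[leRHS]mul1r ler_pdivlMr// mulrAC.
  rewrite -ler_pdivlMr ?exprn_gt0// mul1r -exprVn.
  have : 1 + n%:R * (s^-1 - 1) <= s^-1 ^+ n.
    by have := bernoulli_grow n (ltW h0); rewrite [X in _ <= X ^+ _]addrC subrK.
  by apply: le_trans; rewrite lerDr.
- exact: cvg_cst.
- rewrite -[X in _ --> X](mulr0 (s^-1 - 1)^-1); apply: cvgMr; apply: cvg_expr.
  by rewrite ger0_norm// ltW.
Unshelve. all: by end_near. Qed.

(** A polynomial in [a] that approximates the indicator of [a < t]: with about [n t^-n]
factors, the product of this number and [a ^+ n] tends to [0] if [a < t], and is at least
about [n] otherwise. *)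
Definition soft_threshold t n a := (1 - a ^+ n) ^+ Num.truncn (n.+1%:R * t ^- n).

Lemma soft_threshold_itv t n a : 0 <= a <= 1 -> 0 <= soft_threshold t n a <= 1.
Proof.
move=> /andP[a0 a1]; have h : 0 <= 1 - a ^+ n by rewrite subr_ge0 exprn_ile1.
by rewrite exprn_ge0//= exprn_ile1// gerBl exprn_ge0.
Qed.

Lemma cvg_soft_threshold t a : 0 < t -> 0 <= a <= 1 ->
  soft_threshold t n a @[n --> \oo] --> ((a < t)%R%:R : R).
Proof.
move=> t0 a01; have /andP[a0 a1] := a01.
pose m n := Num.truncn (n.+1%:R * t ^- n).
have an n : 0 <= a ^+ n <= 1 by rewrite exprn_ge0//= exprn_ile1.
have nt n : 0 <= n.+1%:R * t ^- n by rewrite mulr_ge0// invr_ge0 exprn_ge0// ltW.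
have [at_|ta] := ltP a t.
  have r01 : 0 <= a / t < 1 by rewrite (divr_ge0 a0 (ltW t0))/= ltr_pdivrMr// mul1r.
  apply: (@squeeze_cvgr _ _ _ _ (fun n => 1 - (n%:R * (a / t) ^+ n + (a / t) ^+ n)) (fun=> 1)).
  - near=> n; have [_ ->] := andP (soft_threshold_itv t n a01); rewrite andbT.
    apply: le_trans (bernoulli_ge (m n) (an n)); rewrite lerD2l lerN2.
    rewrite -[X in _ + X]mul1r -mulrDl natr1 exprMn exprVn mulrCA mulrC.
    by rewrite ler_wpM2l ?exprn_ge0// truncn_le.
  - rewrite -[X in _ --> X](_ : 1 - (0 + 0) = 1); last by rewrite addr0 subr0.
    apply: cvgB; first exact: cvg_cst.
    apply: cvgD; first exact: cvg_nat_expr.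
    by apply: cvg_expr; have [? ?] := andP r01; rewrite ger0_norm.
  - exact: cvg_cst.
apply: (@squeeze_cvgr _ _ _ _ (fun=> 0) (fun n => n.+1%:R^-1)).
- near=> n; have [-> _] := andP (soft_threshold_itv t n a01) => /=.
  apply: le_trans (bernoulli_le (m n) (an n)) _.
  rewrite lef_pV2 ?posrE ?ltr0n//; last first.
    by have [? _] := andP (an n); rewrite ltr_pwDl// mulr_ge0.
  have [an0 an1] := andP (an n).
  apply: (@le_trans _ _ (1 + (n.+1%:R * t ^- n - 1) * a ^+ n)); last first.
    by rewrite lerD2l ler_wpM2r// lerBlDr natr1 ltW// truncnS_gt.
  rewrite mulrBl mul1r addrCA -[leLHS]addr0 lerD// ?subr_ge0//.
  rewrite -mulrA ler_peMr// mulrC ler_pdivlMr ?exprn_gt0// mul1r.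
  by rewrite lerXn2r// nnegrE ltW.
- exact: cvg_cst.
- exact: cvg_harmonic.
Unshelve. all: by end_near. Qed.

End Thresholds.

Section BoundedFunctions.
Variables (R : realType) (T : Type).
Implicit Types (g h : T -> R).

Definition bounded_function g : Prop := exists C, forall x, `|g x| <= C.

Lemma bounded_function_lin c g h : bounded_function g -> bounded_function h ->
  bounded_function (fun x => c * g x + h x).
Proof.
move=> [C gC] [D hD]; exists (`|c| * C + D) => x; apply: le_trans (ler_normD _ _) _.
by rewrite normrM lerD// ler_wpM2l.
Qed.

Lemma bounded_function_lim (g : nat -> T -> R) h C : (forall n x, `|g n x| <= C) ->
  (forall x, g n x @[n --> \oo] --> h x) -> bounded_function h.
Proof.
move=> gC gh; exists C => x; apply: (cvgr_to_le (cvg_norm (gh x))).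
by apply: nearW => n.
Qed.

End BoundedFunctions.

(** A linear class of functions that contains the monomials in the functions [f k] and is closed
under bounded pointwise limits contains the indicators of the boxes defined by them. This
serves twice: for integrals against two measures, and for sums over the atoms. *)
Section ThresholdClass.
Variables (R : realType) (T K : Type) (f : K -> T -> R) (V : (T -> R) -> Prop).
Hypothesis f01 : forall k x, 0 <= f k x <= 1.
Hypothesis V_lin : forall c g h, V g -> V h -> V (fun x => c * g x + h x).
Hypothesis V_lim : forall (g : nat -> T -> R) h C, (forall n, V (g n)) ->
  (forall n x, `|g n x| <= C) -> (forall x, g n x @[n --> \oo] --> h x) -> V h.
Hypothesis V_prod : forall s : seq K, V (fun x => \prod_(k <- s) f k x).

(** The functions by which every monomial may be multiplied within the class; unlike the
class itself, they are evidently stable under multiplication by [f k]. *)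
Let stable (g : T -> R) := bounded_function g /\
  forall s : seq K, V (fun x => \prod_(k <- s) f k x * g x).

Let prod_f01 (s : seq K) x : 0 <= \prod_(k <- s) f k x <= 1.
Proof.
elim: s => [|k s /andP[ih0 ih1]]; first by rewrite big_nil ler01 lexx.
rewrite big_cons; have /andP[a b] := f01 k x.
by rewrite mulr_ge0//= mulr_ile1.
Qed.

Let stable_lin c g h : stable g -> stable h -> stable (fun x => c * g x + h x).
Proof.
move=> [gC gV] [hD hV]; split; first exact: bounded_function_lin.
move=> s; have := V_lin c (gV s) (hV s).
by congr V; apply/funext => x; rewrite mulrDr mulrCA.
Qed.

Let stable_mul k g : stable g -> stable (fun x => f k x * g x).
Proof.
move=> [[C gC] gV]; split.
  exists C => x; have /andP[f0 f1] := f01 k x; rewrite normrM ger0_norm//.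
  by apply: le_trans (gC x); rewrite ler_piMl.
move=> s; have := gV (k :: s).
by congr V; apply/funext => x; rewrite big_cons mulrA [f k x * _]mulrC.
Qed.

Let stable_pow k n g : stable g -> stable (fun x => f k x ^+ n * g x).
Proof.
elim: n => [|n ih] gS; first by under eq_fun do rewrite expr0 mul1r.
have := stable_mul k (ih gS).
by congr stable; apply/funext => x; rewrite exprS mulrA.
Qed.

Let stable_comp k n m g : stable g -> stable (fun x => (1 - f k x ^+ n) ^+ m * g x).
Proof.
elim: m => [|m ih] gS; first by under eq_fun do rewrite expr0 mul1r.
have := stable_lin (-1) (stable_pow k n (ih gS)) (ih gS).
by congr stable; apply/funext => x; rewrite exprS; ring.
Qed.

Let stable_threshold k t g : stable g -> stable (fun x => (t <= f k x)%R%:R * g x).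
Proof.
move=> gS; have [t0|t0] := leP t 0.
  rewrite (_ : (fun _ => _) = g)//; apply/funext => x.
  by have /andP[f0 _] := f01 k x; rewrite (le_trans t0 f0) mul1r.
suff hS : stable (fun x => (f k x < t)%R%:R * g x).
  have := stable_lin (-1) hS gS; congr stable; apply/funext => x.
  by rewrite leNgt; case: ltP => _ /=; ring.
have [[C gC] gV] := gS; split.
  exists C => x; rewrite normrM ger0_norm//; apply: le_trans (gC x).
  by rewrite ler_piMl//; case: ltP.
move=> s; pose gn n x := \prod_(k <- s) f k x * (soft_threshold t n (f k x) * g x).
apply: (V_lim (g := gn) (C := C)).
- move=> n; have [_ h] := stable_comp k n (Num.truncn (n.+1%:R * t ^- n)) gS.
  exact: h.
- move=> n x; have /andP[p0 p1] := prod_f01 s x.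
  have /andP[q0 q1] := soft_threshold_itv t n (f01 k x).
  rewrite !normrM (ger0_norm p0) (ger0_norm q0) mulrA.
  apply: le_trans (gC x); rewrite ler_piMl// mulr_ile1//.
- move=> x; apply: cvgMr; apply: cvgMl; exact: cvg_soft_threshold.
Qed.

Lemma threshold_class (s : seq (K * R)) :
  V (fun x => \prod_(c <- s) (c.2 <= f c.1 x)%R%:R).
Proof.
suff [_ /(_ [::])] : stable (fun x => \prod_(c <- s) (c.2 <= f c.1 x)%R%:R).
  by congr V; apply/funext => x; rewrite big_nil mul1r.
elim: s => [|c s ih].
  split=> [|s]; first by exists 1 => x; rewrite big_nil normr1.
  have := V_prod s; congr V; apply/funext => x; by rewrite big_nil mulr1.
have := stable_threshold c.1 c.2 ih.
by congr stable; apply/funext => x; rewrite big_cons.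
Qed.

End ThresholdClass.

(** * The Borel sets of the Kingman simplex *)

Section CountableUnions.
Context d (T : measurableType d) (I : countType).
Implicit Types (D : set I) (F : I -> set T).

Lemma countable_bigcup_measurable D F : (forall i, D i -> measurable (F i)) ->
  measurable (\bigcup_(i in D) F i).
Proof.
move=> mF; rewrite (_ : \bigcup_(i in D) F i =
    \bigcup_(n in [set: nat]) (if choice.pickle_inv n is Some i then
      if i \in D then F i else set0 else set0)).
  apply: bigcup_measurable => n _; case: choice.pickle_inv => // i.
  by case: ifPn => // /set_mem; exact: mF.
apply/seteqP; split => [x [i Di Fx]|x [n _]].
  by exists (choice.pickle i) => //; rewrite choice.pickleK_inv mem_set.
case: choice.pickle_inv => // i; case: ifPn => // /set_mem Di Fx.
by exists i.
Qed.

Lemma measurable_bool_set (b : T -> bool) :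
  measurable_fun setT b -> measurable [set x | b x].
Proof. by move=> mb; rewrite -preimage_true -[X in measurable X]setTI; exact: mb. Qed.

End CountableUnions.

Section PointwiseTopology.

Lemma cvg_ptws (I : choiceType) (Y : topologicalType) (T : Type) (F : set_system T)
    (f : T -> {ptws I -> Y}) (x : {ptws I -> Y}) : Filter F ->
  (forall i, f t i @[t --> F] --> x i) -> f t @[t --> F] --> x.
Proof.
move=> FF fx; apply/cvg_sup => i A /=.
rewrite (@nbhsE (initial_topology _)) => -[B [[C Cop <-] Bx] BA].
apply: filterS BA _; apply: (fx i); exact: open_nbhs_nbhs.
Qed.

Variables (R : realType) (q : nat).

Lemma eval_continuous i j : continuous (fun x : {ptws nat -> {ptws 'I_q -> R}} => x i j).
Proof.
move=> x; apply: (@continuous_comp _ _ _ (fun x : {ptws nat -> {ptws 'I_q -> R}} => x i)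
  (fun u : {ptws 'I_q -> R} => u j)).
  exact: (proj_continuous (K := fun=> {ptws 'I_q -> R})).
exact: (proj_continuous (K := fun=> R)).
Qed.

Lemma coords_continuous i j : continuous (fun x : kingman_simplex R q => coords x i j).
Proof.
move=> x; apply: (@continuous_comp _ _ _ (set_val : kingman_simplex R q -> _)
  (fun x : {ptws nat -> {ptws 'I_q -> R}} => x i j)).
  exact: initial_continuous.
exact: eval_continuous.
Qed.

(** The length of the list [c] of rational centres bounds the indices of the constrained
coordinates. *)
Definition rational_box (c : seq (seq rat)) (m : nat) : set {ptws nat -> {ptws 'I_q -> R}} :=
  [set y | forall i j, (i < size c)%N ->
     `|y i j - ratr (nth 0 (nth [::] c i) (val j))| < m.+1%:R^-1].

(** Otherwise points outside the open set would converge to [x] coordinatewise. *)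
Lemma open_small_box (O : set {ptws nat -> {ptws 'I_q -> R}}) x : open O -> O x ->
  exists m, forall y : {ptws nat -> {ptws 'I_q -> R}},
    (forall i j, (i < m)%N -> `|y i j - x i j| < m.+1%:R^-1) -> O y.
Proof.
move=> Oop Ox; apply: contrapT => H.
have Hn n : exists y, (forall i j, (i < n)%N -> `|y i j - x i j| < n.+1%:R^-1) /\ ~ O y.
  apply: contrapT => none; apply: H; exists n => y yx.
  by apply: contrapT => Oy; apply: none; exists y.
have [y yP] := choice Hn.
have : (y n : {ptws nat -> {ptws 'I_q -> R}}) @[n --> \oo] --> x.
  apply: cvg_ptws => i; apply: cvg_ptws => j.
  apply/cvgrPdist_lt => e e0; near=> n.
  rewrite distrC; apply: (@lt_trans _ _ n.+1%:R^-1).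
    by have [+ _] := yP n; apply; near: n; exact: nbhs_infty_gt.
  by near: n; exact: near_infty_natSinv_lt (PosNum e0).
move=> /(_ O); case; first exact: open_nbhs_nbhs.
move=> N _ /(_ N (leqnn N)) /= OyN.
by have [_] := yP N; apply.
Unshelve. all: by end_near. Qed.

Lemma open_bigcup_box (O : set {ptws nat -> {ptws 'I_q -> R}}) : open O ->
  O = \bigcup_(p in [set p : seq (seq rat) * nat | rational_box p.1 p.2 `<=` O])
    rational_box p.1 p.2.
Proof.
move=> Oop; apply/seteqP; split=> [x Ox|x [p /= pO px]]; last exact: pO.
have [m mO] := open_small_box Oop Ox.
have M0 : 0 < (2 * m.+1)%:R^-1 :> R by rewrite invr_gt0 ltr0n.
have Hr (ij : nat * 'I_q) : exists r : rat, `|x ij.1 ij.2 - ratr r| < (2 * m.+1)%:R^-1.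
  have [r] := @rat_in_itvoo R (x ij.1 ij.2) (x ij.1 ij.2 + (2 * m.+1)%:R^-1)
    ltac:(by rewrite ltrDl).
  rewrite in_itv/= => /andP[r1 r2]; exists r.
  by rewrite ltr_distlC; rewrite r2 andbT (lt_trans _ r1)// gtrDl oppr_lt0.
have [r rP] := choice Hr.
pose c := mkseq (fun i => [seq r (i, j) | j <- enum 'I_q]) m.
have cE i (j : 'I_q) : (i < m)%N -> nth 0 (nth [::] c i) (val j) = r (i, j).
  move=> im; rewrite nth_mkseq// (nth_map j) ?size_enum_ord//=.
  by congr (r (i, _)); exact: nth_ord_enum.
have half : m.+1%:R^-1 = (2 * m.+1)%:R^-1 + (2 * m.+1)%:R^-1 :> R.
  rewrite -mulr2n -[RHS]mulr_natl natrM invfM mulrA mulfV ?mul1r// pnatr_eq0.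
exists (c, (2 * m.+1).-1); rewrite /rational_box /= size_mkseq.
  move=> y /= yc; apply: mO => i j im.
  have := yc i j im; rewrite cE// => yr.
  rewrite half -[_ - _](subrKA (ratr (r (i, j)))) (le_lt_trans (ler_normD _ _))//.
  by rewrite ltrD// distrC; exact: (rP (i, j)).
by move=> i j im; rewrite cE//; exact: (rP (i, j)).
Qed.

End PointwiseTopology.

Section BorelKingman.
Variables (R : realType) (q : nat).

Lemma measurable_coords i j :
  measurable_fun [set: borel_kingman_simplex R q] (fun x => coords x i j).
Proof.
apply: (measurability _ (RGenOInfty.measurableE R)) => _ [_ [a ->] <-].
rewrite setTI; apply: sub_sigma_algebra.
apply: (@open_comp _ _ (fun x : kingman_simplex R q.+1 => coords x i j)) => //.
  by move=> x _; exact: coords_continuous.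
Qed.

(** The Borel sets are generated by the coordinates because every open set is a countable
union of rational boxes. *)
Lemma measurable_to_kingman d (T : measurableType d) (X : T -> borel_kingman_simplex R q) :
  (forall i j, measurable_fun setT (fun t => coords (X t) i j)) ->
  measurable_fun setT X.
Proof.
move=> mX; apply: (@measurability _ _ T (borel_kingman_simplex R q) setT X
  (@open (kingman_simplex R q.+1))) => //.
move=> _ [_ [G Gop <-] <-]; rewrite setTI (open_bigcup_box Gop) !preimage_bigcup.
apply: countable_bigcup_measurable => -[c m] _ /=.
rewrite (_ : _ @^-1` _ = \bigcap_(i in [set k | (k < size c)%N]) \bigcap_(j in [set: 'I_q.+1])
    [set t | `|coords (X t) i j - ratr (nth 0 (nth [::] c i) (val j))| < m.+1%:R^-1]);
  last first.
  by apply/seteqP; split=> [t tb i im j _|t tb i j im]; [exact: tb|exact: tb].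
apply: fin_bigcap_measurable; first exact: finite_II.
move=> i _; apply: fin_bigcap_measurable => // j _.
apply: measurable_bool_set; apply: measurable_fun_ltr => //.
apply: measurableT_comp => //; exact: measurable_funB.
Qed.

End BorelKingman.

(** * Measurability of the atoms *)

Section ShortlexKeys.
Variables (R : realType) (q : nat).
Implicit Types (u v : 'I_q -> R) (x : nat -> 'I_q -> R).

(** The entries that the shortlex order compares: the norm, then the coordinates. *)
Definition key v c : R := nth 0 (vnorm v :: codom v) c.

Lemma key_coord v (j : 'I_q) : key v j.+1 = v j.
Proof.
rewrite /key /= codomE (nth_map j) ?size_enum_ord//; congr v.
exact: nth_ord_enum.
Qed.

Lemma key_ge0 v c : (forall j, 0 <= v j) -> 0 <= key v c.
Proof.
move=> v0; have [jq|qj] := ltnP c q.+1; last first.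
  by rewrite /key nth_default//= size_codom card_ord.
case: c jq => [|c] cq; first by rewrite /key/= sumr_ge0.
by rewrite (key_coord v (Ordinal (cq : (c < q)%N))).
Qed.

Lemma key_le1 v c : (forall j, 0 <= v j) -> \sum_j v j <= 1 -> key v c <= 1.
Proof.
move=> v0 v1; have [jq|qj] := ltnP c q.+1; last first.
  by rewrite /key nth_default//= size_codom card_ord.
case: c jq => [|c] cq; first by rewrite /key/= vnorm_sum.
rewrite (key_coord v (Ordinal (cq : (c < q)%N))); apply: le_trans v1.
by rewrite (bigD1 (Ordinal (cq : (c < q)%N)))//= lerDl sumr_ge0.
Qed.

Lemma lexi_nth_le (s t : seqlexi R) c : size s = size t -> (s <= t)%O ->
  (forall c', (c' < c)%N -> nth 0 t c' <= nth 0 s c') -> nth 0 s c <= nth 0 t c.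
Proof.
elim: s t c => [|a s ih] [|b t] c //= [] sz; rewrite lexi_cons => /andP[ab /implyP st] ts.
case: c ts => [//|c] ts /=; apply: ih => //; first by apply: st; exact: (ts 0%N).
by move=> c' cc'; exact: (ts c'.+1).
Qed.

Lemma shortlex_key_le u v c : shortlex_le u v ->
  (forall c', (c' < c)%N -> key v c' <= key u c') -> key u c <= key v c.
Proof. by move=> uv; apply: lexi_nth_le => //=; rewrite !size_codom. Qed.

Definition boxed (u : seq rat) c (r : R) v : bool :=
  all (fun c' => ratr (nth 0 u c') <= key v c') (iota 0 c) && (r <= key v c).

Lemma rational_between (s : seq R) (b : R) :
  exists r : rat, ratr r < b /\ forall a, a \in s -> a < b -> a < ratr r.
Proof.
have [m [mb ms]] : exists m, m < b /\ forall a, a \in s -> a < b -> a <= m.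
  elim: s => [|a s [m [mb ms]]]; first by exists (b - 1); split => //; rewrite gtrBl.
  have [ab|ba] := ltP a b.
    exists (Num.max a m); split; first by rewrite gt_max ab.
    move=> a'; rewrite in_cons le_max => /predU1P[->|a's a'b]; first by rewrite lexx.
    by rewrite ms// orbT.
  exists m; split => // a'; rewrite in_cons => /predU1P[->|/ms//]; by rewrite ltNge ba.
have [r] := rat_in_itvoo mb; rewrite in_itv/= => /andP[mr rb].
by exists r; split => // a /ms h /h am; exact: le_lt_trans mr.
Qed.

(** Quadratic, so that the weighted sums over the atoms are power sums free of dust. *)
Definition atom_weight v : R := \sum_j v j ^+ 2.

Lemma atom_weight_ge0 v : 0 <= atom_weight v.
Proof. by rewrite sumr_ge0// => j _; exact: sqr_ge0. Qed.

Lemma atom_weight_eq0 v : atom_weight v = 0 -> v = fun=> 0.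
Proof.
move=> /eqP; rewrite psumr_eq0 => [/allP v0|j _]; last exact: sqr_ge0.
apply/funext => j; apply/eqP; rewrite -sqrf_eq0; apply: v0; exact: mem_index_enum.
Qed.

Lemma key0 c : key (fun=> 0) c = 0.
Proof.
case: c => [|c]; first by rewrite /key /vnorm /= big1// => j _; rewrite normr0.
rewrite /key /= codomE; by elim: (enum _) c => [|j s ih] [|c] //=.
Qed.

(** The key number [c] of the largest remaining atom is the largest key number [c] among
the remaining atoms whose previous keys are close enough to its own: above any positive
size there are finitely many atoms, so close enough can be tested with rationals. *)
Lemma key_ltP x k c r : in_simplex x ->
  (forall i, (1 <= i)%N -> shortlex_le (x i.+1) (x i)) -> 0 < r ->
  key (x k.+1) c < r <->
  exists2 u : seq rat, (forall c', (c' < c)%N -> ratr (nth 0 u c') < key (x k.+1) c') &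
    forall i, (k <= i)%N -> boxed u c r (x i.+1) -> atom_weight (x i.+1) = 0.
Proof.
move=> xS xsort r0; have [x0 _] := xS; split; last first.
  move=> [u uY Hu]; rewrite ltNge; apply/negP => rY.
  have bY : boxed u c r (x k.+1).
    rewrite /boxed rY andbT; apply/allP => c'; rewrite mem_iota => /= cc'.
    exact/ltW/uY.
  by move: rY; rewrite (atom_weight_eq0 (Hu k (leqnn k) bY)) key0 leNgt r0.
have le_key i : (k <= i)%N -> shortlex_le (x i.+1) (x k.+1).
  elim: i => [|i ih]; first by rewrite leqn0 => /eqP ->; exact: shortlex_refl.
  rewrite leq_eqVlt => /predU1P[->|]; first exact: shortlex_refl.
  by rewrite ltnS => /ih; apply: shortlex_trans; exact: xsort.
move=> Yr; have [Y0|Yn0] := eqVneq (vnorm (x k.+1)) 0.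
  exists (nseq c (-1)) => [c' cc'|i ki _].
    rewrite nth_nseq cc'; apply: lt_le_trans (key_ge0 _ _) => //.
    by rewrite raddfN/= rmorph1 oppr_lt0.
  have xi0 : vnorm (x i.+1) = 0.
    by apply/eqP; rewrite eq_le sumr_ge0// -Y0 (shortlex_norm (le_key i ki)).
  by rewrite /atom_weight (vnorm_eq0 xi0) big1// => j _; rewrite expr0n.
have Y0 : 0 < vnorm (x k.+1) by rewrite lt_neqAle eq_sym Yn0 sumr_ge0.
(* The atoms of index larger than [M] are smaller than the next one. *)
have [M MY] : exists M, M.+1%:R^-1 < vnorm (x k.+1).
  exists (Num.truncn (vnorm (x k.+1))^-1).
  by rewrite invf_plt ?posrE// truncnS_gt.
have [f fP] := choice (fun c' => rational_between
  (M.+1%:R^-1 :: [seq key (x i.+1) c' | i <- iota 0 M]) (key (x k.+1) c')).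
exists (mkseq f c) => [c' cc'|i ki /andP[/allP bi ri]].
  by rewrite nth_mkseq//; have [] := fP c'.
exfalso; move: Yr; rewrite ltNge => /negP; apply; apply: le_trans ri _.
apply: shortlex_key_le (le_key i ki) _ => c' cc'.
have [iM|Mi] := ltnP i M.
  rewrite leNgt; apply/negP => lt; have [_ /(_ (key (x i.+1) c'))] := fP c'.
  rewrite in_cons (map_f (fun i => key (x i.+1) c')) ?mem_iota// orbT => /(_ isT lt).
  have := bi c'; rewrite mem_iota cc' nth_mkseq// => /(_ isT) h.
  by rewrite ltNge h.
have c0 : (0 < c)%N by apply: leq_ltn_trans cc'.
have [_ /(_ M.+1%:R^-1)] := fP 0%N; rewrite mem_head => /(_ isT MY).
have := bi 0%N; rewrite mem_iota c0 nth_mkseq// => /(_ isT) /le_trans h1.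
move=> h2; have := lt_le_trans h2 (h1 _ (lexx _)).
rewrite /key/= ltNge; case/negP; rewrite vnorm_sum//.
apply: le_trans (sorted_norm_small xS xsort i) _.
by rewrite lef_pV2 ?posrE ?ltr0n// ler_nat.
Qed.

End ShortlexKeys.

Lemma prod_indicator (R : realType) (I : Type) (s : seq I) (b : I -> bool) :
  \prod_(i <- s) (b i)%:R = (all b s)%:R :> R.
Proof.
by elim: s => [|i s ih]; rewrite ?big_nil// big_cons ih -natrM mulnb.
Qed.

Section RandomPoint.
Context d (T : measurableType d) (R : realType) (q : nat).
Variable X : T -> nat -> 'I_q -> R.
Hypothesis XS : forall t, in_simplex (X t).
Hypothesis X_sorted : forall t i, (1 <= i)%N -> shortlex_le (X t i.+1) (X t i).
Hypothesis mX : forall b, nonempty_block b -> measurable_fun setT (fun t => power_sum (X t) b).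

Let X0 t i j : 0 <= X t i j. Proof. by have [+ _] := XS t. Qed.

Let w t i := atom_weight (X t i.+1).

Let w0 t i : 0 <= w t i. Proof. exact: atom_weight_ge0. Qed.

Let unit2 j : color_count q := cadd (unit_count j) (unit_count j).

Let w_monomial t i b : w t i * monomial (X t i.+1) b =
  \sum_j monomial (X t i.+1) (cadd (unit2 j) b).
Proof.
rewrite /w /atom_weight mulr_suml; apply: eq_bigr => j _.
by rewrite monomialD /unit2 monomialD !monomial_unit expr2.
Qed.

Let unit2_nonempty j b : nonempty_block (cadd (unit2 j) b).
Proof. by do 2! apply: nonempty_cadd; exact: nonempty_unit. Qed.

Let unit2_not_unit j b : ~~ is_unit (cadd (unit2 j) b).
Proof.
apply/existsP => -[k /eqP/(congr1 (@color_size q))].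
by rewrite !color_sizeD !color_size_unit; lia.
Qed.

(** Integrals against the counting measure, to which dominated convergence applies. *)
Let weighted_count (g : T * nat -> R) t :=
  (\int[counting]_i (w t i * g (t, i))%:E)%E.

Let weighted_monomial b t : weighted_count (fun p => monomial (X p.1 p.2.+1) b) t =
  (\sum_j power_sum (X t) (cadd (unit2 j) b))%:E.
Proof.
rewrite /weighted_count ge0_integral_count; last first.
  by move=> i; rewrite lee_fin mulr_ge0// monomial_ge0.
rewrite nneseries_esumT; last by move=> i; rewrite lee_fin mulr_ge0// monomial_ge0.
under eq_esum do rewrite w_monomial -sumEFin.
rewrite (@esum_sum _ _ _ _ _ xpredT (fun i j => (monomial (X t i.+1) (cadd (unit2 j) b))%:E));
  last by move=> *; rewrite lee_fin monomial_ge0.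
rewrite -sumEFin; apply: eq_bigr => j _.
rewrite (power_sum_tail (XS t) (unit2_nonempty j b) (unit2_not_unit j b) 0).
by rewrite /head_sum big_ord0 add0e.
Qed.

Let w_integrable t :
  (counting : {measure set nat -> \bar R}).-integrable setT (fun i => (w t i)%:E).
Proof.
apply/integrableP; split; first by [].
under eq_integral do rewrite gee0_abs ?lee_fin//.
have one v : monomial v [ffun=> 0%N] = 1 :> R.
  by rewrite /monomial big1// => j _; rewrite ffunE.
have := weighted_monomial [ffun=> 0%N] t; rewrite /weighted_count /=.
rewrite (eq_integral (fun i => (w t i)%:E)) => [-> |i _]; first by rewrite ltry.
by rewrite one mulr1.
Qed.

Let good (g : T * nat -> R) := bounded_function g /\ measurable_fun setT (weighted_count g).

Let weighted_integrable g t : bounded_function g ->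
  (counting : {measure set nat -> \bar R}).-integrable setT (fun i => (w t i * g (t, i))%:E).
Proof.
move=> [C gC]; have C0 : 0 <= C by apply: le_trans (gC (t, 0%N)).
apply: (@le_integrable _ _ _ _ _ _ _ (fun i => C%:E * (w t i)%:E)%E) => //.
  move=> i _; rewrite lee_fin normrM (ger0_norm (w0 t i)) mulrC.
  by rewrite normrM (ger0_norm C0) (ger0_norm (w0 t i)) ler_wpM2r.
exact: integrableZl.
Qed.

Let good_lin c g h : good g -> good h -> good (fun p => c * g p + h p).
Proof.
move=> [gC gm] [hD hm]; split; first exact: bounded_function_lin.
rewrite (_ : weighted_count _ = fun t => (c%:E * weighted_count g t + weighted_count h t)%E).
  by apply: emeasurable_funD => //; exact: measurable_funeM.
apply/funext => t; rewrite /weighted_count -integralZl//; last exact: weighted_integrable.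
rewrite -integralD//; last 2 first.
- by apply: integrableZl => //; exact: weighted_integrable.
- exact: weighted_integrable.
by apply: eq_integral => i _; rewrite -EFinM -EFinD; congr (_%:E); ring.
Qed.

Let good0 : good (fun=> 0).
Proof.
split; first by exists 0 => p; rewrite normr0.
rewrite (_ : weighted_count _ = fun=> 0%E)//.
by apply/funext => t; rewrite /weighted_count integral0_eq// => i _; rewrite mulr0.
Qed.

Let good_sum (I : Type) (s : seq I) (g : I -> T * nat -> R) :
  (forall i, good (g i)) -> good (fun p => \sum_(i <- s) g i p).
Proof.
move=> gg; elim: s => [|i s ih]; first by under eq_fun do rewrite big_nil.
have := good_lin 1 (gg i) ih; congr good; apply/funext => p.
by rewrite big_cons mul1r.
Qed.

Let good_lim (g : nat -> T * nat -> R) h C : (forall n, good (g n)) ->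
  (forall n p, `|g n p| <= C) -> (forall p, g n p @[n --> \oo] --> h p) -> good h.
Proof.
move=> gg gC gh; split.
  exact: bounded_function_lim gC gh.
have wg_lim t : (weighted_count (g n) t @[n --> \oo] --> weighted_count h t)%E.
  apply: (@dominated_cvg _ _ _ _ setT measurableT (fun n i => (w t i * g n (t, i))%:E)
    (fun i => (w t i * h (t, i))%:E) (fun i => C%:E * (w t i)%:E)%E) => //.
  - move=> i _; apply: cvg_EFin; first by apply: nearW.
    by apply: cvgMr; exact: gh.
  - exact: integrableZl.
  - move=> n i _; rewrite -EFinM abse_EFin lee_fin normrM (ger0_norm (w0 t i)) mulrC.
    by rewrite ler_wpM2r.
apply: (emeasurable_fun_cvg (fun n => weighted_count (g n))); last by move=> t _; exact: wg_lim.
by move=> n; have [] := gg n.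
Qed.

Let keys (c : nat) (p : T * nat) := key (X p.1 p.2.+1) c.

Let keys01 c p : 0 <= keys c p <= 1.
Proof. by rewrite key_ge0//= key_le1// simplex_sum_le1. Qed.

Let monomial01 p b : `|monomial (X p.1 p.2.+1) b| <= 1.
Proof.
rewrite ger0_norm ?monomial_ge0// /monomial prodr_ile1// => j _.
by rewrite exprn_ge0//= exprn_ile1// simplex_le1.
Qed.

Let good_monomial b : good (fun p => monomial (X p.1 p.2.+1) b).
Proof.
split; first by exists 1 => p; exact: monomial01.
rewrite (_ : weighted_count _ =
    fun t => (\sum_j power_sum (X t) (cadd (unit2 j) b))%:E); last first.
  by apply/funext => t; exact: weighted_monomial.
apply/measurable_EFinP; apply: measurable_sum => j; exact: mX.
Qed.

Let good_keys (s : seq nat) : good (fun p => \prod_(c <- s) keys c p).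
Proof.
suff h b : good (fun p => monomial (X p.1 p.2.+1) b * \prod_(c <- s) keys c p).
  have := h [ffun=> 0%N]; congr good; apply/funext => p.
  by rewrite /monomial big1 ?mul1r// => j _; rewrite ffunE.
elim: s b => [|c s ih] b.
  have := good_monomial b; congr good; apply/funext => p.
  by rewrite big_nil mulr1.
have [jq|qj] := ltnP c q.+1; last first.
  have := good0; congr good; apply/funext => p.
  by rewrite big_cons /keys /key nth_default ?mul0r ?mulr0//= size_codom card_ord.
case: c jq => [|c] cq.
  have := good_sum (index_enum 'I_q) (fun j => ih (cadd b (unit_count j))).
  congr good; apply/funext => p; rewrite big_cons.
  have -> : keys 0 p = \sum_j X p.1 p.2.+1 j by rewrite /keys /key /= vnorm_sum.
  rewrite mulrA mulr_sumr mulr_suml; apply: eq_bigr => j _.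
  by rewrite monomialD monomial_unit.
have := ih (cadd b (unit_count (Ordinal (cq : (c < q)%N)))).
congr good; apply/funext => p; rewrite big_cons mulrA monomialD monomial_unit.
by rewrite /keys -(key_coord _ (Ordinal (cq : (c < q)%N))).
Qed.

Let measurable_box_count (u : seq rat) c r : measurable_fun setT
  (weighted_count (fun p => (boxed u c r (X p.1 p.2.+1))%:R)).
Proof.
pose s := rcons [seq (c', ratr (nth 0 u c')) | c' <- iota 0 c] (c, r).
have [_] := @threshold_class R _ _ keys good keys01 good_lin good_lim good_keys s.
congr (measurable_fun _ (weighted_count _)); apply/funext => p.
rewrite prod_indicator /s all_rcons all_map /boxed andbC.
by congr (nat_of_bool (_ && _))%:R; apply: eq_all.
Qed.

Let boxed_fin u c r t :
  weighted_count (fun p => (boxed u c r (X p.1 p.2.+1))%:R) t \is a fin_num.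
Proof.
apply: integrable_fin_num => //.
apply: (weighted_integrable (g := fun p => (boxed u c r (X p.1 p.2.+1))%:R)).
by exists 1 => p; case: boxed; rewrite ?normr1 ?normr0.
Qed.

(** The weight of a box reveals whether the box contains atoms beyond the first [k]. *)
Let boxed_tail u c r t k :
  (forall i, (k <= i)%N -> boxed u c r (X t i.+1) -> atom_weight (X t i.+1) = 0) <->
  fine (weighted_count (fun p => (boxed u c r (X p.1 p.2.+1))%:R) t) =
  \sum_(i < k) w t i * (boxed u c r (X t i.+1))%:R.
Proof.
have ge0 i : (0 <= (w t i * (boxed u c r (X t i.+1))%:R)%:E)%E.
  by rewrite lee_fin mulr_ge0.
have E : weighted_count (fun p => (boxed u c r (X p.1 p.2.+1))%:R) t =
    ((\sum_(i < k) w t i * (boxed u c r (X t i.+1))%:R)%:E +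
     \esum_(i in [set: nat]) (w t (k + i) * (boxed u c r (X t (k + i).+1))%:R)%:E)%E.
  rewrite /weighted_count ge0_integral_count// nneseries_esumT// (esum_nat_split k)//.
  by rewrite -sumEFin.
split=> [H|H].
  apply: EFin_inj; rewrite fineK// E esum1 ?adde0// => i _.
  case: (boolP (boxed _ _ _ _)) => [bi|_]; last by rewrite mulr0.
  by rewrite /w H ?mul0r// leq_addr.
have tail0 : \esum_(i in [set: nat]) (w t (k + i) * (boxed u c r (X t (k + i).+1))%:R)%:E = 0%E.
  move: E; rewrite -(fineK (boxed_fin u c r t)) H.
  set S := \sum_(i < k) _; set tl := (X in (_ + X)%E) => E; rewrite -/tl.
  case: tl E => [a [] /eqP|//|//]; rewrite -[X in X == _]addr0 => /eqP/addrI <-//.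
move=> i ki bi; apply/eqP; rewrite eq_le atom_weight_ge0 andbT -lee_fin.
rewrite -[leRHS]tail0; have := @sum_le_esum _ _ (fun i =>
  (w t (k + i) * (boxed u c r (X t (k + i).+1))%:R)%:E) [:: (i - k)%N] (fun=> ge0 _) isT.
by rewrite big_seq1 subnKC// bi mulr1.
Qed.

Let measurable_key i c : (forall j, measurable_fun setT (fun t => X t i j)) ->
  measurable_fun setT (fun t => key (X t i) c).
Proof.
move=> mXi; have [jq|qj] := ltnP c q.+1; last first.
  rewrite (_ : (fun t => _) = fun=> 0); first exact: measurable_cst.
  by apply/funext => t; rewrite /key nth_default//= size_codom card_ord.
case: c jq => [|c] cq.
  have := @measurable_sum _ _ _ setT _ (index_enum 'I_q) (fun j t => X t i j) mXi.
  by congr measurable_fun; apply/funext => t; rewrite /key /= vnorm_sum.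
have := mXi (Ordinal (cq : (c < q)%N)).
by congr measurable_fun; apply/funext => t; rewrite -key_coord.
Qed.

Let measurable_boxed u c r i : (forall j, measurable_fun setT (fun t => X t i j)) ->
  measurable_fun setT (fun t => (boxed u c r (X t i))%:R : R).
Proof.
move=> mXi; apply: (measurableT_comp (f := fun b : bool => b%:R : R)) => //.
apply: measurable_and; last first.
  by apply: measurable_fun_ler => //; exact: measurable_key.
elim: (iota 0 c) => [|c' s ih] /=; first exact: measurable_cst.
by apply: measurable_and => //; apply: measurable_fun_ler => //; exact: measurable_key.
Qed.

Let measurable_next_key k c :
  (forall i, (i < k)%N -> forall j, measurable_fun setT (fun t => X t i.+1 j)) ->
  measurable_fun setT (fun t => key (X t k.+1) c).
Proof.
move=> mXk; elim/ltn_ind: c => c ih.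
apply: (measurability _ (RGenInftyO.measurableE R)) => _ [_ [r ->] <-]; rewrite setTI.
have [r0|r0] := leP r 0.
  rewrite (_ : _ @^-1` _ = set0)//; apply/seteqP; split => // t /=.
  by rewrite in_itv/= ltNge (le_trans r0)// key_ge0.
rewrite (_ : _ @^-1` _ = \bigcup_(u in [set: seq rat])
    ([set t | all (fun c' => ratr (nth 0 u c') < key (X t k.+1) c') (iota 0 c)] `&`
     [set t | fine (weighted_count (fun p => (boxed u c r (X p.1 p.2.+1))%:R) t) ==
        \sum_(i < k) w t i * (boxed u c r (X t i.+1))%:R])).
  apply: countable_bigcup_measurable => u _; apply: measurableI; apply: measurable_bool_set.
    have : all (ltn^~ c) (iota 0 c) by apply/allP => c'; rewrite mem_iota.
    elim: (iota 0 c) => [|c' s ihs] /=; first by move=> _; exact: measurable_cst.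
    move=> /andP[c'c /ihs h]; apply: measurable_and => //.
    by apply: measurable_fun_ltr => //; exact: ih.
  apply: measurable_fun_eqr.
    apply: measurableT_comp; [exact: fine_measurable|exact: measurable_box_count].
  apply: (@measurable_sum _ _ _ _ _ _
    (fun (i : 'I_k) t => w t i * (boxed u c r (X t i.+1))%:R)) => i.
  apply: measurable_funM; last by apply: measurable_boxed; exact: mXk.
  apply: measurable_sum => j; apply: measurable_funX; exact: mXk.
apply/seteqP; split=> [t|t [u _ [/allP uY /eqP /boxed_tail H]]] /=; rewrite in_itv/=.
  move=> /(key_ltP _ _ (XS t) (X_sorted t) r0)[u uY /boxed_tail H]; exists u => //; split.
    by apply/allP => c'; rewrite mem_iota => /= c'c; exact: uY.
  exact/eqP.
apply/(key_ltP _ _ (XS t) (X_sorted t) r0); exists u => // c' c'c.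
by apply: uY; rewrite mem_iota.
Qed.

Let measurable_atom i j : measurable_fun setT (fun t => X t i.+1 j).
Proof.
elim/ltn_ind: i j => i ih j; have := measurable_next_key j.+1 ih.
by congr measurable_fun; apply/funext => t; rewrite key_coord.
Qed.

(** The point is recovered from its power sums in a measurable way. By [threshold_class] the
weight that the atoms put on a box of keys is measurable; by [key_ltP] this determines the
next atom, one key after the other, from the previous ones; and what is missing in the power
sums of the unit blocks is the dust. *)
Lemma measurable_point i j : measurable_fun setT (fun t => X t i j).
Proof.
case: i => [|i]; last exact: measurable_atom.
have E t : X t 0%N j = power_sum (X t) (unit_count j) -
    fine (\esum_(i in [set: nat]) (X t i.+1 j)%:E).
  have := power_sum_unit (XS t) j; rewrite esum_nat_recl; last by move=> i; rewrite lee_fin.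
  case: (\esum_(i in _) _) => [s /= [->]||]//; first by rewrite addrK.
under eq_fun do rewrite E; apply: measurable_funB; first exact/mX/nonempty_unit.
apply: measurableT_comp; first exact: fine_measurable.
rewrite (_ : (fun t => _) = fun t => (\sum_(i <oo) (X t i.+1 j)%:E)%E); last first.
  by apply/funext => t; rewrite nneseries_esumT// => i; rewrite lee_fin.
apply: ge0_emeasurable_sum => [i t _ _|i _]; first by rewrite lee_fin.
exact/measurable_EFinP.
Qed.

End RandomPoint.

(** * Measurability of the sampling functions *)

Section KingmanPoints.
Variables (R : realType) (q : nat).

Lemma coords_simplex (x : kingman_simplex R q) : in_simplex (coords x).
Proof.
have [x0 _ x1] : kingman_set R q (coords x) by exact: set_valP.
split=> //; rewrite -x1 nneseries_esumT; last by move=> i; rewrite lee_fin sumr_ge0.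
by apply: eq_esum => i _; rewrite vnorm_sum.
Qed.

Lemma coords_sorted (x : kingman_simplex R q) i :
  (1 <= i)%N -> shortlex_le (coords x i.+1) (coords x i).
Proof.
have [_ h _] : kingman_set R q (coords x) by exact: set_valP.
exact: h.
Qed.

Lemma kingman_of_coords y : in_simplex y ->
  (forall i, (1 <= i)%N -> shortlex_le (y i.+1) (y i)) ->
  exists x : kingman_simplex R q, coords x = y.
Proof.
move=> [y0 y1] y_sorted.
have yK : kingman_set R q y.
  split=> //; rewrite -y1 nneseries_esumT; last by move=> i; rewrite lee_fin sumr_ge0.
  by apply: eq_esum => i _; rewrite vnorm_sum.
by exists (exist _ (y : {ptws nat -> {ptws 'I_q -> R}}) (mem_set yK)).
Qed.

End KingmanPoints.

Section MeasurableSampling.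
Context d (T : measurableType d) (R : realType) (q : nat) (X : T -> nat -> 'I_q -> R).
Hypothesis XS : forall t, in_simplex (X t).

Lemma measurable_power_sum b : (forall i j, measurable_fun setT (fun t => X t i j)) ->
  nonempty_block b -> measurable_fun setT (fun t => power_sum (X t) b).
Proof.
move=> mX b0; apply: measurableT_comp; first exact: fine_measurable.
have X0 t i j : 0 <= X t i j by have [+ _] := XS t.
have ge0 t i : (0 <= (if (i == 0%N) && ~~ is_unit b then 0 else monomial (X t i) b : R)%:E)%E.
  by rewrite lee_fin; case: ifP => // _; exact: monomial_ge0.
rewrite (_ : (fun t => _) = fun t => (\sum_(i <oo)
    (if (i == 0%N) && ~~ is_unit b then 0 else monomial (X t i) b : R)%:E)%E); last first.
  by apply/funext => t; rewrite nneseries_esumT.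
apply: ge0_emeasurable_sum => [i t _ _|i _]; first exact: ge0.
apply/measurable_EFinP; case: ((i == 0%N) && ~~ is_unit b); first exact: measurable_cst.
by apply: measurable_prod => j _; exact: measurable_funX.
Qed.

Lemma measurable_sampling l :
  (forall b, nonempty_block b -> measurable_fun setT (fun t => power_sum (X t) b)) ->
  all nonempty_block l -> measurable_fun setT (fun t => sampling (X t) l).
Proof.
move=> mX; move Es: (size l) => n; elim: n l Es => [|n ih] [|b l] //=.
  rewrite (_ : (fun t => _) = fun=> 1); first by move=> *; exact: measurable_cst.
  by apply/funext => t; rewrite sampling_nil.
case=> sz /andP[b0 l0].
rewrite (_ : (fun t => _) = fun t => power_sum (X t) b * sampling (X t) l -
    \sum_(l' <- alterations (fun a => cadd a b) l) sampling (X t) l'); last first.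
  by apply/funext => t; rewrite sampling_rec// addrK.
apply: measurable_funB.
  by apply: measurable_funM; [exact: mX|exact: ih].
under eq_fun do rewrite big_seq_cond big_mkcond.
apply: measurable_sum => l'; rewrite andbT.
case: (boolP (l' \in _)) => [l'l|_]; last exact: measurable_cst.
by apply: ih; rewrite ?(size_alterations l'l)// (alterations_nonempty l0 l'l).
Qed.

End MeasurableSampling.

(** * Uniqueness of the mixing measure *)

Section Uniqueness.
Variables (R : realType) (q : nat) (mu nu : probability (borel_kingman_simplex R q) R).
Let K := borel_kingman_simplex R q.
Hypothesis samplingE : forall l, all nonempty_block l ->
  (\int[mu]_x (sampling (coords x) l)%:E = \int[nu]_x (sampling (coords x) l)%:E)%E.

Let mp b : nonempty_block b -> measurable_fun [set: K] (fun x => power_sum (coords x) b).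
Proof.
apply: measurable_power_sum => [x|i j]; [exact: coords_simplex|exact: measurable_coords].
Qed.

Let good (g : K -> R) := [/\ bounded_function g, measurable_fun setT g &
  (\int[mu]_x (g x)%:E = \int[nu]_x (g x)%:E)%E].

Let bounded_integrable (m : probability K R) (g : K -> R) : bounded_function g ->
  measurable_fun setT g -> m.-integrable setT (EFin \o g).
Proof.
move=> [C gC] mg; apply: (@le_integrable _ _ _ _ _ _ _ (cst C%:E)) => //.
- exact/measurable_EFinP.
- move=> x _ /=; rewrite lee_fin; apply: le_trans (gC x) _; exact: ler_norm.
- exact: finite_measure_integrable_cst.
Qed.

Let good_lin c g h : good g -> good h -> good (fun x => c * g x + h x).
Proof.
move=> [gb gm gE] [hb hm hE]; split; first exact: bounded_function_lin.
  by apply: measurable_funD => //; exact: measurable_funM.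
have int (m : probability K R) : (\int[m]_x (c * g x + h x)%:E =
    c%:E * \int[m]_x (g x)%:E + \int[m]_x (h x)%:E)%E.
  have ig := bounded_integrable m gb gm; have ih := bounded_integrable m hb hm.
  rewrite -integralZl// -integralD//; last exact: integrableZl.
by rewrite !int gE hE.
Qed.

Let good0 : good (fun=> 0).
Proof. by split; [exists 0 => p; rewrite normr0|exact: measurable_cst|rewrite !integral0]. Qed.

Let good_sum (I : eqType) (s : seq I) (g : I -> K -> R) :
  (forall i, i \in s -> good (g i)) -> good (fun p => \sum_(i <- s) g i p).
Proof.
elim: s => [|i s ih] gg; first by under eq_fun do rewrite big_nil.
have {}ih : good (fun p => \sum_(i <- s) g i p).
  by apply: ih => k ks; apply: gg; rewrite in_cons ks orbT.
have := good_lin 1 (gg i (mem_head _ _)) ih; congr good; apply/funext => p.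
by rewrite big_cons mul1r.
Qed.

Let good_lim (g : nat -> K -> R) h C : (forall n, good (g n)) ->
  (forall n p, `|g n p| <= C) -> (forall p, g n p @[n --> \oo] --> h p) -> good h.
Proof.
move=> gg gC gh; split; first exact: bounded_function_lim gC gh.
  apply: (measurable_fun_cvg (h := g)); last by move=> x _; exact: gh.
  by move=> n; have [] := gg n.
have int (m : probability K R) :
    (\int[m]_x (g n x)%:E @[n --> \oo] --> \int[m]_x (h x)%:E)%E.
  apply: (@dominated_cvg _ _ _ _ setT measurableT (fun n x => (g n x)%:E)
    (fun x => (h x)%:E) (cst C%:E)) => //.
  - by move=> n; apply/measurable_EFinP; have [] := gg n.
  - by move=> x _; apply: cvg_EFin; [exact: nearW|exact: gh].
  - exact: finite_measure_integrable_cst.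
  - by move=> n x _; rewrite lee_fin.
apply: cvg_unique (int mu) _ => //.
have -> : (fun n => \int[mu]_x (g n x)%:E)%E = (fun n => \int[nu]_x (g n x)%:E)%E.
  by apply/funext => n; have [] := gg n.
exact: int.
Qed.

Let good_sampling l : all nonempty_block l -> good (fun x => sampling (coords x) l).
Proof.
move=> l0; split; last exact: samplingE.
  exists 1 => x; rewrite ger0_norm; last exact: sampling_ge0 (coords_simplex x) _.
  exact: sampling_le1 (coords_simplex x) _ l0.
by apply: measurable_sampling => // x; exact: coords_simplex.
Qed.

Let block := {b : color_count q.+1 | nonempty_block b}.

Let psum (b : block) (x : K) : R := power_sum (coords x) (val b).

Let good_powers (s : seq block) : good (fun x => \prod_(b <- s) psum b x).
Proof.
suff h l : all nonempty_block l ->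
    good (fun x => sampling (coords x) l * \prod_(b <- s) psum b x).
  have := h [::] isT; congr good; apply/funext => x.
  by rewrite -[RHS]mul1r; congr (_ * _); exact: sampling_nil (coords_simplex x).
elim: s l => [|b s ih] l l0.
  have := good_sampling l0; congr good; apply/funext => x.
  by rewrite big_nil mulr1.
have bl0 : all nonempty_block (val b :: l) by rewrite /= l0 (valP b).
have := good_lin 1 (ih _ bl0) (@good_sum _ (alterations (fun a => cadd a (val b)) l) _
  (fun l' l'l => ih l' (alterations_nonempty l0 l'l))).
congr good; apply/funext => x; rewrite big_cons mul1r -mulr_suml -mulrDl.
by rewrite -(sampling_rec (coords_simplex x))// ?(valP b)// -mulrA mulrCA.
Qed.

Let psum01 b x : 0 <= psum b x <= 1.
Proof.
by rewrite (power_sum_ge0 (coords_simplex x)) (power_sum_le1 (coords_simplex x) (valP b)).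
Qed.

Let box (s : seq (block * R)) : set K := [set x | all (fun c => c.2 <= psum c.1 x) s].

Let boxes : set (set K) := range box.

Let measurable_box s : measurable (box s).
Proof.
apply: measurable_bool_set; elim: s => [|c s ih] /=; first exact: measurable_cst.
by apply: measurable_and => //; apply: measurable_fun_ler => //; apply: mp; exact: valP.
Qed.

Let box_eq s : mu (box s) = nu (box s).
Proof.
have [_ _] := @threshold_class R _ _ psum good psum01 good_lin good_lim good_powers s.
have ind (m : probability K R) :
    (\int[m]_x (\prod_(c <- s) (c.2 <= psum c.1 x)%R%:R)%:E)%E = m (box s).
  rewrite -(setIT (box s)) -integral_indic//; apply: eq_integral => x _.
  rewrite prod_indicator indicE; congr (_%:R%:E); congr nat_of_bool.
  by apply/idP/idP => [h|/set_mem//]; rewrite mem_set.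
by rewrite !ind.
Qed.

(** The boxes generate the Borel sets, because the coordinates of a point are measurable
functions of its power sums. *)
Let boxes_generate (E : set K) : measurable E -> <<s boxes >> E.
Proof.
move=> mE; pose T := g_sigma_algebraType boxes.
have mpT b : nonempty_block b -> measurable_fun [set: T] (fun x => power_sum (coords x) b).
  move=> b0; apply: (measurability _ (RGenCInfty.measurableE R)) => _ [_ [r ->] <-].
  rewrite setTI; apply: sub_sigma_algebra; exists [:: (exist _ b b0, r)] => //.
have mid : measurable_fun [set: T] (fun x : T => x : K).
  apply: measurable_to_kingman => i j; apply: measurable_point => //.
  - by move=> t; exact: coords_simplex.
  - by move=> t; exact: coords_sorted.
by have := mid measurableT E mE; rewrite setTI preimage_id.
Qed.

(** The two measures give the same integral to the products of a sampling function and power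
sums, hence by [threshold_class] the same mass to the boxes, which are stable under
intersection and generate the Borel sets. *)
Lemma kingman_measure_unique E : measurable E -> mu E = nu E.
Proof.
move=> /boxes_generate.
apply: (@g_sigma_algebra_measure_unique _ R K boxes _ (fun=> setT) _ _ mu nu) => //.
- by move=> _ [s _ <-]; exact: measurable_box.
- by move=> _; exists [::] => //; apply/seteqP; split => x.
- by apply/seteqP; split => // x _; exists 0%N.
- move=> _ _ [s _ <-] [s' _ <-]; exists (s ++ s') => //.
  by apply/seteqP; split => x; rewrite /box /= all_cat; move/andP.
- by move=> _ [s _ <-]; exact: box_eq.
- by move=> _; apply: le_lt_trans (probability_le1 mu measurableT) (ltry 1).
Qed.

End Uniqueness.

(** * Mixtures are partition structures *)

Section FiniteProbability.
Variables (R : realType) (q n : nat).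
Let T := chromatic_partition q.+1 n.

Lemma probability_sum1 (P : probability T R) : (\sum_(A : T) P [set A] = 1)%E.
Proof.
rewrite fsbig_seq ?index_enum_uniq// -measure_fin_bigcup//.
- rewrite (_ : \bigcup_(_ in _) _ = setT); first exact: probability_setT.
  by apply/seteqP; split=> // A _; exists A => //=; rewrite mem_index_enum.
- by move=> A B _ _ [C [/= -> ->]].
Qed.

Section Masses.
Variable p : T -> R.
Hypothesis p_ge0 : forall A, 0 <= p A.
Hypothesis p_sum1 : \sum_A p A = 1.

Let point_mass (k : nat) : {measure set T -> \bar R} :=
  let A := nth point (index_enum T) k in mscale (NngNum (p_ge0 A)) (dirac A).

Let mass := msum point_mass (size (index_enum T)).

Let massE E : mass E = (\sum_(A : T) (p A)%:E * \d_A E)%E.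
Proof.
by rewrite /mass /msum (big_nth point) big_mkord.
Qed.

Let mass_setT : mass setT = 1%E.
Proof.
rewrite massE; under eq_bigr do rewrite diracT mule1.
by rewrite sumEFin p_sum1.
Qed.

HB.instance Definition _ := Measure.on mass.
HB.instance Definition _ := Measure_isProbability.Build _ _ _ mass mass_setT.

Lemma finite_probability : exists P : probability T R, forall A, P [set A] = (p A)%:E.
Proof.
exists mass => A; rewrite [LHS]massE (bigD1 A)//= diracE mem_set// mule1.
rewrite big1 ?adde0// => B BA; rewrite diracE memNset ?mule0//= => BA'.
by move: BA; rewrite BA' eqxx.
Qed.

End Masses.
End FiniteProbability.

Section Kernels.
Variables (R : realType) (q : nat).

Lemma transition_ge0 l n (A B : {mset color_count q}%mset) : 0 <= transition R l n A B.
Proof.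
elim: n A => [|n ih] A /=; case: ifP => // _.
by rewrite sumr_ge0// => C _; rewrite mulr_ge0// transition1_ge0.
Qed.

Lemma falling_ratio_cvg (n : nat) :
  (N.+1%:R ^+ n / (N.+1 ^_ n)%:R : R) @[N --> \oo] --> (1 : R).
Proof.
suff h : ((N.+1 ^_ n)%:R / N.+1%:R ^+ n : R) @[N --> \oo] --> (1 : R).
  rewrite -[X in _ --> X]invr1; under eq_fun do rewrite -invf_div.
  by apply: cvgV.
elim: n => [|n ih].
  by under eq_fun do rewrite ffactn0 expr0 divr1; exact: cvg_cst.
have h : (1 - n%:R * N.+1%:R^-1 : R) @[N --> \oo] --> (1 : R).
  rewrite -[X in _ --> X](subr0 1); apply: cvgB; first exact: cvg_cst.
  rewrite -[X in _ --> X](mulr0 n%:R); apply: cvgMr; exact: cvg_harmonic.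
rewrite -[X in _ --> X](mulr1 1).
apply: cvg_trans (cvgM ih h); apply: near_eq_cvg; near=> N.
have nN : (n <= N.+1)%N by near: N; exists n => // m /= /leqW.
rewrite /= ffactnSr natrM natrB// exprSr invfM mulrACA; congr (_ * _).
by rewrite mulrBl divff// pnatr_eq0.
Unshelve. all: by end_near. Qed.

End Kernels.

Section Mixtures.
Variables (R : realType) (q : nat) (mu : probability (borel_kingman_simplex R q) R).
Let K := borel_kingman_simplex R q.

Lemma measurable_kingman_sampling l : all nonempty_block l ->
  measurable_fun [set: K] (fun x => sampling (coords x) l).
Proof.
apply: measurable_sampling => [x|b b0]; first exact: coords_simplex.
apply: measurable_power_sum => // [x|i j]; first exact: coords_simplex.
exact: measurable_coords.
Qed.

Definition mixture n (A : chromatic_partition q.+1 n) : \bar R :=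
  (\int[mu]_x (sampling_prob (coords x) A)%:E)%E.

Lemma integral_psi n (A : chromatic_partition q.+1 n) :
  (\int[mu]_x psi A (coords x) = mixture A)%E.
Proof.
apply: eq_integral => x _; have [x0 _] := coords_simplex x.
by rewrite psi_simplex//; exact: coords_simplex.
Qed.

Lemma mixture_sampling n (A : chromatic_partition q.+1 n) :
  mixture A = ((coef R A)%:E * \int[mu]_x (sampling (coords x) (enum_mset A))%:E)%E.
Proof.
rewrite -ge0_integralZl_EFin//.
- by move=> x _; rewrite lee_fin; exact: sampling_ge0 (coords_simplex x) _.
- apply/measurable_EFinP; apply: measurable_kingman_sampling; exact: chromatic_all.
- exact/ltW/coef_gt0.
Qed.

Lemma mixture_ge0 n (A : chromatic_partition q.+1 n) : (0 <= mixture A)%E.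
Proof.
by apply: integral_ge0 => x _; rewrite lee_fin; exact: sampling_prob_ge0 (coords_simplex x) _.
Qed.

Let measurable_prob n (A : chromatic_partition q.+1 n) :
  measurable_fun [set: K] (fun x => sampling_prob (coords x) A).
Proof.
apply: measurable_funM; first exact: measurable_cst.
apply: measurable_kingman_sampling; exact: chromatic_all.
Qed.

Let measurable_Eprob n (A : chromatic_partition q.+1 n) :
  measurable_fun [set: K] (fun x => (sampling_prob (coords x) A)%:E).
Proof. exact/measurable_EFinP. Qed.

Lemma mixture_chain m n (B : chromatic_partition q.+1 m) : (m <= n)%N ->
  mixture B = (\sum_(A : chromatic_partition q.+1 n) mixture A * (transition R m n A B)%:E)%E.
Proof.
move=> mn; rewrite /mixture.
under eq_integral do rewrite (sampling_prob_chain (coords_simplex _) _ mn) -sumEFin.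
rewrite ge0_integral_sum//.
- apply: eq_bigr => A _; under eq_integral do rewrite EFinM muleC.
  rewrite ge0_integralZl_EFin 1?muleC//; last exact: transition_ge0.
    by move=> x _; rewrite lee_fin; exact: sampling_prob_ge0 (coords_simplex x) _.
- move=> A; apply/measurable_EFinP; apply: measurable_funM; last exact: measurable_cst.
  exact: measurable_prob.
- move=> A x _; rewrite lee_fin mulr_ge0 ?transition_ge0//.
  exact: sampling_prob_ge0 (coords_simplex x) _.
Qed.

Lemma mixture_sum1 n : (\sum_(A : chromatic_partition q.+1 n) mixture A = 1)%E.
Proof.
rewrite /mixture -ge0_integral_sum//; last first.
  by move=> A x _; rewrite lee_fin; exact: sampling_prob_ge0 (coords_simplex x) _.
under eq_integral do rewrite sumEFin (sampling_prob_sum1 (coords_simplex _)).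
by rewrite integral_cst// mul1e; exact: probability_setT.
Qed.

Lemma mixture_fin n (A : chromatic_partition q.+1 n) : mixture A \is a fin_num.
Proof.
rewrite ge0_fin_numE ?mixture_ge0//; apply: (@le_lt_trans _ _ 1%E); last by rewrite ltry.
rewrite -(mixture_sum1 n) (bigD1 A)//= leeDl// sume_ge0// => B _; exact: mixture_ge0.
Qed.

Lemma mixture_structure : exists P : forall n, probability (chromatic_partition q.+1 n) R,
  represents mu P /\ partition_structure P.
Proof.
have ex n : exists P : probability (chromatic_partition q.+1 n) R,
    forall A, P [set A] = mixture A.
  have [||P PE] := @finite_probability R q n (fun A => fine (mixture A)).
  - by move=> A; rewrite fine_ge0// mixture_ge0.
  - apply: EFin_inj; rewrite -sumEFin -(mixture_sum1 n); apply: eq_bigr => A _.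
    by rewrite fineK// mixture_fin.
  - by exists P => A; rewrite PE fineK// mixture_fin.
exists (fun n => projT1 (cid (ex n))).
have PE n A : projT1 (cid (ex n)) [set A] = mixture A by case: cid.
split=> [n A|m n mn B]; first by rewrite PE integral_psi.
rewrite PE (mixture_chain _ mn); apply: eq_bigr => A _; by rewrite PE.
Qed.

End Mixtures.

(** * Partition structures are mixtures *)

Section Representation.
Variables (R : realType) (q : nat).
Variable P : forall n, probability (chromatic_partition q.+1 n) R.
Hypothesis P_structure : partition_structure P.

Let p n (A : chromatic_partition q.+1 n) : R := fine (P n [set A]).

Let pE n (A : chromatic_partition q.+1 n) : P n [set A] = (p A)%:E.
Proof. by rewrite /p fineK// fin_num_measure. Qed.

Let p_ge0 n (A : chromatic_partition q.+1 n) : 0 <= p A.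
Proof. by rewrite fine_ge0. Qed.

Let p_sum1 n : \sum_(A : chromatic_partition q.+1 n) p A = 1.
Proof.
apply: EFin_inj; rewrite -sumEFin -[RHS](probability_sum1 (P n)).
by apply: eq_bigr => A _; rewrite pE.
Qed.

Let p_chain m n (B : chromatic_partition q.+1 m) : (m <= n)%N ->
  p B = \sum_(A : chromatic_partition q.+1 n) p A * transition R m n A B.
Proof.
move=> mn; apply: EFin_inj; rewrite -pE (P_structure mn) -sumEFin.
by apply: eq_bigr => A _; rewrite pE.
Qed.

(** Consistency expresses [p B] as a mean of transitions from partitions of a large integer,
where by [transition_sampling] these are close to sampling from the empirical point. *)
Let mean_sampling_prob n (B : chromatic_partition q.+1 n) :
  (\sum_(A : chromatic_partition q.+1 N.+1) p A * sampling_prob (empirical R A) B)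
    @[N --> \oo] --> p B.
Proof.
apply/cvgrPdist_le => e e0.
have /cvgrPdist_le/(_ _ e0) := @falling_ratio_cvg R n.
apply: filterS2 (nbhs_infty_ge n) => N /= nN Ne.
rewrite (p_chain B (leqW nN)) -sumrB; apply: le_trans (ler_norm_sum _ _ _) _.
rewrite -[leRHS]mul1r -(p_sum1 N.+1) mulr_suml; apply: ler_sum => A _.
rewrite -mulrBr normrM ger0_norm// ler_wpM2l//.
apply: le_trans (transition_sampling _ A _ B (leqW nN)) _ => //.
by apply: le_trans Ne; rewrite distrC ler_norm.
Qed.

Let mean_sampling n (B : chromatic_partition q.+1 n) :
  (\sum_(A : chromatic_partition q.+1 N.+1) p A * sampling (empirical R A) (enum_mset B))
    @[N --> \oo] --> p B / coef R B.
Proof.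
rewrite (_ : (fun N => _) = fun N => (\sum_(A : chromatic_partition q.+1 N.+1)
    p A * sampling_prob (empirical R A) B) * (coef R B)^-1).
  by apply: cvgM; [exact: mean_sampling_prob|exact: cvg_cst].
apply/funext => N; rewrite mulr_suml; apply: eq_bigr => A _.
rewrite /sampling_prob -mulrA [X in _ = _ * X]mulrC.
by rewrite mulKf// gt_eqF// coef_gt0.
Qed.

Let point_law := {y : nat -> 'I_q.+1 -> R | in_simplex y}.

Let word k : seq (color_count q.+1) := odflt [::] (choice.unpickle k).

Let observable k (y : point_law) : R :=
  if all nonempty_block (word k) then sampling (sval y) (word k) else 0.

Let observable01 k y : 0 <= observable k y <= 1.
Proof.
rewrite /observable; case: ifP => [l0|_]; last by rewrite lexx ler01.
by rewrite (sampling_ge0 (svalP y)) (sampling_le1 (svalP y)).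
Qed.

Let empirical_point N (A : chromatic_partition q.+1 N.+1) : point_law :=
  exist _ (empirical R A) (empirical_simplex R A (ltn0Sn N)).

(** The random point in the limit of the empirical points: [random_limits] provides the limits
of their sampling functions, which by [sampling_closed] are the sampling functions of a point
of the simplex, and [measurable_point] makes it a measurable function. *)
Let limit_point : exists2 X : R -> kingman_simplex R q.+1,
  (forall i j, measurable_fun setT (fun omega => coords (X omega) i j)) &
  forall n (B : chromatic_partition q.+1 n),
    (\int[lebesgue_measure]_(omega in `[0%R, 1%R[)
      (sampling (coords (X omega)) (enum_mset B))%:E = (p B / coef R B)%:E)%E.
Proof.
have [s [ms s_lim s_int]] := random_limits observable01
  (I := fun N => chromatic_partition q.+1 N.+1)
  (p := fun N A => p A) (@empirical_point) (fun N A => p_ge0 A) (fun N => p_sum1 N.+1).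
have ex omega : exists x : kingman_simplex R q.+1,
    if 0 <= omega < 1 then forall l, all nonempty_block l ->
      sampling (coords x) l = s (choice.pickle l) omega
    else x = point.
  case: (boolP (0 <= omega < 1)) => [unit01|_]; last by exists point.
  have [|z z_lim] := s_lim omega; first by rewrite /= in_itv/=.
  have [|l l0|x [xS xsort xs]] := sampling_closed (y := fun n => sval (z n))
    (s := fun l => s (choice.pickle l) omega).
  - by move=> n; exact: svalP.
  - have := z_lim (choice.pickle l).
    by under eq_fun do rewrite /observable /word choice.pickleK /= l0.
  - have [x' x'E] := kingman_of_coords xS xsort.
    by exists x' => l l0; rewrite x'E xs.
have [X XP] := choice ex; exists X.
  move=> i j; apply: (@measurable_point _ _ R _ (fun omega : R => coords (X omega)))
    => [omega|omega|b b0].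
  - exact: coords_simplex.
  - exact: coords_sorted.
  rewrite (_ : (fun omega => _) = fun omega => if 0 <= omega < 1
      then s (choice.pickle [:: b]) omega
      else power_sum (coords (point : kingman_simplex R q.+1)) b); last first.
    apply/funext => omega; have := XP omega; case: (0 <= omega < 1) => [<-|-> //].
      by rewrite sampling1//; exact: coords_simplex.
    by rewrite /= b0.
  apply: measurable_fun_ifT => //.
  by apply: measurable_and; [exact: measurable_fun_ler|exact: measurable_fun_ltr].
move=> n B; have B0 := chromatic_all B.
rewrite -(s_int (choice.pickle (enum_mset (mset_of_cp B))) (p B / coef R B)).
  apply: eq_integral => omega; rewrite inE/= in_itv/= => unit01.
  by have := XP omega; rewrite unit01 => ->.
rewrite (_ : (fun N => _) = fun N => \sum_(A : chromatic_partition q.+1 N.+1)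
    p A * sampling (empirical R A) (enum_mset (mset_of_cp B))); first exact: mean_sampling.
apply/funext => N; apply: eq_bigr => A _.
by rewrite /observable /word choice.pickleK /= B0.
Qed.

Lemma structure_represented : exists mu : probability (borel_kingman_simplex R q) R,
  represents mu P.
Proof.
have [X0 mX0 X_int] := limit_point.
pose X : measurableTypeR R -> borel_kingman_simplex R q := X0.
have mX : measurable_fun setT X by exact: measurable_to_kingman.
pose XRV : {mfun measurableTypeR R >-> borel_kingman_simplex R q} :=
  HB.pack X (isMeasurableFun.Build _ _ _ _ X mX).
pose mu := distribution (uniform_prob (@ltr01 R)) XRV.
exists mu => n B; rewrite integral_psi mixture_sampling.
have mB : measurable_fun [set: borel_kingman_simplex R q]
    (fun x => (sampling (coords x) (enum_mset B))%:E).
  by apply/measurable_EFinP; exact: (measurable_kingman_sampling (chromatic_all B)).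
rewrite ge0_integral_distribution; last 2 first.
- exact: mB.
- by move=> x; rewrite lee_fin; exact: sampling_ge0 (coords_simplex x) _.
rewrite integral_uniform; last 2 first.
- exact: measurableT_comp mB mX.
- by move=> omega; rewrite lee_fin; exact: sampling_ge0 (coords_simplex _) _.
rewrite subr0 invr1 mul1e -integral_itv_bndo_bndc; last first.
  apply: measurable_funTS; exact: measurableT_comp mB mX.
by rewrite X_int -EFinM mulrCA divff ?mulr1 ?pE// gt_eqF// coef_gt0.
Qed.

End Representation.

Section RepresentedSampling.
Variables (R : realType) (q : nat).
Variable P : forall n, probability (chromatic_partition q.+1 n) R.
Variables mu nu : probability (borel_kingman_simplex R q) R.

Lemma represents_sampling_eq l : represents mu P -> represents nu P ->
  all nonempty_block l ->
  (\int[mu]_x (sampling (coords x) l)%:E = \int[nu]_x (sampling (coords x) l)%:E)%E.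
Proof.
move=> muP nuP l0.
have enum_l : perm_eq (enum_mset (seq_mset l)) l by exact: perm_eq_seq_mset.
have lP : is_chromatic_partition (weight (seq_mset l)) (seq_mset l).
  by rewrite is_chromatic_all (perm_all _ enum_l) l0 eqxx.
pose A := ChromaticPartition lP.
have int (m : probability (borel_kingman_simplex R q) R) : represents m P ->
    (\int[m]_x (sampling (coords x) l)%:E = (coef R A)^-1%:E * P _ [set A])%E.
  move=> mP; rewrite mP integral_psi mixture_sampling muleA -EFinM mulVf ?mul1e; last first.
    by rewrite gt_eqF// coef_gt0.
  by apply: eq_integral => x _; rewrite (sampling_perm _ enum_l).
by rewrite (int mu)// (int nu).
Qed.

End RepresentedSampling.

Theorem theorem1 (R : realType) (q : nat) :
  (forall mu : probability (borel_kingman_simplex R q) R,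
     exists P : forall n, probability (chromatic_partition q.+1 n) R,
       represents mu P /\ partition_structure P) /\
  (forall P : forall n, probability (chromatic_partition q.+1 n) R,
     partition_structure P ->
     exists mu : probability (borel_kingman_simplex R q) R,
       represents mu P /\
       forall nu : probability (borel_kingman_simplex R q) R,
         represents nu P ->
         forall E : set (borel_kingman_simplex R q),
           measurable E -> nu E = mu E).
Proof.
split=> [mu|P PS]; first exact: mixture_structure.
have [mu muP] := structure_represented PS; exists mu; split=> // nu nuP E mE.
apply: kingman_measure_unique mE => l l0; exact: represents_sampling_eq nuP muP l0.
Qed.
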